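(* (1) Let $A$ be a local statistical continuous $1$-form field, with associated tensor field $\tilde A$. If $A$ is invariant under sufficient statistics, then there is a continuous function $c:\mathbb{R}\to\mathbb{R}$ such that for all finite measures $\mu$ on $\Omega$ ($\Omega$ any measurable space) and all $V\in L^1(\Omega,\mu)$, $$\tilde A_\mu(V)=c\Big(\int_\Omega d\mu\Big)\cdot\int_\Omega V\,d\mu .$$ In particular, there is no nonzero weakly continuous $1$-form field on statistical models that is invariant under sufficient statistics. On a parametrized measure model $(M,\Omega,\mu,p)$ the field $A$ is expressed, for $x\in M$, $V\in T_xM$, by $$A(V)_x=c\Big(\int_\Omega dp(x)\Big)\cdot\partial_V\Big(\int_\Omega dp(x)\Big).$$ (2) Let $F$ be a local statistical continuous quadratic form field. If $F$ is invariant under sufficient statistics, then there are continuous functions $f,d:\mathbb{R}\to\mathbb{R}$ such that on every model $(M,\Omega,\mu,p)$ and for all $x\in M$, $$F(x)=f\Big(\int_\Omega dp(x)\Big)\,g^F(x)+d\Big(\int_\Omega dp(x)\Big)\,A(x)^2,$$ where $A$ is the field in (1) with $c=1$, i.e. $A(V)_x=\partial_V\big(\int_\Omega dp(x)\big)=\int_\Omega\partial_V\ln\bar p(x,\omega)\,dp(x)$, and $g^F$ is the Fisher quadratic form. In particular, the Fisher quadratic form is, up to a constant, the unique weakly continuous quadratic form field on statistical models that is invariant under sufficient statistics. (3) Let $T$ be a local statistical continuous covariant symmetric $3$-tensor field. If $T$ is invariant under sufficient statistics, then there are a continuous function $t:\mathbb{R}\to\mathbb{R}$ and fields $A_1,A_2$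 of the form described in (1) (i.e. $A_i(V)_x=c_i(\int_\Omega dp(x))\,\partial_V(\int_\Omega dp(x))$ with $c_i:\mathbb{R}\to\mathbb{R}$ continuous) such that on every model and for all $x\in M$, $$T(x)=t\Big(\int_\Omega dp(x)\Big)\,T^{AC}(x)+A_1(x)^3+A_2(x)\cdot g^F(x),$$ where $g^F$ and $T^{AC}$ are the Fisher quadratic form and the Amari-Chentsov tensor (and $A_2\cdot g^F$ is the symmetric product). In particular, the Amari-Chentsov tensor is, up to a constant, the unique weakly continuous symmetric $3$-tensor field on statistical models that is invariant under sufficient statistics.
   Context: Measures. For a measurable space $\Omega$, $\mathcal M(\Omega)$ is the set of finite non-negative measures on $\Omega$. For a $\sigma$-finite non-negative measure $\mu$, $\mathcal M_+(\Omega,\mu)=\{\phi\mu:\phi\in L^1(\Omega,\mu),\ \phi>0\}$ with the $L^1$-topology (via $\phi\mu\mapsto\phi$), and $\mathcal P_+(\Omega,\mu)$ is the subset of probability measures in it. Models. Let $k\ge1$. A $k$-integrable parametrized measure model is a quadruple $(M,\Omega,\mu,p)$, where $M$ is a smooth (finite or infinite dimensional) Banach manifold, $\mu$ is a $\sigma$-finite reference measure on $\Omega$, and $p:M\to\mathcal M_+(\Omega,\mu)$ is continuous, such that there is a density potential $\bar p:M\times\Omega\to\mathbb{R}$ with $p(x)=\bar p(x,\cdot)\mu$ for all $x$, satisfying: (i) for $\mu$-almost all $\omega$, $x\mapsto\ln\bar p(x,\omega)$ is defined and continuously Gâteaux-differentiable on $M$, i.e. $V\mapsto\partial_V\ln\bar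 p(x,\omega)$ is continuous on $TM$ and linear on each $T_xM$; (ii) for every continuous vector field $V$ on $M$, $\partial_V\ln\bar p(x,\cdot)\in L^k(\Omega,p(x))$ and $x\mapsto\|\partial_V\ln\bar p(x,\cdot)\|_{L^k(\Omega,p(x))}$ is continuous on $M$. It is a statistical model if $p(M)\subset\mathcal P_+(\Omega,\mu)$. Fisher quadratic form and Amari-Chentsov tensor: $g^F(V,W)_x=\int_\Omega\partial_V\ln\bar p\,\partial_W\ln\bar p\,dp(x)$, $\ T^{AC}(V,W,X)_x=\int_\Omega\partial_V\ln\bar p\,\partial_W\ln\bar p\,\partial_X\ln\bar p\,dp(x)$ (derivatives of $\bar p(x,\omega)$ in $x$). Tensor fields. A covariant $n$-tensor field on $\mathcal M(\Omega)$ assigns to each $\mu\in\mathcal M(\Omega)$ a multilinear map $\tau_\mu:\bigoplus^nL^n(\Omega,\mu)\to\mathbb{R}$ that is continuous (for each fixed $\mu$). A covariant $n$-tensor $\tau$ on a Banach manifold $M$ (an $n$-linear form on each $T_xM$) is weakly continuous if $\tau(V_1,\dots,V_n)$ is a continuous function on $M$ for all continuous vector fields $V_1,\dots,V_n$. A statistical covariant continuous $n$-tensor field $A$ assigns to each ($n$-integrable) parametrized measure model $(M,\Omega,\mu,p)$ a weakly continuous covariant $n$-tensor $A|_{(M,\Omega,\mu,p)}$ on $M$. It is local if there is a covariant $n$-tensor field $\tilde A$ on $\mathcal M(\Omega)$ with $$A|_{(M,\Omega,\mu,p)}(V_1,\dots,V_n)_x=\tilde A_{p(x)}(\partial_{V_1}\ln\bar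 p(x),\dots,\partial_{V_n}\ln\bar p(x))$$ for all models over $\Omega$, all $x\in M$ and $V_i\in T_xM$. A $1$-form field is the case $n=1$; a quadratic form field is the symmetric case $n=2$. Fields on statistical models are assignments of weakly continuous tensors to statistical models. Sufficiency. A statistic is a measurable map $\kappa:\Omega_1\to\Omega_2$. It is sufficient for the parameter $x\in M$ of a model $(M,\Omega_1,\mu_1,p_1)$ if there are $s:M\times\Omega_2\to\mathbb{R}$ with $s(x,\cdot)\in L^1(\Omega_2,\kappa_*\mu_1)$ for all $x$, and $t\in L^1(\Omega_1,\mu_1)$, such that for all $x\in M$, $\bar p_1(x,\omega_1)=s(x,\kappa(\omega_1))\,t(\omega_1)$ for $\mu_1$-a.e. $\omega_1$. A field $A$ is invariant under sufficient statistics if $A|_{(M,\Omega_1,\mu_1,p_1)}=A|_{(M,\Omega_2,\kappa_*\mu_1,\kappa_*p_1)}$ for every such model and every statistic $\kappa$ sufficient for its parameter.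
   Formalization: The coefficient functions are continuous on (0,∞) only (the field ∂_V ln∫dp forces c(r)=1/r); fields on statistical models are also assumed local (else dx on models with M=R, 0 elsewhere, is a counterexample); Banach manifolds are Hausdorff and regular, so that all scores lie in L^n. *)

(* Defs.v *)
From HB Require Import structures.
From mathcomp Require Import all_boot all_order all_algebra all_fingroup.
From mathcomp Require Import all_classical all_reals all_analysis.

Set Implicit Arguments.
Unset Strict Implicit.
Unset Printing Implicit Defensive.

Import Order.TTheory GRing.Theory Num.Theory.
Import numFieldNormedType.Exports.

Local Open Scope classical_set_scope.
Local Open Scope ring_scope.

(* [D x s] is the value of the iterated Frechet derivative D^n f(x), with
   n = size s, at the n-tuple of vectors s: for x in U it is a bounded n-linear
   map, D^0 f = f, and D^n f is differentiable at x in the operator norm of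
   n-linear maps with derivative D^(n+1) f(x). *)
Definition smooth_on (R : realType) (E F : normedModType R) (U : set E)
    (f : E -> F) : Prop :=
  exists D : E -> seq E -> F, forall x, U x ->
    [/\ D x [::] = f x,
        forall (s t : seq E) (a : R) (u v : E),
          D x (s ++ (a *: u + v) :: t) =
            a *: D x (s ++ u :: t) + D x (s ++ v :: t),
        forall n : nat, exists C : R, forall s : seq E, size s = n ->
          `|D x s| <= C * \prod_(v <- s) `|v|
      & forall (n : nat) (e : R), 0 < e -> \forall h \near (0 : E),
          forall s : seq E, size s = n ->
          `|D (x + h) s - D x s - D x (h :: s)|
            <= e * `|h| * \prod_(v <- s) `|v| ].

Record chart (R : realType) (M : topologicalType) := Chart {
  chart_space : completeNormedModType R ;
  chart_dom : set M ;
  chart_map : M -> chart_space ;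
  chart_inv : chart_space -> M }.
Arguments chart_inv {R M} c _.

Definition chart_range (R : realType) (M : topologicalType) (c : chart R M) :=
  chart_map c @` chart_dom c.
Arguments chart_range {R M} c _.

Definition is_chart (R : realType) (M : topologicalType) (c : chart R M) :=
  [/\ open (chart_dom c), open (chart_range c),
      forall x, chart_dom c x -> chart_inv c (chart_map c x) = x,
      {within chart_dom c, continuous (chart_map c)}
    & {within chart_range c, continuous (chart_inv c)} ].

Definition smooth_transition (R : realType) (M : topologicalType)
    (c c' : chart R M) :=
  smooth_on (chart_map c @` (chart_dom c `&` chart_dom c'))
            (chart_map c' \o chart_inv c).

(* Finite-dimensional and, more generally, paracompact Hausdorff manifolds are
   regular; regularity ensures that every tangent vector is the value of a
   continuous vector field on the whole manifold. *)
Record banach_manifold (R : realType) := BanachManifold {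
  manifold_sort :> topologicalType ;
  atlas : chart R manifold_sort -> Prop ;
  atlas_chart : forall c, atlas c -> is_chart c ;
  atlas_cover : forall x, exists c, atlas c /\ chart_dom c x ;
  atlas_smooth : forall c c', atlas c -> atlas c' -> smooth_transition c c' ;
  manifold_hausdorff : hausdorff_space manifold_sort ;
  manifold_regular : regular_space manifold_sort }.

Section tangent.
Context {R : realType} {M : banach_manifold R}.

Definition chart_at (x : M) : chart R M := sval (cid (atlas_cover x)).

(* T_x M, read in the chart [chart_at x]. *)
Definition tangent (x : M) : completeNormedModType R :=
  chart_space (chart_at x).

(* Coordinates of a tangent vector at x in another chart c around x. *)
Definition tangent_coord (c : chart R M) (x : M) (v : tangent x) :
    chart_space c :=
  'd (chart_map c \o chart_inv (chart_at x)) (chart_map (chart_at x) x) v.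
Arguments tangent_coord c {x} v.

(* Continuity into TM, which carries the topology of the bundle charts
   (chart_dom c) x (chart_space c). *)
Definition continuous_vector_field (V : forall x : M, tangent x) : Prop :=
  forall c, atlas c ->
    {within chart_dom c, continuous (fun x => tangent_coord c (V x))}.

Definition tangent_derive (f : M -> R) (x : M) (v : tangent x) : R :=
  'D_v (f \o chart_inv (chart_at x)) (chart_map (chart_at x) x).

Definition tangent_derivable (f : M -> R) (x : M) (v : tangent x) : Prop :=
  derivable (f \o chart_inv (chart_at x)) (chart_map (chart_at x) x) v.

Definition is_tangent_derive (f : M -> R) (x : M) (v : tangent x) (l : R) :=
  is_derive (chart_map (chart_at x) x) v (f \o chart_inv (chart_at x)) l.

Definition continuously_gateaux (f : M -> R) : Prop :=
  forall c, atlas c ->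
    [/\ forall y, chart_range c y ->
          forall v, derivable (f \o chart_inv c) y v,
        forall y, chart_range c y ->
          scalar (fun v => 'D_v (f \o chart_inv c) y)
      & {within chart_range c `*` setT, continuous
          (fun yv : chart_space c * chart_space c =>
             'D_(yv.2) (f \o chart_inv c) yv.1)} ].

End tangent.

Section models.
Context {R : realType}.

(* nu = phi mu with phi in L^1(mu), phi > 0. *)
Definition positive_density d (Omega : measurableType d)
    (mu nu : {measure set Omega -> \bar R}) (phi : Omega -> R) : Prop :=
  [/\ phi \in Lfun mu 1%E,
      {ae mu, forall w, 0 < phi w}
    & forall A, measurable A -> nu A = (\int[mu]_(w in A) (phi w)%:E)%E ].

(* p takes its values in M_+(Omega, mu) and is continuous for the L^1-topology
   given by phi mu |-> phi. *)
Definition continuous_to_Mplus (M : topologicalType) d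
    (Omega : measurableType d) (mu : {measure set Omega -> \bar R})
    (p : M -> {finite_measure set Omega -> \bar R}) : Prop :=
  exists2 phi : M -> Omega -> R,
    forall x, positive_density mu (p x) (phi x)
  & forall x, Lnorm mu 1%E (EFin \o (phi y \- phi x)) @[y --> x] --> 0%E.

(* w |-> (d_v ln pbar)(x, w). *)
Definition dlog (M : banach_manifold R) (Omega : Type)
    (pbar : M -> Omega -> R) (x : M) (v : tangent x) : Omega -> R :=
  fun w => tangent_derive (fun y => ln (pbar y w)) v.

Definition density_potential (k : nat) (M : banach_manifold R) d
    (Omega : measurableType d) (mu : {measure set Omega -> \bar R})
    (p : M -> {finite_measure set Omega -> \bar R})
    (pbar : M -> Omega -> R) : Prop :=
  [/\ forall x, positive_density mu (p x) (pbar x),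
      {ae mu, forall w, (forall x, 0 < pbar x w) /\
                        continuously_gateaux (fun x => ln (pbar x w))}
    & forall V : forall x : M, tangent x, continuous_vector_field V ->
        (forall x, dlog pbar (V x) \in Lfun (p x) k%:R%:E) /\
        continuous (fun x => fine (Lnorm (p x) k%:R%:E (EFin \o dlog pbar (V x)))) ].

(* k-integrable parametrized measure models (M, Omega, mu, p). *)
Record measure_model (k : nat) (M : banach_manifold R) d
    (Omega : measurableType d) := MeasureModel {
  reference : {sigma_finite_measure set Omega -> \bar R} ;
  param : M -> {finite_measure set Omega -> \bar R} ;
  param_continuous : continuous_to_Mplus reference param ;
  param_potential : exists pbar, density_potential k reference param pbar }.

Definition potential k (M : banach_manifold R) d (Omega : measurableType d)
    (m : measure_model k M Omega) (pbar : M -> Omega -> R) : Prop :=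
  density_potential k (reference m) (param m) pbar.

(* The total mass, x |-> \int_Omega dp(x). *)
Definition mass k (M : banach_manifold R) d (Omega : measurableType d)
    (m : measure_model k M Omega) (x : M) : R :=
  fine (param m x setT).

Definition is_statistical k (M : banach_manifold R) d
    (Omega : measurableType d) (m : measure_model k M Omega) : Prop :=
  forall x, param m x setT = 1%E.

Definition fisher k (M : banach_manifold R) d (Omega : measurableType d)
    (m : measure_model k M Omega) (pbar : M -> Omega -> R)
    (x : M) (v w : tangent x) : R :=
  \int[param m x]_o (dlog pbar v o * dlog pbar w o).

Definition amari_chentsov k (M : banach_manifold R) d
    (Omega : measurableType d) (m : measure_model k M Omega)
    (pbar : M -> Omega -> R) (x : M) (u v w : tangent x) : R :=
  \int[param m x]_o (dlog pbar u o * dlog pbar v o * dlog pbar w o).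

(* A(v)_x = c(\int dp(x)) d_v(\int dp(x)). *)
Definition mass_form (c : R -> R) k (M : banach_manifold R) d
    (Omega : measurableType d) (m : measure_model k M Omega)
    (x : M) (v : tangent x) : R :=
  c (mass m x) * tangent_derive (mass m) v.

(* The symmetric product of a 1-form and a quadratic form, normalized so that
   its value at (v, v, v) is a(v) g(v, v). *)
Definition symmetric_product (E : Type) (a : E -> R) (g : E -> E -> R)
    (u v w : E) : R :=
  (a u * g v w + a v * g u w + a w * g u v) / 3.

Definition multilinear_form n (E : lmodType R) (f : ('I_n -> E) -> R) : Prop :=
  forall (i : 'I_n) (u : 'I_n -> E), scalar (fun v => f (dfwith u i v)).

Definition symmetric_form n (E : Type) (f : ('I_n -> E) -> R) : Prop :=
  forall (s : 'S_n) (u : 'I_n -> E), f (fun i => u (s i)) = f u.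

(* Continuous n-linear maps on L^n(mu); elements of L^n are represented by
   functions, and the values of [tau] outside L^n are irrelevant. Continuity in
   the seminorm makes [tau] insensitive to modifications on mu-null sets. *)
Definition continuous_multilinear_Ln n d (Omega : measurableType d)
    (mu : {measure set Omega -> \bar R}) (tau : ('I_n -> Omega -> R) -> R) :=
  let Ln : {pred Omega -> R} := Lfun mu n%:R%:E in
  (forall (i : 'I_n) (u : 'I_n -> Omega -> R) (a : R) (v w : Omega -> R),
     (forall j, u j \in Ln) -> v \in Ln -> w \in Ln ->
     tau (dfwith u i (a *: v + w)) =
       a * tau (dfwith u i v) + tau (dfwith u i w)) /\
  (forall u : 'I_n -> Omega -> R, (forall j, u j \in Ln) ->
     forall e : R, 0 < e -> exists2 r : R, 0 < r &
       forall v : 'I_n -> Omega -> R, (forall j, v j \in Ln) ->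
         (forall j, fine (Lnorm mu n%:R%:E (EFin \o (v j \- u j))) < r) ->
         `|tau v - tau u| < e).

(* Candidate n-tensor fields on the finite measures of every measurable space,
   and on n-integrable models. *)
Definition Ln_family n := forall d (Omega : measurableType d),
  {finite_measure set Omega -> \bar R} -> ('I_n -> Omega -> R) -> R.

Definition tensor_family n :=
  forall (M : banach_manifold R) d (Omega : measurableType d),
    measure_model n M Omega -> forall x : M, ('I_n -> tangent x) -> R.

Definition model_class n :=
  forall (M : banach_manifold R) d (Omega : measurableType d),
    measure_model n M Omega -> Prop.

Definition all_models n : model_class n := fun M d Omega m => True.

Definition statistical_models n : model_class n :=
  fun M d Omega m => is_statistical m.

Definition covariant_tensor_field n (tau : Ln_family n) : Prop :=
  forall d (Omega : measurableType d)
    (mu : {finite_measure set Omega -> \bar R}),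
    continuous_multilinear_Ln mu (tau d Omega mu).

(* In the following, fields on a class P of models are total functions whose
   values on models outside P are irrelevant. *)
Definition continuous_field n (P : model_class n) (A : tensor_family n) :=
  forall M d (Omega : measurableType d) (m : measure_model n M Omega), P M d Omega m ->
    (forall x, multilinear_form (A M d Omega m x)) /\
    (forall V : 'I_n -> forall x : M, tangent x,
       (forall i, continuous_vector_field (V i)) ->
       continuous (fun x => A M d Omega m x (fun i => V i x))).

Definition symmetric_field n (P : model_class n) (A : tensor_family n) :=
  forall M d (Omega : measurableType d) (m : measure_model n M Omega), P M d Omega m ->
    forall x, symmetric_form (A M d Omega m x).

Definition local_field n (P : model_class n) (A : tensor_family n)
    (tau : Ln_family n) : Prop :=
  forall M d (Omega : measurableType d) (m : measure_model n M Omega), P M d Omega m ->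
  forall pbar, potential m pbar ->
  forall (x : M) (V : 'I_n -> tangent x),
    A M d Omega m x V = tau d Omega (param m x) (fun i => dlog pbar (V i)).

(* [pushforward mu kappa] as a measure. *)
Definition image_measure d1 d2 (Omega1 : measurableType d1)
    (Omega2 : measurableType d2) (mu : {measure set Omega1 -> \bar R})
    (kappa : {mfun Omega1 >-> Omega2}) : {measure set Omega2 -> \bar R} :=
  measure_function_pushforward__canonical__measure_function_Measure mu
    (measurable_funPT kappa).

Definition sufficient k (M : banach_manifold R) d1 d2
    (Omega1 : measurableType d1) (Omega2 : measurableType d2)
    (m : measure_model k M Omega1) (kappa : {mfun Omega1 >-> Omega2}) : Prop :=
  exists pbar (s : M -> Omega2 -> R) (t : Omega1 -> R),
    [/\ potential m pbar,
        forall x, s x \in Lfun (image_measure (reference m) kappa) 1%E,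
        t \in Lfun (reference m) 1%E
      & forall x, {ae reference m, forall w,
          pbar x w = s x (kappa w) * t w} ].

(* m2 is the model (M, Omega2, kappa_* mu1, kappa_* p1). *)
Definition image_model k (M : banach_manifold R) d1 d2
    (Omega1 : measurableType d1) (Omega2 : measurableType d2)
    (kappa : {mfun Omega1 >-> Omega2})
    (m1 : measure_model k M Omega1) (m2 : measure_model k M Omega2) : Prop :=
  (forall B, measurable B ->
     reference m2 B = image_measure (reference m1) kappa B) /\
  (forall x B, measurable B -> param m2 x B = image_measure (param m1 x) kappa B).

Definition sufficient_invariant n (P : model_class n) (A : tensor_family n) :=
  forall M d1 d2 (Omega1 : measurableType d1) (Omega2 : measurableType d2)
    (m1 : measure_model n M Omega1) (m2 : measure_model n M Omega2)
    (kappa : {mfun Omega1 >-> Omega2}),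
    P M d1 Omega1 m1 -> sufficient m1 kappa -> image_model kappa m1 m2 ->
    forall (x : M) (V : 'I_n -> tangent x),
      A M d1 Omega1 m1 x V = A M d2 Omega2 m2 x V.

Definition local_invariant_field n (P : model_class n) (A : tensor_family n)
    (tau : Ln_family n) : Prop :=
  [/\ continuous_field P A, covariant_tensor_field tau, local_field P A tau
    & sufficient_invariant P A].

End models.

(* Main.v *)
Require Import Defs.
From HB Require Import structures.
From mathcomp Require Import all_boot all_order all_algebra all_fingroup.
From mathcomp Require Import all_classical all_reals all_analysis.
From mathcomp Require Import measurable_realfun ring lra.

Set Implicit Arguments.
Unset Strict Implicit.
Unset Printing Implicit Defensive.

Import Order.TTheory GRing.Theory Num.Theory.
Import numFieldNormedType.Exports.

Local Open Scope classical_set_scope.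
Local Open Scope ring_scope.

(** The tensor [tau] of a local invariant field is determined by its values on
    tuples of indicators. Exponential families over a finite partition realize
    any tuple of finitely valued functions as scores, and the partition map is a
    sufficient statistic, so on finitely valued functions [tau] depends on their
    joint law only. Subtracting a combination of products of integrals
    \int u_i u_j ... dmu makes [tau] vanish on indicators of n equal cells;
    multilinearity and invariance under refinement extend this to N equal cells
    with n | N, and continuity of [tau] to L^n(mu). Weak continuity of the field
    along the family exp(s) mu makes the coefficients continuous in the mass.

    For the derivative of the mass, Fatou's lemma is applied to Riemann sums of
    the score along a segment, since no domination is assumed. For the existence
    of the Fisher and Amari-Chentsov fields, scores are limits of difference
    quotients along one sequence of points; hence they depend, up to null sets,
    only on the ratios of densities, which a sufficient statistic preserves. *)

(** * Limits of integrals *)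

(** Indicators of equal cells enter [tau] only through their coincidences, that is, through a
    partition of the n indices. Products of integrals over the blocks of such a partition are law
    invariant too, and the product is non-zero at a tuple of cells exactly when the tuple is
    constant on each block. Matching [tau] with these products is thus a triangular system, solved
    upwards from the tuple of distinct cells; the coefficients come from it. As n cells realize
    every partition of n indices, n cells are enough for the test.

    All laws are compared on [[0, r[] with Lebesgue measure, where a staircase has any prescribed
    finite law of mass r. Mass zero is apart: all tuples are then at distance zero, which forces a
    continuous multilinear form to vanish.

    A tensor field takes a model as a whole record, so two spaces with the same law are compared by
    mapping both onto literally one model over [nat]. On statistical models, products with an
    isolated index vanish at the scores, so at most one coefficient survives in degree at most
    three. *)

Section fatou_tools.
Context d (T : measurableType d) (R : realType).
Variable mu : {measure set T -> \bar R}.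

Lemma le_limn_einf (u : (\bar R)^nat) (x : R) :
  (forall e, 0 < e -> \forall n \near \oo, (x%:E <= u n + e%:E)%E) ->
  (x%:E <= limn_einf u)%E.
Proof.
move=> xu; rewrite limn_einf_lim; apply/lee_addgt0Pr => e e0.
rewrite -leeBlDr//; apply: lime_ge; first exact: is_cvg_einfs.
have [N _ xuN] := xu e e0; exists N => // n Nn /=.
apply: le_ereal_inf_tmp => _ [m /= nm <-] /=.
rewrite EFinN leeBlDr//; apply: xuN => /=; exact: leq_trans nm.
Qed.

Lemma limn_einf_le (u : (\bar R)^nat) (x : \bar R) :
  (forall n, exists2 m, (n <= m)%N & (u m <= x)%E) -> (limn_einf u <= x)%E.
Proof.
move=> ux; rewrite limn_einf_lim; apply: lime_le; first exact: is_cvg_einfs.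
apply: nearW => n; have [m nm umx] := ux n.
by apply: le_trans umx; apply: ereal_inf_lbound; exists m.
Qed.

(** The hypotheses are those that later arguments can supply: a pointwise lower bound up to every
    [e] instead of a limit, and a bound on the integrals along infinitely many indices only. *)
Lemma fatou_le (f_ : nat -> T -> R) (f : T -> R) (c : \bar R) :
  (forall n, measurable_fun setT (f_ n)) -> measurable_fun setT f ->
  (forall n x, 0 <= f_ n x) -> (forall x, 0 <= f x) ->
  {ae mu, forall x, forall e, 0 < e -> \forall n \near \oo, f x <= f_ n x + e} ->
  (forall n, exists2 m, (n <= m)%N & (\int[mu]_x (f_ m x)%:E <= c)%E) ->
  (\int[mu]_x (f x)%:E <= c)%E.
Proof.
move=> mf_ mf f_0 f0 ff_ fc.
have mE n : measurable_fun setT (EFin \o f_ n) by exact/measurable_EFinP.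
have := @fatou _ _ _ mu setT measurableT (fun n => EFin \o f_ n) mE.
have fge0 n x : setT x -> (0 <= (EFin \o f_ n) x)%E by move=> _; rewrite lee_fin.
move=> /(_ fge0) fatouf; apply: (le_trans (le_trans _ fatouf)); last first.
  exact: limn_einf_le.
apply: ae_ge0_le_integral => //.
- by move=> x _; rewrite lee_fin.
- exact/measurable_EFinP.
- move=> x _; apply: le_limn_einf => e e0; apply: nearW => n.
  by rewrite -EFinD lee_fin addr_ge0// ltW.
- have -> : (fun x => limn_einf (fun n => (f_ n x)%:E)) =
      (fun x => - limn_esup (fun n => - (f_ n x)%:E))%E by [].
  apply: measurableT_comp => //; apply: measurable_fun_limn_esup => n.
  by apply: measurableT_comp => //; exact: mE.
- apply: filterS ff_ => x fx _; apply: le_limn_einf => e e0.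
  by have := fx e e0; apply: filterS => n; rewrite -EFinD lee_fin.
Qed.

Lemma fine_integral_le (f : T -> R) (c : R) : mu.-integrable setT (EFin \o f) ->
  (\int[mu]_x f x <= c) = (\int[mu]_x (f x)%:E <= c%:E)%E.
Proof.
by move=> fi; rewrite -lee_fin /Rintegral fineK// integrable_fin_num.
Qed.

Lemma integrable_EFinD (f g : T -> R) : mu.-integrable setT (EFin \o f) ->
  mu.-integrable setT (EFin \o g) -> mu.-integrable setT (EFin \o (f \+ g)).
Proof.
by move=> fi gi; rewrite (_ : _ \o _ = (EFin \o f) \+ (EFin \o g))%E//;
  exact: integrableD.
Qed.

Lemma integrable_EFinB (f g : T -> R) : mu.-integrable setT (EFin \o f) ->
  mu.-integrable setT (EFin \o g) -> mu.-integrable setT (EFin \o (f \- g)).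
Proof.
by move=> fi gi; rewrite (_ : _ \o _ = (EFin \o f) \- (EFin \o g))%E//;
  exact: integrableB.
Qed.

Lemma integrable_EFinZ (k : R) (f : T -> R) : mu.-integrable setT (EFin \o f) ->
  mu.-integrable setT (EFin \o (k \*: f)).
Proof.
move=> fi; rewrite (_ : _ \o _ = (fun x => k%:E * (EFin \o f) x)%E)//.
exact: integrableZl.
Qed.

Lemma integrable_EFin_sum (I : Type) (s : seq I) (f : I -> T -> R) :
  (forall i, mu.-integrable setT (EFin \o f i)) ->
  mu.-integrable setT (EFin \o (fun x => \sum_(i <- s) f i x)).
Proof.
move=> fi; elim: s => [|i s IHs].
  rewrite (_ : _ \o _ = cst 0%E); first exact: integrable0.
  by apply/funext => x /=; rewrite big_nil.
rewrite (_ : _ \o _ = EFin \o (f i \+ (fun x => \sum_(i <- s) f i x))).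
  exact: integrable_EFinD.
by apply/funext => x /=; rewrite big_cons.
Qed.

Lemma Rintegral_sum (I : Type) (s : seq I) (f : I -> T -> R) :
  (forall i, mu.-integrable setT (EFin \o f i)) ->
  \int[mu]_x (\sum_(i <- s) f i x) = \sum_(i <- s) \int[mu]_x f i x.
Proof.
move=> fi; elim: s => [|i s IHs].
  rewrite big_nil; under eq_Rintegral do rewrite big_nil.
  by rewrite /Rintegral integral0.
under eq_Rintegral do rewrite big_cons.
by rewrite RintegralD// ?IHs ?big_cons//; exact: integrable_EFin_sum.
Qed.

Lemma integrable_measurable (f : T -> R) : mu.-integrable setT (EFin \o f) ->
  measurable_fun setT f.
Proof. by move=> /integrableP[/measurable_EFinP]. Qed.

Lemma le_integrable_norm (f g : T -> R) : measurable_fun setT f ->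
  (forall x, `|f x| <= g x) -> mu.-integrable setT (EFin \o g) ->
  mu.-integrable setT (EFin \o f).
Proof.
move=> mf fg; apply: le_integrable => //; first exact/measurable_EFinP.
by move=> x _; rewrite /= lee_fin (le_trans (fg x))// ler_norm.
Qed.

Lemma Rintegral_opp (f : T -> R) : mu.-integrable setT (EFin \o f) ->
  \int[mu]_x (- f x) = - \int[mu]_x f x.
Proof.
move=> fi; under eq_Rintegral do rewrite -mulN1r.
by rewrite RintegralZl// mulN1r.
Qed.

(* Pratt's form of dominated convergence, with varying dominating functions; an
   upper bound on the limit of their integrals is enough. *)
Lemma pratt (f_ G_ : nat -> T -> R) (f G : T -> R) :
  (forall n, measurable_fun setT (f_ n)) -> measurable_fun setT f ->
  (forall n x, `|f_ n x| <= G_ n x) -> (forall x, `|f x| <= G x) ->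
  (forall n, mu.-integrable setT (EFin \o G_ n)) ->
  mu.-integrable setT (EFin \o G) ->
  {ae mu, forall x, f_ ^~ x @ \oo --> f x} ->
  {ae mu, forall x, G_ ^~ x @ \oo --> G x} ->
  (forall e, 0 < e -> \forall n \near \oo, \int[mu]_x G_ n x <= \int[mu]_x G x + e) ->
  (\int[mu]_x f_ n x) @[n --> \oo] --> \int[mu]_x f x.
Proof.
(* One-sided estimate by contradiction: if the integral of [f_ n] stays [e] below that of [f] for
   infinitely many n, Fatou's lemma for [f_ n + G_ n >= 0] loses [e] on [f] and regains at most
   [e / 2] on [G]. The other side is the same estimate for the opposite functions. *)
have half (f_' G_' : nat -> T -> R) (f' G' : T -> R) :
  (forall n, measurable_fun setT (f_' n)) -> measurable_fun setT f' ->
  (forall n x, `|f_' n x| <= G_' n x) -> (forall x, `|f' x| <= G' x) ->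
  (forall n, mu.-integrable setT (EFin \o G_' n)) ->
  mu.-integrable setT (EFin \o G') ->
  {ae mu, forall x, f_' ^~ x @ \oo --> f' x} ->
  {ae mu, forall x, G_' ^~ x @ \oo --> G' x} ->
  (forall e, 0 < e -> \forall n \near \oo, \int[mu]_x G_' n x <= \int[mu]_x G' x + e) ->
  forall e, 0 < e -> \forall n \near \oo, \int[mu]_x f' x - \int[mu]_x f_' n x < e.
  move=> {f_ G_ f G}; move: f_' G_' f' G' => f_ G_ f G.
  move=> mf_ mf fG_ fG iG_ iG ff GG GGe e e0.
  have if_ n : mu.-integrable setT (EFin \o f_ n).
    exact: (le_integrable_norm _ (fG_ n)).
  have i_f : mu.-integrable setT (EFin \o f).
    exact: (le_integrable_norm _ fG).
  apply: contrapT => nn.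
  have {nn}fr n : exists2 m, (n <= m)%N & e <= \int[mu]_x f x - \int[mu]_x f_ m x.
    apply: contrapT => nm; apply: nn; exists n => // m /= nm'.
    by rewrite ltNge; apply/negP => fm; apply: nm; exists m.
  have e2 : 0 < e / 2 by rewrite divr_gt0.
  have [N _ GN] := GGe _ e2.
  have h : (\int[mu]_x ((f \+ G) x)%:E <=
      (\int[mu]_x f x + \int[mu]_x G x - e / 2)%:E)%E.
    apply: (@fatou_le (fun n => f_ n \+ G_ n)).
    - move=> n; apply: measurable_funD => //; exact: integrable_measurable.
    - by apply: measurable_funD => //; exact: integrable_measurable.
    - by move=> n x; have := fG_ n x; rewrite ler_norml /= => /andP[]; lra.
    - by move=> x; have := fG x; rewrite ler_norml /= => /andP[]; lra.
    - apply: filterS2 ff GG => x fx Gx r r0.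
      have : (f_ n x + G_ n x) @[n --> \oo] --> f x + G x by exact: cvgD.
      move=> /cvgrPdist_lt/(_ _ r0); apply: filterS => n /=.
      by rewrite ltr_distl => /andP[_]; lra.
    - move=> n; have [m nm fm] := fr (maxn n N).
      exists m; first by rewrite (leq_trans _ nm)// leq_maxl.
      rewrite -fine_integral_le; last exact: integrable_EFinD.
      rewrite RintegralD//.
      have /= := GN m; rewrite (leq_trans _ nm) ?leq_maxr// => /(_ isT).
      lra.
  move: h; rewrite -fine_integral_le; last exact: integrable_EFinD.
  by rewrite RintegralD//; lra.
move=> mf_ mf fG_ fG iG_ iG ff GG GGe.
have if_ n : mu.-integrable setT (EFin \o f_ n) by exact: (le_integrable_norm _ (fG_ n)).
have i_f : mu.-integrable setT (EFin \o f) by exact: (le_integrable_norm _ fG).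
apply/cvgrPdist_lt => e e0.
have h1 := half f_ G_ f G mf_ mf fG_ fG iG_ iG ff GG GGe e e0.
have h2 : \forall n \near \oo, \int[mu]_x (- f x) - \int[mu]_x (- f_ n x) < e.
  apply: (half (fun n x => - f_ n x) G_ (fun x => - f x) G) => //.
  - by move=> n; exact: measurableT_comp.
  - exact: measurableT_comp.
  - by move=> n x; rewrite normrN.
  - by move=> x; rewrite normrN.
  - by apply: filterS ff => x; exact: cvgN.
apply: filterS2 h1 h2 => n.
rewrite !Rintegral_opp// => ? ?; rewrite ltr_norml; apply/andP; split; lra.
Qed.

End fatou_tools.

(** * Differentiation under an integral without domination *)

Section derivative_under_integral.
Context (R : realType).

Lemma MVT_abs (g b : R -> R) (x y : R) :
  (forall s, `|s - x| <= `|y - x| -> is_derive s 1 g (b s)) ->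
  exists2 c, `|c - x| <= `|y - x| & `|g y - g x| = `|b c| * `|y - x|.
Proof.
move=> gb.
have [xy|yx|<-] := ltgtP x y; last first.
- by exists x; rewrite ?subrr ?normr0 ?mulr0.
- have dg s : s \in `]y, x[ -> is_derive s 1 g (b s).
    rewrite in_itv /= => /andP[ys sx]; apply: gb.
    by rewrite !ltr0_norm ?subr_lt0//; lra.
  have cg : {within `[y, x], continuous g}.
    apply: derivable_within_continuous => s; rewrite in_itv /= => /andP[ys sx].
    suff /(@ex_derive _ _ _ _ _ _ _) : is_derive s 1 g (b s) by [].
    by apply: gb; rewrite !ler0_norm ?subr_le0//; lra.
  have [c] := MVT yx dg cg; rewrite in_itv /= => /andP[yc cx] gE.
  exists c; first by rewrite !ltr0_norm ?subr_lt0//; lra.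
  by rewrite distrC gE normrM (distrC x).
- have dg s : s \in `]x, y[ -> is_derive s 1 g (b s).
    rewrite in_itv /= => /andP[ys sx]; apply: gb.
    by rewrite !gtr0_norm ?subr_gt0//; lra.
  have cg : {within `[x, y], continuous g}.
    apply: derivable_within_continuous => s; rewrite in_itv /= => /andP[ys sx].
    suff /(@ex_derive _ _ _ _ _ _ _) : is_derive s 1 g (b s) by [].
    by apply: gb; rewrite !ger0_norm ?subr_ge0//; lra.
  have [c] := MVT xy dg cg; rewrite in_itv /= => /andP[yc cx] gE.
  exists c; first by rewrite !gtr0_norm ?subr_gt0//; lra.
  by rewrite gE normrM.
Qed.

(** [b] is uniformly continuous on a compact segment. The mean value theorem on each subinterval
    produces [b] at an intermediate point, and replacing that point by the end nearer to 0 costs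
    [eta] per unit length. *)
Lemma riemann_sum_bound (g b : R -> R) (t : R) :
  (forall s : R, `|s| <= `|t| -> is_derive s 1 g (b s)) ->
  (forall s : R, `|s| <= `|t| -> {for s, continuous b}) ->
  forall e, 0 < e -> \forall N \near \oo,
    `|g t - g 0| <= \sum_(i < N.+1) `|t| / N.+1%:R * `|b (t * (i%:R / N.+1%:R))| + e.
Proof.
move=> gb cb e e0.
have t1 : 0 < `|t| + 1 by rewrite ltr_wpDl.
(* The [+ 1] keeps the denominator positive when [t = 0]. *)
pose eta := e / (`|t| + 1).
have eta0 : 0 < eta by rewrite divr_gt0.
have cK := @segment_compact R (- `|t|) `|t|.
have/compact_near_coveringP ncK := cK.
pose P (N : nat) (s : R) := forall y, `|y - s| <= `|t| / N.+1%:R -> `|b y - b s| < eta.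
have [N0 _ PN] : \forall N \near \oo, `[(- `|t|), `|t|]%classic `<=` P N.
  apply: ncK => s; rewrite /= in_itv /= -ler_norml => st.
  have := cb _ st; rewrite /prop_for /continuous_at => /cvgrPdist_lt.
  have eta20 : 0 < eta / 2 by rewrite divr_gt0.
  move=> /(_ _ eta20) /nbhs_ballP[r /= r0 br].
  have r40 : 0 < r / 4 by rewrite divr_gt0.
  exists (ball s (r / 4), [set N | `|t| / N.+1%:R < r / 4]).
    split; first exact: nbhsx_ballx.
    have [N1 _ HN1] := near_infty_natSinv_lt (PosNum (divr_gt0 r40 t1)).
    exists N1 => // n /HN1 /=; rewrite ltr_pdivlMr// => h.
    apply: le_lt_trans h; rewrite mulrC ler_wpM2l ?invr_ge0//; lra.
  move=> [x n] [/= xs nr] y yx.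
  have bsx := br x; rewrite /ball /= in bsx xs.
  have bsy := br y; rewrite /ball /= in bsy.
  have h1 : `|b s - b x| < eta / 2 by apply: bsx; apply: lt_trans xs _; lra.
  have h2 : `|b s - b y| < eta / 2.
    have key (s' x' y' c : R) : `|s' - x'| < r / 4 -> `|y' - x'| <= c -> c < r / 4 ->
        `|s' - y'| < r.
      by have := ler_distD x' s' y'; rewrite (distrC x' y'); lra.
    by apply: bsy; exact: key xs yx nr.
  have key (s' x' y' c : R) : `|s' - x'| < c / 2 -> `|s' - y'| < c / 2 -> `|y' - x'| < c.
    by have := ler_distD s' y' x'; rewrite (distrC y' s'); lra.
  exact: key h1 h2.
exists N0 => // N NN; have {}PN := PN N NN.
have N1 : 0 < N.+1%:R :> R by [].
pose s (i : nat) : R := t * (i%:R / N.+1%:R).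
have sS i : s i.+1 - s i = t / N.+1%:R.
  by rewrite /s -mulrBr -mulrBl -natr1 addrAC subrr add0r mul1r.
have sle i : (i <= N.+1)%N -> `|s i| <= `|t|.
  move=> iN; rewrite /s normrM ler_piMr// ger0_norm ?divr_ge0//.
  by rewrite ler_pdivrMr// mul1r ler_nat.
have -> : g t - g 0 = \sum_(i < N.+1) (g (s i.+1) - g (s i)).
  rewrite -(big_mkord xpredT (fun i => g (s i.+1) - g (s i))) telescope_sumr//.
  by rewrite /s mul0r mulr0 divff ?mulr1// lt0r_neq0.
have -> : e = \sum_(i < N.+1) (e / N.+1%:R).
  by rewrite sumr_const card_ord -[RHS]mulr_natr divfK// lt0r_neq0.
rewrite -big_split /=; apply: le_trans (ler_norm_sum _ _ _) _.
apply: ler_sum => -[i iN] _ /=; rewrite -/(s i).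
have seg c : `|c - s i| <= `|s i.+1 - s i| -> `|c| <= `|t|.
  rewrite sS normrM normfV (ger0_norm (ltW N1)) => ci.
  have ii : (i < N.+1)%N by [].
  have hc : `|c| <= `|c - s i| + `|s i|.
    by rewrite -[in leLHS](subrK (s i) c) ler_normD.
  apply: le_trans hc _; apply: le_trans (lerD ci (lexx _)) _.
  rewrite /s normrM (ger0_norm (_ : 0 <= i%:R / N.+1%:R)) ?divr_ge0//.
  rewrite -mulrDr ler_piMr// -[X in X + _]mul1r -mulrDl ler_pdivrMr// mul1r.
  by rewrite -(natrD _ 1 i) ler_nat.
have [c cs ->] := @MVT_abs g b (s i) (s i.+1) (fun c hc => gb c (seg c hc)).
rewrite sS normrM normfV (ger0_norm (ltW N1)) in cs *.
have bc : `|b c - b (s i)| < eta.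
  apply: (PN (s i)) => //; rewrite /= in_itv /= -ler_norml; apply: sle; exact: ltnW.
have bc' : `|b c| <= `|b (s i)| + eta.
  have : `|b c| <= `|b c - b (s i)| + `|b (s i)|.
    by rewrite -[in leLHS](subrK (b (s i)) (b c)) ler_normD.
  lra.
rewrite mulrC; apply: le_trans (ler_wpM2l _ bc') _; first by rewrite divr_ge0.
rewrite mulrDr lerD2l /eta mulrAC ler_pM2r ?invr_gt0//.
by rewrite mulrA ler_pdivrMr// mulrC ler_pM2l//; lra.
Qed.

Context d (T : measurableType d) (mu : {measure set T -> \bar R}).

Section usc.
Variables (u b : R -> T -> R) (r : R).
Hypothesis r0 : 0 < r.
Hypothesis iu : forall s, `|s| < r -> mu.-integrable setT (EFin \o u s).
Hypothesis ib : forall s, `|s| < r -> mu.-integrable setT (EFin \o b s).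
Hypothesis ub : {ae mu, forall w, forall s : R, `|s| < r ->
  is_derive s 1 (u ^~ w) (b s w) /\ {for s, continuous (b ^~ w)}}.
Hypothesis usc_b : forall e, 0 < e -> \forall s \near (0 : R),
  \int[mu]_w `|b s w| <= \int[mu]_w `|b 0 w| + e.

Let norm0r : `|0 : R| < r. Proof. by rewrite normr0. Qed.

(* Riemann sums of [|b s w|] in s dominate [|u t w - u 0 w|] in the limit, so
   Fatou's lemma replaces Tonelli's theorem and no joint measurability is needed. *)
Let increment_le (t K : R) : `|t| < r ->
  (forall s, `|s| <= `|t| -> \int[mu]_w `|b s w| <= K) ->
  \int[mu]_w `|u t w - u 0 w| <= `|t| * K.
Proof.
move=> tr bK.
have sr (N i : nat) : (i <= N.+1)%N -> `|t * (i%:R / N.+1%:R)| <= `|t|.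
  move=> iN; rewrite normrM ler_piMr// ger0_norm ?divr_ge0//.
  by rewrite ler_pdivrMr// mul1r ler_nat.
have sr' N (i : 'I_N.+1) : `|t * (i%:R / N.+1%:R)| < r.
  by apply: le_lt_trans tr; apply: sr; exact: ltnW.
have iS N : mu.-integrable setT
    (EFin \o (fun w => \sum_(i < N.+1) `|t| / N.+1%:R * `|b (t * (i%:R / N.+1%:R)) w|)).
  apply: integrable_EFin_sum => i.
  have := integrable_EFinZ (`|t| / N.+1%:R) (integrable_norm (ib (sr' N i))).
  exact.
rewrite fine_integral_le; last first.
  exact: integrable_norm (integrable_EFinB (iu tr) (iu norm0r)).
apply: (@fatou_le _ _ _ mu (fun N w => \sum_(i < N.+1) `|t| / N.+1%:R * `|b (t * (i%:R / N.+1%:R)) w|)).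
- by move=> N; exact: integrable_measurable (iS N).
- exact: integrable_measurable (integrable_norm (integrable_EFinB (iu tr) (iu norm0r))).
- by move=> N w; apply: sumr_ge0 => i _; rewrite mulr_ge0// divr_ge0.
- by [].
- apply: filterS ub => w ubw e e0.
  have := @riemann_sum_bound (u ^~ w) (b ^~ w) t _ _ e e0; apply.
  + by move=> s st; apply: (ubw s _).1; exact: le_lt_trans tr.
  + by move=> s st; apply: (ubw s _).2; exact: le_lt_trans tr.
- move=> n; exists n => //; rewrite -fine_integral_le//.
  have -> : \int[mu]_x (\sum_(i < n.+1) `|t| / n.+1%:R * `|b (t * (i%:R / n.+1%:R)) x|) =
      \sum_(i < n.+1) `|t| / n.+1%:R * \int[mu]_x `|b (t * (i%:R / n.+1%:R)) x|.
    rewrite Rintegral_sum; last first.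
      move=> k; have := integrable_EFinZ (`|t| / n.+1%:R) (integrable_norm (ib (sr' n k))).
      exact.
    apply: eq_bigr => k _; rewrite RintegralZl//.
    exact: integrable_norm (ib (sr' n k)).
  have : \sum_(i < n.+1) `|t| / n.+1%:R * \int[mu]_x `|b (t * (i%:R / n.+1%:R)) x| <=
      \sum_(i < n.+1) `|t| / n.+1%:R * K.
    apply: ler_sum => i _; apply: ler_wpM2l; first by rewrite divr_ge0.
    by apply: bK; apply: sr; exact: ltnW.
  move=> /le_trans; apply.
  by rewrite sumr_const card_ord -[leLHS]mulr_natl mulrA [_ * (_ / _)]mulrC divfK// lt0r_neq0.
Qed.

(** The difference quotients [D n] are their own dominating functions in [pratt]: [increment_le] and
    the upper semicontinuity of the L^1-norm of [b s] at 0 bound the integrals of [|D n|] by that of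
    [|b 0|] up to [e]. *)
Lemma is_derive_Rintegral :
  is_derive (0 : R) 1 (fun s => \int[mu]_w u s w) (\int[mu]_w b 0 w).
Proof.
pose q (h : R) := h^-1 *: ((\int[mu]_w u h w) - \int[mu]_w u 0 w).
suff h : q h @[h --> 0^'] --> \int[mu]_w b 0 w.
  have {}h : h^-1 *: (((fun s => \int[mu]_w u s w) \o shift 0) (h *: 1) - \int[mu]_w u 0 w)
      @[h --> 0^'] --> \int[mu]_w b 0 w.
    apply: cvg_trans h; apply: near_eq_cvg; apply: nearW => s /=.
    by rewrite /q addr0 [_ *: 1]mulr1.
  apply: DeriveDef; first by apply/cvg_ex; exists (\int[mu]_w b 0 w).
  by apply/cvg_lim.
apply/cvgr_dnbhsP => v [v0 vcvg].
have vr : \forall n \near \oo, `|v n| < r.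
  by move/cvgrPdist_lt : vcvg => /(_ _ r0); apply: filterS => n; rewrite sub0r normrN.
case: vr => N0 _ vr.
pose v' n := v (n + N0)%N.
have v'r n : `|v' n| < r by apply: vr => /=; rewrite leq_addl.
have v'0 n : v' n != 0 by exact: v0.
have v'cvg : v' n @[n --> \oo] --> (0 : R) by rewrite cvg_shiftn.
rewrite -(cvg_shiftn N0) /= /q.
pose D n w := (v' n)^-1 * (u (v' n) w - u 0 w).
have iD n : mu.-integrable setT (EFin \o D n).
  have := integrable_EFinZ ((v' n)^-1) (integrable_EFinB (iu (v'r n)) (iu norm0r)).
  exact.
have -> : (fun n => (v (n + N0)%N)^-1 *: ((\int[mu]_w u (v (n + N0)%N) w) - \int[mu]_w u 0 w))
    = (fun n => \int[mu]_w D n w).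
  apply/funext => n; rewrite -RintegralB//; [|exact: iu (v'r n)|exact: iu norm0r].
  by rewrite -[LHS]RintegralZl//; exact: integrable_EFinB (iu (v'r n)) (iu norm0r).
have Db : {ae mu, forall w, D ^~ w @ \oo --> b 0 w}.
  apply: filterS ub => w ubw.
  have [[dw <-] _] := ubw 0 norm0r.
  have /cvgr_dnbhsP/(_ v') := dw.
  move=> /(_ (conj v'0 v'cvg)); apply: cvg_trans; apply: near_eq_cvg; apply: nearW => n /=.
  by rewrite addr0 /D [_ *: 1]mulr1.
apply: (@pratt _ _ _ mu D (fun n w => `|D n w|) (b 0) (fun w => `|b 0 w|)) => //.
- by move=> n; exact: integrable_measurable (iD n).
- exact: integrable_measurable (ib norm0r).
- by move=> n; exact: integrable_norm (iD n).
- exact: integrable_norm (ib norm0r).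
- by apply: filterS Db => w; exact: cvg_norm.
- move=> e e0; have /nbhs_ballP[rho /= rho0 rhob] := usc_b e0.
  move/cvgrPdist_lt : v'cvg => /(_ _ rho0); apply: filterS => n; rewrite sub0r normrN => vq.
  have -> : \int[mu]_x `|D n x| = `|v' n|^-1 * \int[mu]_x `|u (v' n) x - u 0 x|.
    rewrite -RintegralZl//; last first.
      exact: integrable_norm (integrable_EFinB (iu (v'r n)) (iu norm0r)).
    by apply: eq_Rintegral => x _; rewrite /D normrM normfV.
  rewrite ler_pdivrMl ?normr_gt0//; apply: increment_le => // s sv.
  by apply: rhob; rewrite /ball /= sub0r normrN (le_lt_trans sv).
Qed.

End usc.
End derivative_under_integral.

(** * Derivatives in charts *)

Section frechet.
Context (R : realType).

(** The remainder estimate of order 0 makes [D x [:: v]] the differential. That of order 1, with the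
    bound on the bilinear map [D x [:: h; v]], shows that the differential at [v] moves by
    [O(|h|)]. *)
Lemma smooth_on_C1 (E F : normedModType R) (U : set E) (f : E -> F) :
  open U -> smooth_on U f -> forall x, U x ->
  differentiable f x /\ forall v, {for x, continuous (fun y => 'd f y v)}.
Proof.
move=> oU [D HD].
have dD x : U x -> differentiable f x /\ forall v, 'd f x v = D x [:: v].
  move=> Ux; have [_ lin bnd near0] := HD x Ux.
  pose df := fun v => D x [:: v].
  have ldf : linear df by move=> a u v; exact: (lin [::] [::]).
  pose dfM := GRing.isLinear.Build _ _ _ _ _ ldf.
  pose dfL : {linear E -> F} := HB.pack df dfM.
  have [C bC] := bnd 1%N.
  have cdf : continuous dfL.
    apply/linear_bounded_continuous/linear_boundedP.
    exists `|C|; split; first by rewrite ger0_real.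
    move=> M CM v; have := bC [:: v] erefl; rewrite big_seq1 => /le_trans; apply.
    by apply: ler_wpM2r => //; rewrite (le_trans (ler_norm _))// ltW.
  have fE : f \o shift x = cst (f x) + dfL +o_ (0 : E) id.
    have Uxh : \forall h \near 0, U (x + h).
      have := oU; rewrite openE => /(_ _ Ux).
      by rewrite /interior -{1}[x]addr0 => /nbhs0P; rewrite addr0.
    apply/eqaddoP => e e0; apply: filterS2 Uxh (near0 0%N e e0) => h Uxh /(_ [::] erefl).
    rewrite big_nil mulr1 => h0.
    have [D0 _ _ _] := HD _ Uxh; have [D0x _ _ _] := HD _ Ux.
    rewrite /= [X in `|X|](_ : _ = D (x + h) [::] - D x [::] - D x [:: h])//.
    by rewrite D0 D0x !fctE /= opprD addrA [h + x]addrC.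
  have ddf : 'd f x = dfL :> (E -> F) by exact: diff_unique.
  split; last by move=> v; rewrite ddf.
  by apply/diff_locallyP; rewrite ddf.
move=> x Ux; split; first exact: (dD x Ux).1.
move=> v; have [_ _ bnd near0] := HD x Ux.
have Unear : \forall y \near x, U y by move: oU; rewrite openE => /(_ _ Ux).
rewrite /prop_for /continuous_at (dD x Ux).2.
suff h : D y [:: v] @[y --> x] --> D x [:: v].
  apply: cvg_trans h; apply: near_eq_cvg; apply: filterS Unear => y Uy.
  by rewrite (dD y Uy).2.
apply/cvgrPdist_le => e e0.
have [C bC] := bnd 2%N.
have v1 : 0 < `|v| + 1 by rewrite ltr_wpDl.
have C1 : 0 < `|C| + 1 by rewrite ltr_wpDl.
have Cv : 0 < (`|C| + 1) * (`|v| + 1) by rewrite mulr_gt0.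
apply/nbhs0P.
have e' : 0 < e / ((`|C| + 1) * (`|v| + 1)) by rewrite divr_gt0.
have hs : \forall h \near 0, `|h : E| <= e / ((`|C| + 1) * (`|v| + 1)).
  by apply/nbhs_normP; exists (e / ((`|C| + 1) * (`|v| + 1))) => //= y; rewrite /= sub0r normrN => /ltW.
apply: filterS2 hs (near0 1%N 1 ltr01) => h hs /(_ [:: v] erefl) h1.
have := bC [:: h; v] erefl.
rewrite big_cons !big_seq1 mul1r in h1 * => h2.
rewrite distrC.
have -> : D (x + h) [:: v] - D x [:: v] =
  (D (x + h) [:: v] - D x [:: v] - D x [:: h; v]) + D x [:: h; v] by rewrite subrK.
apply: le_trans (ler_normD _ _) _.
apply: (@le_trans _ _ (`|h| * ((`|C| + 1) * (`|v| + 1)))); last by rewrite -ler_pdivlMr.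
apply: le_trans (lerD h1 h2) _.
have -> : `|h| * `|v| + C * (`|h| * `|v|) = `|h| * ((C + 1) * `|v|) by ring.
rewrite ler_wpM2l//; apply: (@le_trans _ _ ((`|C| + 1) * `|v|)).
  by rewrite ler_wpM2r// lerD2r ler_norm.
by rewrite ler_wpM2l ?(ltW C1)// lerDl.
Qed.

Lemma is_derive_segment (F : normedModType R) (g : F -> R) (y k : F) (s : R) :
  derivable g (s *: k + y) k ->
  is_derive s 1 (fun t : R => g (t *: k + y)) ('D_k g (s *: k + y)).
Proof.
move=> dg.
have e : (fun h : R => h^-1 *: (((fun t : R => g (t *: k + y)) \o shift s) (h *: 1) -
             g (s *: k + y))) =
         (fun h : R => h^-1 *: ((g \o shift (s *: k + y)) (h *: k) - g (s *: k + y))).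
  by apply/funext => h /=; rewrite [h *: 1]mulr1 scalerDl addrA.
apply: DeriveDef; first by rewrite /derivable e.
by rewrite /derive e.
Qed.

Lemma is_derive_line (F : normedModType R) (g : F -> R) (y k : F) (l : R) :
  is_derive (0 : R) 1 (fun t : R => g (t *: k + y)) l -> is_derive y k g l.
Proof.
have e : (fun h : R => h^-1 *: (((fun t : R => g (t *: k + y)) \o shift 0) (h *: 1) -
             g (0 *: k + y))) =
         (fun h : R => h^-1 *: ((g \o shift y) (h *: k) - g y)).
  by apply/funext => h /=; rewrite [h *: 1]mulr1 addr0 scale0r add0r.
move=> [dg <-]; rewrite /derivable e in dg.
by apply: DeriveDef => //; rewrite /derive e.
Qed.

(** A chain rule in which [g] is Gateaux differentiable only. With [f (h v + x) = h q(h) + f x] and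
    [q(h)] tending to ['d f x v], the mean value theorem on the straight segment between the two
    values of [f] gives [h] times the derivative of [g] along [q(h)] at an intermediate point; joint
    continuity of that derivative concludes. *)
Lemma is_derive_gateaux_comp (E F : normedModType R) (W : set F) (f : E -> F)
    (g : F -> R) (x v : E) :
  open W -> W (f x) -> differentiable f x ->
  (forall y, W y -> forall w, derivable g y w) ->
  (forall y, W y -> scalar (fun w => 'D_w g y)) ->
  {for (f x, 'd f x v), continuous (fun yw : F * F => 'D_(yw.2) g yw.1)} ->
  is_derive x v (g \o f) ('D_('d f x v) g (f x)).
Proof.
move=> oW Wfx df dg lg cg.
have dfv : derivable f x v by exact: diff_derivable.
pose q (h : R) := h^-1 *: (f (h *: v + x) - f x).
have qcvg : q h @[h --> 0^'] --> 'd f x v.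
  by have := @ex_derive _ _ _ _ _ _ _ (derivableP dfv); rewrite /derivable -deriveE.
have fE h : h != 0 -> f (h *: v + x) = h *: q h + f x.
  by move=> h0; rewrite /q scalerA divff// scale1r subrK.
have [rho rho0 rhoW] : exists2 rho, 0 < rho & forall y, `|f x - y| < rho -> W y.
  by have := oW; rewrite openE => /(_ _ Wfx) /nbhs_normP[rho /= rho0 h]; exists rho.
pose K := `|'d f x v| + 1.
have K0 : 0 < K by rewrite ltr_wpDl.
have qK : \forall h \near 0^', `|q h| < K.
  have nq : `|q h| @[h --> 0^'] --> `|'d f x v| by exact: cvg_norm.
  move/cvgrPdist_lt : nq => /(_ _ ltr01); apply: filterS => h.
  by rewrite ltr_distlC => /andP[].
suff key : h^-1 *: ((g \o f) (h *: v + x) - (g \o f) x) @[h --> 0^'] --> 'D_('d f x v) g (f x).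
  apply: DeriveDef; first by apply/cvg_ex; eexists; exact: key.
  exact/cvg_lim.
apply/cvgrPdist_lt => e e0.
move: cg; rewrite /prop_for /continuous_at /= => /cvgrPdist_lt/(_ _ e0).
move=> [[A B] /= [nA nB] AB].
have [a a0 aA] : exists2 a, 0 < a & forall y, `|f x - y| < a -> A y.
  by have /nbhs_normP[a /= a0 h] := nA; exists a.
near=> h.
have h0 : h != 0 by near: h; exact: nbhs_dnbhs_neq.
have qhK : `|q h| < K by near: h; exact: qK.
have qB : B (q h) by near: h; exact: qcvg.
have hs : `|h| < Num.min rho a / K.
  near: h; apply: nbhs_dnbhs; apply/nbhs_normP; exists (Num.min rho a / K).
    by rewrite /= divr_gt0// lt_min rho0.
  by move=> y /=; rewrite sub0r normrN.
have seg (s : R) : 0 <= s <= 1 -> `|f x - (s *: (h *: q h) + f x)| < Num.min rho a.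
  move=> /andP[s0 s1]; rewrite opprD addrC addrNK normrN normrZ normrZ.
  apply: (@le_lt_trans _ _ (`|h| * `|q h|)).
    by rewrite ler_piMl ?mulr_ge0// ger0_norm.
  apply: (@le_lt_trans _ _ (`|h| * K)); first by rewrite ler_wpM2l// ltW.
  by rewrite -ltr_pdivlMr.
have segW (s : R) : 0 <= s <= 1 -> W (s *: (h *: q h) + f x).
  by move=> /seg; rewrite lt_min => /andP[/rhoW].
have dG (s : R) : 0 <= s <= 1 -> is_derive s 1 (fun t : R => g (t *: (h *: q h) + f x))
    ('D_(h *: q h) g (s *: (h *: q h) + f x)).
  by move=> s01; apply: is_derive_segment; apply: dg; exact: segW.
have dG' (s : R) : s \in `]0, 1[ -> is_derive s 1 (fun t : R => g (t *: (h *: q h) + f x))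
    ('D_(h *: q h) g (s *: (h *: q h) + f x)).
  by rewrite in_itv /= => /andP[/ltW s0 /ltW s1]; apply: dG; rewrite s0.
have cG : {within `[0, 1], continuous (fun t : R => g (t *: (h *: q h) + f x))}.
  apply: derivable_within_continuous => s; rewrite in_itv /= => s01.
  exact: (@ex_derive _ _ _ _ _ _ _ (dG s s01)).
have [s] := MVT ltr01 dG' cG.
rewrite in_itv /= => /andP[/ltW s0 /ltW s1].
have s01 : 0 <= s <= 1 by rewrite s0.
rewrite scale1r scale0r add0r subr0 mulr1 -fE// => ->.
have -> : 'D_(h *: q h) g (s *: (h *: q h) + f x) = h * 'D_(q h) g (s *: (h *: q h) + f x).
  have := lg _ (segW s s01) h (q h) 0; rewrite derive0 !addr0.
  exact.
rewrite [_ *: (_ * _)]mulrA mulVf// mul1r.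
apply: (AB (s *: (h *: q h) + f x, q h)) => /=; split => //.
by apply: aA; have := seg s s01; rewrite lt_min => /andP[].
Unshelve. all: by end_near. Qed.

End frechet.

Section near_derive.
Context (R : realType).

Lemma near_eq_diff (E F : normedModType R) (f g : E -> F) (x : E) :
  {near x, f =1 g} -> differentiable f x -> differentiable g x ->
  forall v, 'd f x v = 'd g x v.
Proof.
by move=> fg df dg v; rewrite -!deriveE//; exact: near_eq_derive.
Qed.

End near_derive.

(** * Charts, tangent vectors and vector fields *)

Section charts.
Context (R : realType) (M : banach_manifold R).
Implicit Types (c : chart R M) (x z : M).

Lemma chart_at_atlas x : atlas (chart_at x).
Proof. by rewrite /chart_at; case: cid => c [/=]. Qed.

Lemma chart_at_dom x : chart_dom (chart_at x) x.
Proof. by rewrite /chart_at; case: cid => c [/=]. Qed.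

Lemma chart_mapK c x : atlas c -> chart_dom c x -> chart_inv c (chart_map c x) = x.
Proof. by move=> /atlas_chart[_ _ cK _ _]; exact: cK. Qed.

Lemma chart_invK c y : atlas c -> chart_range c y -> chart_map c (chart_inv c y) = y.
Proof. by move=> ac [x cx <-]; rewrite chart_mapK. Qed.

Lemma chart_inv_dom c y : atlas c -> chart_range c y -> chart_dom c (chart_inv c y).
Proof. by move=> ac [x cx <-]; rewrite chart_mapK. Qed.

Lemma near_chart_dom c x : atlas c -> chart_dom c x -> \forall z \near x, chart_dom c z.
Proof. by move=> /atlas_chart[oc _ _ _ _] cx; move: oc; rewrite openE => /(_ _ cx). Qed.

Lemma near_chart_range c y : atlas c -> chart_range c y ->
  \forall z \near y, chart_range c z.
Proof. by move=> /atlas_chart[_ oc _ _ _] cx; move: oc; rewrite openE => /(_ _ cx). Qed.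

Lemma chart_range_map c x : chart_dom c x -> chart_range c (chart_map c x).
Proof. by move=> cx; exists x. Qed.

Lemma continuous_chart_map c x : atlas c -> chart_dom c x ->
  {for x, continuous (chart_map c)}.
Proof.
move=> /atlas_chart[oc _ _ + _] cx.
by rewrite continuous_open_subspace// => /(_ x); apply; rewrite inE.
Qed.

Lemma continuous_chart_inv c y : atlas c -> chart_range c y ->
  {for y, continuous (chart_inv c)}.
Proof.
move=> /atlas_chart[_ oc _ _ +] cy.
by rewrite continuous_open_subspace// => /(_ y); apply; rewrite inE.
Qed.

Lemma open_chart_inter c c' : atlas c -> atlas c' ->
  open (chart_map c @` (chart_dom c `&` chart_dom c')).
Proof.
move=> ac ac'; rewrite openE => _ [x [cx c'x] <-].
have rx := chart_range_map cx.
have h : \forall y \near chart_map c x, chart_dom c' (chart_inv c y).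
  by apply: (continuous_chart_inv ac rx); rewrite chart_mapK//; exact: near_chart_dom.
apply: filterS2 (near_chart_range ac rx) h => y ry hy.
exists (chart_inv c y); last by rewrite chart_invK.
by split => //; exact: chart_inv_dom.
Qed.

Lemma transition_C1 c c' x : atlas c -> atlas c' -> chart_dom c x -> chart_dom c' x ->
  differentiable (chart_map c' \o chart_inv c) (chart_map c x) /\
  forall v, {for chart_map c x, continuous
    (fun y => 'd (chart_map c' \o chart_inv c) y v)}.
Proof.
move=> ac ac' cx c'x.
apply: (smooth_on_C1 (open_chart_inter ac ac')); last by exists x.
exact: atlas_smooth.
Qed.

Lemma near_transition c c' c'' x : atlas c -> atlas c' -> chart_dom c x -> chart_dom c' x ->
  {near chart_map c x, (chart_map c'' \o chart_inv c') \o (chart_map c' \o chart_inv c) =1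
    chart_map c'' \o chart_inv c}.
Proof.
move=> ac ac' cx c'x.
have := open_chart_inter ac ac'.
rewrite openE => /(_ (chart_map c x) (ex_intro2 _ _ _ (conj cx c'x) erefl)).
by apply: filterS => _ [z [cz c'z] <-] /=; rewrite chart_mapK// chart_mapK.
Qed.

Lemma transition_comp c c' c'' x v : atlas c -> atlas c' -> atlas c'' ->
  chart_dom c x -> chart_dom c' x -> chart_dom c'' x ->
  'd (chart_map c'' \o chart_inv c') (chart_map c' x)
     ('d (chart_map c' \o chart_inv c) (chart_map c x) v) =
  'd (chart_map c'' \o chart_inv c) (chart_map c x) v.
Proof.
move=> ac ac' ac'' cx c'x c''x.
have [d1 _] := transition_C1 ac ac' cx c'x.
have [d2 _] := transition_C1 ac' ac'' c'x c''x.
have [d3 _] := transition_C1 ac ac'' cx c''x.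
have e : (chart_map c' \o chart_inv c) (chart_map c x) = chart_map c' x.
  by rewrite /= chart_mapK.
have d2' : differentiable (chart_map c'' \o chart_inv c')
    ((chart_map c' \o chart_inv c) (chart_map c x)) by rewrite e.
rewrite -(near_eq_diff (near_transition c'' ac ac' cx c'x) _ d3).
  by rewrite diff_comp// e.
exact: differentiable_comp.
Qed.

Lemma transition_id c x v : atlas c -> chart_dom c x ->
  'd (chart_map c \o chart_inv c) (chart_map c x) v = v.
Proof.
move=> ac cx; have [dc _] := transition_C1 ac ac cx cx.
transitivity ('d (@idfun (chart_space c)) (chart_map c x) v); last by rewrite diff_val.
apply: near_eq_diff => //.
by apply: filterS (near_chart_range ac (chart_range_map cx)) => y ry /=; rewrite chart_invK.
Qed.

(** A right inverse of [tangent_coord c] at the points of the domain of [c]. *)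
Definition tangent_of c z (v : chart_space c) : tangent z :=
  'd (chart_map (chart_at z) \o chart_inv c) (chart_map c z) v.

Lemma tangent_coord_of c c' z (v : chart_space c) : atlas c -> atlas c' ->
  chart_dom c z -> chart_dom c' z ->
  tangent_coord c' (tangent_of z v) = 'd (chart_map c' \o chart_inv c) (chart_map c z) v.
Proof.
move=> ac ac' cz c'z; rewrite /tangent_coord /tangent_of.
exact: (transition_comp v ac (chart_at_atlas z) ac' cz (chart_at_dom z) c'z).
Qed.

Lemma tangent_coordK c z (v : chart_space c) : atlas c -> chart_dom c z ->
  tangent_coord c (tangent_of z v) = v.
Proof. by move=> ac cz; rewrite tangent_coord_of// transition_id. Qed.

Lemma continuously_gateaux_for (f : M -> R) c x w : continuously_gateaux f ->
  atlas c -> chart_dom c x ->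
  {for (chart_map c x, w), continuous
     (fun yv : chart_space c * chart_space c => 'D_(yv.2) (f \o chart_inv c) yv.1)}.
Proof.
move=> gf ac cx; have [_ _] := gf c ac.
rewrite continuous_open_subspace; last first.
  rewrite openE => -[y u] [/= ry _]; exists (chart_range c, setT) => /=.
    by split; [exact: near_chart_range|exact: filterT].
  by move=> [y' u'] [].
by apply; rewrite inE; split => //=; exact: chart_range_map.
Qed.

(** The chain rule applied to the transition map from [chart_at x] to [c]. *)
Lemma is_tangent_derive_coord (f : M -> R) c x (v : tangent x) :
  continuously_gateaux f -> atlas c -> chart_dom c x ->
  is_tangent_derive f v ('D_(tangent_coord c v) (f \o chart_inv c) (chart_map c x)).
Proof.
move=> gf ac cx.
have ax := chart_at_atlas x; have dx := chart_at_dom x.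
have [dtr _] := transition_C1 ax ac dx cx.
have [dg lg cg] := gf c ac.
have e : (chart_map c \o chart_inv (chart_at x)) (chart_map (chart_at x) x) = chart_map c x.
  by rewrite /= chart_mapK.
apply: (@near_eq_is_derive _ _ _ ((f \o chart_inv c) \o (chart_map c \o chart_inv (chart_at x)))).
  have := open_chart_inter ax ac.
  rewrite openE => /(_ (chart_map (chart_at x) x) (ex_intro2 _ _ _ (conj dx cx) erefl)).
  by apply: filterS => _ [z [az cz] <-] /=; rewrite !chart_mapK.
rewrite -e.
apply: (@is_derive_gateaux_comp _ _ _ (chart_range c)) => //.
- by have [] := atlas_chart ac.
- by rewrite e; exact: chart_range_map.
- by rewrite e; exact: continuously_gateaux_for.
Qed.

Lemma tangent_derive_coord (f : M -> R) c x (v : tangent x) :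
  continuously_gateaux f -> atlas c -> chart_dom c x ->
  tangent_derive f v = 'D_(tangent_coord c v) (f \o chart_inv c) (chart_map c x).
Proof.
by move=> gf ac cx; have [_] := is_tangent_derive_coord v gf ac cx.
Qed.

(* MVT along segments; the derivative is bounded near the base point by joint
   continuity at the zero vector. *)
Lemma continuously_gateaux_continuous (f : M -> R) : continuously_gateaux f -> continuous f.
Proof.
move=> gf x; pose c := chart_at x; have ac : atlas c := chart_at_atlas x.
have cx : chart_dom c x := chart_at_dom x.
pose y0 := chart_map c x; have ry0 : chart_range c y0 := chart_range_map cx.
pose g := f \o chart_inv c.
have [dg lg _] := gf c ac.
have cg := @continuously_gateaux_for f c x 0 gf ac cx.
suff cgy : {for y0, continuous g}.
  have h : g (chart_map c z) @[z --> x] --> g y0.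
    by apply: (@continuous_comp _ _ _ (chart_map c) g); [exact: continuous_chart_map|].
  rewrite /continuous_at; have -> : f x = g y0 by rewrite /g /y0 /= chart_mapK.
  apply: cvg_trans h; apply: near_eq_cvg.
  by apply: filterS (near_chart_dom ac cx) => z cz; rewrite /g /= chart_mapK.
move: cg; rewrite /prop_for /continuous_at /= derive0 => /cvgrPdist_lt/(_ _ ltr01).
move=> [[A B] /= [nA nB] AB].
have [a a0 aA] : exists2 a, 0 < a & forall y, `|y0 - y| < a -> A y /\ chart_range c y.
  have /nbhs_normP[a /= a0 h] : nbhs y0 (A `&` chart_range c).
    by apply: filterI => //; exact: near_chart_range.
  by exists a => // y /h.
have [b b0 bB] : exists2 b, 0 < b & forall w, `|w| < b -> B w.
  have /nbhs_normP[b /= b0 h] := nB.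
  by exists b => // w wb; apply: h; rewrite /= sub0r normrN.
(* By homogeneity the bound 1 on the ball of radius [b] becomes a linear bound: [w] is rescaled to
   norm [b / 2]. *)
have bnd y w : `|y0 - y| < a -> `|'D_w g y| <= 2 / b * `|w|.
  move=> ya; have [-> | w0] := eqVneq w 0; first by rewrite derive0 !normr0 mulr0.
  have [Ay ry] := aA y ya.
  have nw : 0 < `|w| by rewrite normr_gt0.
  pose t := b / 2 / `|w|; have t0 : 0 < t by rewrite !divr_gt0.
  have Bt : B (t *: w).
    apply: bB; rewrite normrZ gtr0_norm// /t divfK ?lt0r_neq0//.
    by rewrite ltr_pdivrMr// ltr_pMr// ltr1n.
  have /= := AB (y, t *: w) (conj Ay Bt).
  have -> : 'D_(t *: w) g y = t * 'D_w g y.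
    by have := lg y ry t w 0; rewrite derive0 !addr0; exact.
  rewrite sub0r normrN normrM (gtr0_norm t0) mulrC -ltr_pdivlMr// => /ltW /le_trans; apply.
  by rewrite /t div1r invf_div invf_div mulrC.
apply/cvgrPdist_lt => e e0.
apply/nbhs_normP; exists (Num.min a (e * b / 2)); first by rewrite /= lt_min a0/= divr_gt0// mulr_gt0.
move=> y /=; rewrite lt_min => /andP[ya ye].
have seg (s : R) : 0 <= s <= 1 -> `|y0 - (s *: (y - y0) + y0)| < a.
  move=> /andP[s0 s1]; rewrite opprD addrC addrNK normrN normrZ ger0_norm//.
  by apply: le_lt_trans ya; rewrite -(distrC y) ler_piMl.
have dG (s : R) : 0 <= s <= 1 -> is_derive s 1 (fun t : R => g (t *: (y - y0) + y0))
    ('D_(y - y0) g (s *: (y - y0) + y0)).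
  by move=> s01; apply: is_derive_segment; apply: dg; exact: (aA _ (seg s s01)).2.
have dG' (s : R) : s \in `]0, 1[ -> is_derive s 1 (fun t : R => g (t *: (y - y0) + y0))
    ('D_(y - y0) g (s *: (y - y0) + y0)).
  by rewrite in_itv /= => /andP[/ltW s0 /ltW s1]; apply: dG; rewrite s0.
have cG : {within `[0, 1], continuous (fun t : R => g (t *: (y - y0) + y0))}.
  apply: derivable_within_continuous => s; rewrite in_itv /= => s01.
  exact: (@ex_derive _ _ _ _ _ _ _ (dG s s01)).
have [s] := MVT ltr01 dG' cG.
rewrite in_itv /= => /andP[/ltW s0 /ltW s1].
rewrite scale1r scale0r add0r subr0 mulr1 subrK distrC => ->.
have s01 : 0 <= s <= 1 by rewrite s0.
apply: le_lt_trans (bnd _ (y - y0) (seg s s01)) _.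
rewrite distrC -ltr_pdivlMl ?divr_gt0// invf_div mulrC mulrA.
exact: ye.
Qed.

Lemma continuous_tangent_derive (f : M -> R) (V : forall x, tangent x) :
  continuously_gateaux f -> continuous_vector_field V ->
  continuous (fun x => tangent_derive f (V x)).
Proof.
move=> gf cV x.
pose c := chart_at x; have ac : atlas c := chart_at_atlas x.
have cx : chart_dom c x := chart_at_dom x.
have h : 'D_(tangent_coord c (V z)) (f \o chart_inv c) (chart_map c z) @[z --> x] -->
    'D_(tangent_coord c (V x)) (f \o chart_inv c) (chart_map c x).
  apply: (@continuous_comp _ _ _ (fun z => (chart_map c z, tangent_coord c (V z)))
     (fun yv : chart_space c * chart_space c => 'D_(yv.2) (f \o chart_inv c) yv.1)).
    apply: cvg_pair => //=; first exact: continuous_chart_map.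
    have := cV c ac; rewrite continuous_open_subspace; last by have [] := atlas_chart ac.
    by move=> /(_ x); apply; rewrite inE.
  exact: continuously_gateaux_for.
rewrite /continuous_at (tangent_derive_coord _ gf ac cx).
apply: cvg_trans h; apply: near_eq_cvg.
by apply: filterS (near_chart_dom ac cx) => z cz; rewrite (tangent_derive_coord _ gf ac cz).
Qed.

(* Regularity of M makes the image of a small ball closed in M, so the bump
   function supported there extends continuously by zero. *)
Lemma extend_tangent x (v : tangent x) : exists2 V : forall z, tangent z,
  continuous_vector_field V /\ V x = v &
  \forall z \near x, tangent_coord (chart_at x) (V z) = v.
Proof.
pose c := chart_at x; have ac : atlas c := chart_at_atlas x.
have cx : chart_dom c x := chart_at_dom x.
pose y0 := chart_map c x; have ry0 : chart_range c y0 := chart_range_map cx.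
have [B nB Bc] := manifold_regular (near_chart_dom ac cx).
have nB' : \forall y \near y0, B (chart_inv c y).
  by apply: (continuous_chart_inv ac ry0); rewrite /y0 chart_mapK.
have [rho rho0 rhoB] : exists2 rho, 0 < rho &
    forall y, `|y0 - y| < rho -> B (chart_inv c y).
  by have /nbhs_normP[rho /= ? h] := nB'; exists rho.
(* Equal to 1 up to [rho / 4] and to 0 from [rho / 2] on. Off [closure B] the cut-off vanishes on a
   neighbourhood. A point of [closure B] lies in the chart domain, so [dist] is continuous there,
   and beyond [rho / 2] both branches of [chi] are 0. *)
pose bump (t : R) := Num.min 1 (Num.max 0 (2 - 4 * t / rho)).
pose dist z := `|y0 - chart_map c z|.
pose chi z := if `[< closure B z >] then bump (dist z) else 0.
have cbump : continuous bump.
  have -> : bump = (cst 1 \min (cst 0 \max (fun t => 2 - 4 * t / rho))) by [].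
  move=> t; apply: continuous_min; first exact: cvg_cst.
  apply: continuous_max; first exact: cvg_cst.
  apply: cvgB; first exact: cvg_cst.
  by apply: cvgMl; apply: cvgMr; exact: cvg_id.
have cdist z : chart_dom c z -> {for z, continuous dist}.
  move=> cz; apply: cvg_norm; apply: cvgB; first exact: cvg_cst.
  exact: continuous_chart_map.
have bump0 t : rho / 2 <= t -> bump t = 0.
  move=> rt; rewrite /bump max_l ?min_r// subr_le0 ler_pdivlMr//; lra.
have bump1 t : t <= rho / 4 -> bump t = 1.
  move=> rt; rewrite /bump min_l// le_max; apply/orP; right.
  rewrite lerBrDr -lerBrDl ler_pdivrMr//; lra.
have chiE z : chart_dom c z -> dist z < rho -> \forall z' \near z, chi z' = bump (dist z').
  move=> cz dz.
  have h1 : \forall z' \near z, dist z' < rho.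
    have h := cdist z cz; move: h; rewrite /prop_for /continuous_at => /cvgr_lt; exact.
  apply: filterS2 h1 (near_chart_dom ac cz) => z' dz' cz'.
  rewrite /chi ifT//; apply/asboolP; apply: subset_closure.
  by rewrite -(chart_mapK ac cz'); exact: rhoB.
have cchi z : chart_dom c z -> dist z < rho -> {for z, continuous chi}.
  move=> cz dz.
  have h : bump (dist z') @[z' --> z] --> bump (dist z).
    by apply: (@continuous_comp _ _ _ dist bump); [exact: cdist|exact: cbump].
  rewrite /prop_for /continuous_at (nbhs_singleton (chiE z cz dz)).
  apply: cvg_trans h; apply: near_eq_cvg.
  by apply: filterS (chiE z cz dz) => z' ->.
have chi0 z : ~ (chart_dom c z /\ dist z < rho) -> \forall z' \near z, chi z' = 0.
  move=> nz.
  have [Bz|nBz] := pselect (closure B z); last first.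
    have : (~` closure B) z by [].
    have oB : open (~` closure B) by apply: closed_openC; exact: closed_closure.
    move: oB; rewrite openE => /[apply]; apply: filterS => z' /= nBz'.
    by rewrite /chi ifF//; exact/asboolP.
  have cz := Bc _ Bz.
  have dz : rho / 2 < dist z.
    apply: (@lt_le_trans _ _ rho); first lra.
    by rewrite leNgt; apply/negP => dz; apply: nz.
  have h := cdist z cz; move: h; rewrite /prop_for /continuous_at => /cvgr_gt /(_ _ dz).
  apply: filterS => z' dz'; rewrite /chi; case: ifP => // _.
  by apply: bump0; exact: ltW.
pose V z : tangent z := chi z *: tangent_of z v.
have Vc z c' : atlas c' -> tangent_coord c' (V z) = chi z *: tangent_coord c' (tangent_of z v).
  by move=> _; rewrite /tangent_coord /V linearZ.
have dist_x : dist x = 0 by rewrite /dist subrr normr0.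
exists V.
  split.
    move=> c' ac'; rewrite continuous_open_subspace; last by have [] := atlas_chart ac'.
    move=> z; rewrite inE => c'z.
    have [[cz dz]|nz] := pselect (chart_dom c z /\ dist z < rho); last first.
      rewrite /continuous_at Vc// (nbhs_singleton (chi0 z nz)) scale0r.
      have h : (fun=> 0 : chart_space c') z' @[z' --> z] --> (0 : chart_space c') by exact: cvg_cst.
      apply: cvg_trans h; apply: near_eq_cvg.
      by apply: filterS (chi0 z nz) => z' h; rewrite Vc// h scale0r.
    have [_ cd] := transition_C1 ac ac' cz c'z.
    have h : chi z' *: ('d (chart_map c' \o chart_inv c) (chart_map c z') v : chart_space c')
        @[z' --> z] --> chi z *: ('d (chart_map c' \o chart_inv c) (chart_map c z) v : chart_space c').
      apply: cvgZ; first exact: cchi.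
      apply: (@continuous_comp _ _ _ (chart_map c)
        (fun y => 'd (chart_map c' \o chart_inv c) y v : chart_space c')).
        exact: continuous_chart_map.
      exact: cd.
    rewrite /continuous_at Vc// tangent_coord_of//; apply: cvg_trans h; apply: near_eq_cvg.
    apply: filterS2 (near_chart_dom ac cz) (near_chart_dom ac' c'z) => z' cz' c'z'.
    by rewrite Vc// tangent_coord_of.
  rewrite /V (nbhs_singleton (chiE x cx _)) dist_x ?bump1 ?scale1r//; last by rewrite divr_ge0// ltW.
  exact: (transition_id v ac cx).
have dx4 : dist x < rho / 4 by rewrite dist_x divr_gt0.
have h1 : \forall z \near x, dist z < rho / 4.
  by have h := cdist x cx; move: h; rewrite /prop_for /continuous_at => /cvgr_lt; exact.
have h2 : \forall z \near x, chi z = bump (dist z) by apply: chiE; rewrite ?dist_x.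
apply: filterS3 h1 h2 (near_chart_dom ac cx) => z h1 h2 cz.
by rewrite Vc// h2 bump1 ?(ltW h1)// scale1r tangent_coordK.
Qed.

End charts.

(** * Integrals on models *)

Section density.
Context d (T : measurableType d) (R : realType).
Variables (mu nu : {measure set T -> \bar R}) (phi : T -> R).
Hypothesis mp : positive_density mu nu phi.

Lemma density_integrable : mu.-integrable setT (EFin \o phi).
Proof. by have [/Lfun1_integrable] := mp. Qed.

Lemma density_measurable : measurable_fun setT phi.
Proof. exact: integrable_measurable density_integrable. Qed.

(** [phi] is positive only almost everywhere; [|phi|] is nonnegative everywhere, as the theorems on
    integrals of nonnegative functions require. *)
Lemma density_norm A : measurable A -> nu A = (\int[mu]_(w in A) `|phi w|%:E)%E.
Proof.
have [_ phi0 phiA] := mp; move=> mA; rewrite phiA//; apply: ae_eq_integral => //.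
- exact/measurable_funTS/measurable_EFinP/density_measurable.
- apply/measurable_funTS/measurable_EFinP.
  exact: measurableT_comp density_measurable.
- by apply: filterS phi0 => w phiw _; rewrite gtr0_norm.
Qed.

Lemma density_null A : measurable A -> mu A = 0%E -> nu A = 0%E.
Proof.
move=> mA muA; rewrite density_norm//; apply: null_set_integral => //.
apply/measurable_funTS/measurable_EFinP; exact: measurableT_comp density_measurable.
Qed.

Lemma density_ae (P : T -> Prop) : {ae mu, forall w, P w} -> {ae nu, forall w, P w}.
Proof. by move=> [A [mA muA PA]]; exists A; split => //; exact: density_null. Qed.

Let mphi : measurable_fun setT (fun w => `|phi w|).
Proof. exact: measurableT_comp density_measurable. Qed.

Import HBNNSimple.

(** For simple functions this is additivity over the level sets; monotone convergence gives the
    rest. *)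
Lemma ge0_integral_density (f : T -> R) : measurable_fun setT f ->
  (forall w, 0 <= f w) ->
  (\int[nu]_w (f w)%:E = \int[mu]_w (f w * `|phi w|)%:E)%E.
Proof.
move=> mf f0.
have mEf : measurable_fun setT (EFin \o f) by exact/measurable_EFinP.
have Ef0 w : setT w -> (0 <= (EFin \o f) w)%E by move=> _; rewrite lee_fin.
pose h := nnsfun_approx measurableT mEf.
have hcvg w : (EFin \o h ^~ w) n @[n --> \oo] --> (f w)%:E.
  exact: (@cvg_nnsfun_approx _ _ _ _ measurableT _ mEf Ef0 w I).
have hnd w m n : (m <= n)%N -> h m w <= h n w.
  by move=> mn; exact/lefP/nd_nnsfun_approx.
have simple (g : {nnsfun T >-> R}) :
    (\int[nu]_w (g w)%:E = \int[mu]_w (g w * `|phi w|)%:E)%E.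
  rewrite integralT_nnsfun sintegralE.
  have mg y : measurable (g @^-1` [set y]).
    by rewrite -[X in measurable X]setTI; exact: (measurable_funPT g).
  have g0 y : range g y -> 0 <= y by move=> [w _ <-].
  have Eg w : (g w * `|phi w|)%:E =
      \sum_(y \in range g) (y * \1_(g @^-1` [set y]) w * `|phi w|)%:E.
    rewrite fsumEFin// [in LHS](fimfunE g w); congr EFin.
    by rewrite mulr_fsuml.
  under eq_integral do rewrite Eg.
  have pos y w : 0 <= y * \1_(g @^-1` [set y]) w * `|phi w|.
    rewrite mulr_ge0// indicE; case: (boolP (w \in _)) => [|_]; last by rewrite mulr0.
    by rewrite inE /= => <-; rewrite mulr1.
  rewrite ge0_integral_fsum//.
  - apply: eq_fsbigr => y /[!inE] ry; rewrite density_norm//.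
    have mphiy : measurable_fun (g @^-1` [set y]) (fun w => `|phi w|%:E).
      by apply/measurable_EFinP; exact: measurable_funTS.
    rewrite -ge0_integralZl ?lee_fin//; last exact: g0.
    rewrite integral_mkcond; apply: eq_integral => w _; rewrite patchE indicE.
    by case: ifP => _; rewrite ?mulr1 ?mulr0 ?mul0r -?EFinM.
  - move=> y; apply/measurable_EFinP; apply: measurable_funM => //.
    exact: measurable_funM.
  - by move=> y w _; rewrite lee_fin.
transitivity (limn (fun n => \int[nu]_w (h n w)%:E)%E).
  rewrite -monotone_convergence//.
  - by apply: eq_integral => w _; apply/esym/cvg_lim => //; exact: hcvg.
  - by move=> n; apply/measurable_EFinP.
  - by move=> n w _; rewrite lee_fin.
  - by move=> w _ m n mn; rewrite lee_fin hnd.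
under eq_fun do rewrite simple.
rewrite -monotone_convergence//.
- apply: eq_integral => w _; apply/cvg_lim => //=.
  under eq_fun do rewrite EFinM.
  rewrite EFinM; apply: cvgeZr => //; exact: hcvg.
- by move=> n; apply/measurable_EFinP; exact: measurable_funM.
- by move=> n w _; rewrite lee_fin mulr_ge0.
- by move=> w _ m n mn; rewrite lee_fin ler_wpM2r// hnd.
Qed.

Lemma integrable_density (f : T -> R) : measurable_fun setT f ->
  nu.-integrable setT (EFin \o f) <-> mu.-integrable setT (EFin \o (f \* phi)).
Proof.
move=> mf; have mfphi : measurable_fun setT (f \* phi).
  by apply: measurable_funM => //; exact: density_measurable.
have mnf : measurable_fun setT (fun w => `|f w|) by exact: measurableT_comp.
have e : (\int[nu]_w `|(EFin \o f) w| = \int[mu]_w `|(EFin \o (f \* phi)%R) w|)%E.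
  rewrite /= (@ge0_integral_density (fun w => `|f w|))//.
  by apply: eq_integral => w _; rewrite normrM.
split=> /integrableP[_ fi]; apply/integrableP; split; try exact/measurable_EFinP.
  by rewrite -e.
by rewrite e.
Qed.

Lemma Rintegral_density (f : T -> R) : measurable_fun setT f ->
  \int[nu]_w f w = \int[mu]_w (f w * phi w).
Proof.
move=> mf; rewrite /Rintegral; congr fine.
have [_ phi0 _] := mp.
transitivity (\int[mu]_w (f w * `|phi w|)%:E)%E; last first.
  apply: ae_eq_integral => //.
  - by apply/measurable_EFinP; exact: measurable_funM.
  - by apply/measurable_EFinP; apply: measurable_funM => //; exact: density_measurable.
  - by apply: filterS phi0 => w phiw _; rewrite gtr0_norm.
rewrite integralE [RHS]integralE; congr (_ - _)%E.
- rewrite (eq_integral (EFin \o (fun w => Num.max (f w) 0))); last first.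
    by move=> w _; rewrite funeposE /= EFin_max.
  rewrite (@ge0_integral_density (fun w => Num.max (f w) 0))//; first last.
  - by move=> w; rewrite le_max lexx orbT.
  - exact: measurable_maxr.
  apply: eq_integral => w _; rewrite funeposE -EFin_max; congr EFin.
  by rewrite maxr_pMl// mul0r.
- rewrite (eq_integral (EFin \o (fun w => Num.max (- f w) 0))); last first.
    by move=> w _; rewrite funenegE /= EFin_max.
  rewrite (@ge0_integral_density (fun w => Num.max (- f w) 0))//; first last.
  - by move=> w; rewrite le_max lexx orbT.
  - by apply: measurable_maxr => //; exact: measurableT_comp.
  apply: eq_integral => w _; rewrite funenegE -EFinN -EFin_max; congr EFin.
  by rewrite maxr_pMl// mul0r mulNr.
Qed.

End density.

Section Lfun_powers.
Context d (T : measurableType d) (R : realType) (mu : {measure set T -> \bar R}).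
Variable n : nat.
Local Notation Ln := (Lfun mu n.+1%:R%:E).

Let powE (f : T -> R) w : (`|(EFin \o f) w| `^ n.+1%:R)%E = (`|f w| ^+ n.+1)%:E.
Proof. by rewrite abse_EFin poweR_EFin powR_mulrn. Qed.

Let LnormE (f : T -> R) : Lnorm mu n.+1%:R%:E (EFin \o f) =
  ((\int[mu]_w (`|f w| ^+ n.+1)%:E) `^ n.+1%:R^-1)%E.
Proof. by rewrite unlock; under eq_integral do rewrite powE. Qed.

Lemma Lfun_pow_integrable (f : T -> R) : f \in Ln <->
  measurable_fun setT f /\ mu.-integrable setT (EFin \o (fun w => `|f w| ^+ n.+1)).
Proof.
have iE : measurable_fun setT f ->
   (mu.-integrable setT (EFin \o (fun w => `|f w| ^+ n.+1)) <->
    (\int[mu]_w (`|f w| ^+ n.+1)%:E < +oo)%E).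
  move=> mf; have e : (\int[mu]_w `|(EFin \o (fun w => `|f w| ^+ n.+1)%R) w| =
      \int[mu]_w (`|f w| ^+ n.+1)%:E)%E.
    by apply: eq_integral => w _; rewrite /= ger0_norm// exprn_ge0.
  split=> [/integrableP[_]|h]; first by rewrite e.
  apply/integrableP; rewrite e; split => //; apply/measurable_EFinP.
  by apply: measurable_funX; exact: measurableT_comp.
split=> [|[mf fi]].
  rewrite inE => /andP[/[!inE]/= mf]; rewrite /finite_norm LnormE => fi.
  split => //; apply/iE => //; apply: lty_poweRy fi.
  by rewrite invr_neq0.
rewrite inE; apply/andP; split; rewrite inE//= /finite_norm LnormE.
by apply: poweR_lty; exact/iE.
Qed.

Lemma fine_Lnorm (f : T -> R) : f \in Ln ->
  fine (Lnorm mu n.+1%:R%:E (EFin \o f)) = (\int[mu]_w `|f w| ^+ n.+1) `^ n.+1%:R^-1.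
Proof.
move=> /Lfun_pow_integrable[_ fi]; rewrite LnormE /Rintegral.
by rewrite -[in LHS](fineK (integrable_fin_num _ fi)).
Qed.

Lemma fine_Lnorm_pow (f : T -> R) : f \in Ln ->
  fine (Lnorm mu n.+1%:R%:E (EFin \o f)) ^+ n.+1 = \int[mu]_w `|f w| ^+ n.+1.
Proof.
move=> fLn; rewrite fine_Lnorm// -powR_mulrn ?powR_ge0// -powRrM mulVf// powRr1//.
by apply: Rintegral_ge0 => w _; rewrite exprn_ge0.
Qed.

Lemma fine_Lnorm_lt (f : T -> R) (e : R) : 0 < e -> f \in Ln ->
  (fine (Lnorm mu n.+1%:R%:E (EFin \o f)) < e) = (\int[mu]_w `|f w| ^+ n.+1 < e ^+ n.+1).
Proof.
move=> e0 fLn; rewrite -fine_Lnorm_pow// ltr_pXn2r// nnegrE; last exact: ltW.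
by apply: fine_ge0; exact: Lnorm_ge0.
Qed.

End Lfun_powers.

Lemma ler_1Dexpn (R : realType) (x : R) k : `|x| <= 1 + `|x| ^+ k.+1.
Proof.
have [x1|x1] := lerP `|x| 1; first by rewrite (le_trans x1)// lerDl exprn_ge0.
rewrite -[leLHS]add0r lerD// exprS ler_peMr// exprn_ege1//; exact: ltW.
Qed.

Lemma cvg_sumr (R : realType) (I U : Type) (r : seq I) (F : set_system U)
    (FF : Filter F) (f : I -> U -> R) (l : I -> R) :
  (forall i, f i x @[x --> F] --> l i) ->
  (\sum_(i <- r) f i x) @[x --> F] --> \sum_(i <- r) l i.
Proof.
move=> fl; elim: r => [|i r IHr].
  by rewrite big_nil; under eq_fun do rewrite big_nil; exact: cvg_cst.
by rewrite big_cons; under eq_fun do rewrite big_cons; exact: cvgD.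
Qed.

(** * Continuity of integrals on a model and the derivative of the mass *)

Section model_integrals.
Context (R : realType) (k : nat) (M : banach_manifold R) d (T : measurableType d).
Variables (m : measure_model k.+1 M T) (pbar : M -> T -> R).
Hypothesis mpbar : potential m pbar.
Let mu := reference m.

Lemma potential_density x : positive_density mu (param m x) (pbar x).
Proof. by have [h _ _] := mpbar. Qed.

Lemma potential_regular : {ae mu, forall w, (forall x, 0 < pbar x w) /\
  continuously_gateaux (fun x => ln (pbar x w))}.
Proof. by have [_ h _] := mpbar. Qed.

Lemma continuous_potential w : (forall y, 0 < pbar y w) ->
  continuously_gateaux (fun y => ln (pbar y w)) -> continuous (pbar ^~ w).
Proof.
move=> pw gw; have -> : pbar ^~ w = expR \o (fun y => ln (pbar y w)).
  by apply/funext => y /=; rewrite lnK// posrE.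
move=> x; apply: continuous_comp; last exact: continuous_expR.
exact: (continuously_gateaux_continuous gw).
Qed.

(** Integrability is postulated for vector fields; [extend_tangent] makes [v] the value of one. *)
Lemma dlog_Lfun x (v : tangent x) : dlog pbar v \in Lfun (param m x) k.+1%:R%:E.
Proof.
have [_ _ h] := mpbar; have [V [cV <-] _] := extend_tangent v.
by have [+ _] := h V cV; exact.
Qed.

Lemma dlog_measurable x (v : tangent x) : measurable_fun setT (dlog pbar v).
Proof. by have [] := (Lfun_pow_integrable _ _ _).1 (dlog_Lfun v). Qed.

Lemma dlog_pow_integrable x (v : tangent x) :
  (param m x).-integrable setT (EFin \o (fun w => `|dlog pbar v w| ^+ k.+1)).
Proof. by have [] := (Lfun_pow_integrable _ _ _).1 (dlog_Lfun v). Qed.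

Lemma mass_density x : mass m x = \int[mu]_w pbar x w.
Proof. by rewrite /mass; have [_ _ ->] := potential_density x. Qed.

Lemma mass_integral x : mass m x = \int[param m x]_w 1.
Proof. by rewrite Rintegral_cst// mul1r. Qed.

Lemma continuous_mass : continuous (mass m).
Proof.
have [phi mphi cphi] := param_continuous m => x.
have massE z : mass m z = \int[mu]_w phi z w.
  by rewrite /mass; have [_ _ ->] := mphi z.
have iphi z : mu.-integrable setT (EFin \o phi z) by exact: density_integrable.
apply/cvgrPdist_lt => e e0.
have := cphi x => /fine_cvgP[_ /cvgrPdist_lt/(_ _ e0)]; apply: filterS => z.
rewrite sub0r normrN /= Lnorm1 => h; rewrite distrC !massE -RintegralB//.
apply: le_lt_trans h; rewrite [X in _ <= `|X|](_ : _ = \int[mu]_w `|phi z w - phi x w|)//.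
apply: (@le_trans _ _ (\int[mu]_w `|phi z w - phi x w|)); last exact: ler_norm.
by apply: le_normr_Rintegral => //; exact: integrable_EFinB.
Qed.

Lemma continuous_dlog_pow (V : forall x : M, tangent x) : continuous_vector_field V ->
  continuous (fun x => \int[param m x]_w `|dlog pbar (V x) w| ^+ k.+1).
Proof.
have [_ _ h] := mpbar; move=> cV; have [LV cLV] := h V cV.
rewrite (_ : (fun x => _) = (fun x => (fine (Lnorm (param m x) k.+1%:R%:E
    (EFin \o dlog pbar (V x)))) ^+ k.+1)); last first.
  by apply/funext => x; rewrite fine_Lnorm_pow.
move=> x; apply: (@continuous_comp _ _ _ (fun x => fine (Lnorm (param m x) k.+1%:R%:E
    (EFin \o dlog pbar (V x)))) (fun y : R => y ^+ k.+1)); first exact: cLV.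
exact: exprn_continuous.
Qed.

(** No single function dominates the densities along the sequence. [pratt] is used with
    [G (z n) * |pbar (z n)|], whose integral is the mass at [z n] plus powers of the norms of
    scores, all continuous on the model. *)
Lemma model_integral_cvg (z : nat -> M) (x : M) (J : nat)
    (V : 'I_J -> forall x : M, tangent x) (f_ : nat -> T -> R) (f : T -> R) :
  z n @[n --> \oo] --> x -> (forall j, continuous_vector_field (V j)) ->
  (forall n, measurable_fun setT (f_ n)) -> measurable_fun setT f ->
  (forall n w, `|f_ n w| <= 1 + \sum_(j < J) `|dlog pbar (V j (z n)) w| ^+ k.+1) ->
  (forall w, `|f w| <= 1 + \sum_(j < J) `|dlog pbar (V j x) w| ^+ k.+1) ->
  {ae mu, forall w, f_ ^~ w @ \oo --> f w} ->
  (\int[param m (z n)]_w f_ n w) @[n --> \oo] --> \int[param m x]_w f w.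
Proof.
move=> zx cV mf_ mf f_le fle ff.
pose G y w := 1 + \sum_(j < J) `|dlog pbar (V j y) w| ^+ k.+1.
have iG y : (param m y).-integrable setT (EFin \o G y).
  apply: integrable_EFinD; first exact: finite_measure_integrable_cst.
  by apply: integrable_EFin_sum => j; exact: dlog_pow_integrable.
have mG y : measurable_fun setT (G y) by exact: integrable_measurable (iG y).
have mpb y : measurable_fun setT (pbar y) by exact: density_measurable (potential_density y).
have iGmu y : mu.-integrable setT (EFin \o (G y \* pbar y)).
  exact: (integrable_density (potential_density y) (mG y)).1 (iG y).
have absG y w : `|G y w| = G y w.
  by rewrite ger0_norm// addr_ge0// sumr_ge0// => j _; rewrite exprn_ge0.
have nG y : (fun w => `|(G y \* pbar y) w|) = (fun w => G y w * `|pbar y w|).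
  by apply/funext => w; rewrite normrM absG.
have pbar_cvg w : (forall y, 0 < pbar y w) -> continuously_gateaux (fun y => ln (pbar y w)) ->
    pbar (z n) w @[n --> \oo] --> pbar x w.
  move=> pw gw; apply: (@cvg_comp _ _ _ z (pbar^~ w) _ (nbhs x)) => //.
  exact: continuous_potential.
rewrite (Rintegral_density (potential_density x))//.
under eq_fun do rewrite (Rintegral_density (potential_density (z _)))//.
apply: (@pratt _ _ _ mu _ (fun n w => G (z n) w * `|pbar (z n) w|) _
  (fun w => G x w * `|pbar x w|)).
- by move=> n; exact: measurable_funM.
- exact: measurable_funM.
- by move=> n w; rewrite normrM ler_wpM2r.
- by move=> w; rewrite normrM ler_wpM2r.
- by move=> n; have := integrable_norm (iGmu (z n)); rewrite -nG.
- by have := integrable_norm (iGmu x); rewrite -nG.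
- apply: filterS2 potential_regular ff => w [pw gw] fw.
  by apply: cvgM => //; exact: pbar_cvg.
- apply: filterS potential_regular => w [pw gw].
  apply: cvgM; last by apply: cvg_norm; exact: pbar_cvg.
  apply: cvgD; first exact: cvg_cst.
  apply: cvg_sumr => j.
  have h : dlog pbar (V j (z n)) w @[n --> \oo] --> dlog pbar (V j x) w.
    apply: (@cvg_comp _ _ _ z (fun y => dlog pbar (V j y) w) _ (nbhs x)) => //.
    exact: (continuous_tangent_derive gw (cV j)).
  apply: (@cvg_comp _ _ _ (fun n => `|dlog pbar (V j (z n)) w|) (fun y : R => y ^+ k.+1) _
    (nbhs `|dlog pbar (V j x) w|)); first exact: cvg_norm.
  exact: exprn_continuous.
- move=> e e0.
  have GE y : \int[mu]_w (G y w * `|pbar y w|) =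
      mass m y + \sum_(j < J) \int[param m y]_w `|dlog pbar (V j y) w| ^+ k.+1.
    have -> : \int[mu]_w (G y w * `|pbar y w|) = \int[param m y]_w G y w.
      rewrite (Rintegral_density (potential_density y))// /Rintegral; congr fine.
      have mGp : measurable_fun setT (fun w => G y w * `|pbar y w|).
        by apply: measurable_funM => //; exact: measurableT_comp.
      apply: ae_eq_integral => //; try exact/measurable_EFinP.
        by apply/measurable_EFinP; exact: measurable_funM.
      by apply: filterS potential_regular => w [pw _] _; rewrite gtr0_norm.
    rewrite RintegralD//; last 2 first.
    - exact: finite_measure_integrable_cst.
    - by apply: integrable_EFin_sum => j; exact: dlog_pow_integrable.
    by rewrite -mass_integral Rintegral_sum// => j; exact: dlog_pow_integrable.
  have h : mass m (z n) + \sum_(j < J) (\int[param m (z n)]_w `|dlog pbar (V j (z n)) w| ^+ k.+1)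
      @[n --> \oo] --> mass m x + \sum_(j < J) \int[param m x]_w `|dlog pbar (V j x) w| ^+ k.+1.
    apply: cvgD.
      by apply: (@cvg_comp _ _ _ z (mass m) _ (nbhs x)) => //; exact: continuous_mass.
    apply: cvg_sumr => j.
    apply: (@cvg_comp _ _ _ z (fun y => \int[param m y]_w `|dlog pbar (V j y) w| ^+ k.+1) _ (nbhs x)) => //.
    exact: continuous_dlog_pow.
  move/cvgrPdist_lt : h => /(_ _ e0); apply: filterS => n.
  by rewrite -!GE ltr_distlC => /andP[_ /ltW].
Qed.

(** Charts make [M] first countable, so sequences detect continuity, and the limit theorems for
    integrals are about sequences. *)
Lemma cvg_seqP (h : M -> R) (x : M) :
  (forall z : nat -> M, z n @[n --> \oo] --> x -> h (z n) @[n --> \oo] --> h x) ->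
  {for x, continuous h}.
Proof.
move=> hz; pose c := chart_at x; have ac : atlas c := chart_at_atlas x.
have cx : chart_dom c x := chart_at_dom x.
pose y0 := chart_map c x; have ry0 : chart_range c y0 := chart_range_map cx.
apply/cvgrPdist_lt => e e0; apply: contrapT => nh.
have far n : exists y, [/\ chart_range c y, `|y0 - y| < n.+1%:R^-1 &
    e <= `|h x - h (chart_inv c y)|].
  apply: contrapT => nex; apply: nh.
  have h1 : \forall z \near x, `|y0 - chart_map c z| < n.+1%:R^-1.
    have cm := continuous_chart_map ac cx.
    by move: cm; rewrite /prop_for /continuous_at => /cvgrPdist_lt; apply; rewrite invr_gt0.
  apply: filterS2 (near_chart_dom ac cx) h1 => z cz zn.
  rewrite ltNge; apply/negP => ez; apply: nex; exists (chart_map c z).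
  by split; [exact: chart_range_map|exact: zn|rewrite chart_mapK].
have [y yP] := choice far.
pose z n := chart_inv c (y n).
have yy0 : y n @[n --> \oo] --> y0.
  apply/cvgrPdist_lt => r r0; have [N _ HN] := near_infty_natSinv_lt (PosNum r0).
  exists N => // n /HN /= nr; have [_ yn _] := yP n.
  exact: lt_trans yn nr.
have zx : z n @[n --> \oo] --> x.
  have -> : x = chart_inv c y0 by rewrite /y0 chart_mapK.
  apply: (@cvg_comp _ _ _ y (chart_inv c) _ (nbhs y0)) => //.
  exact: continuous_chart_inv.
have := hz z zx => /cvgrPdist_lt/(_ _ e0) [N _ HN].
have := HN N (leqnn N); have [_ _ ez] := yP N.
by rewrite /= ltNge ez.
Qed.

Lemma continuous_model_integral (J : nat) (V : 'I_J -> forall x : M, tangent x)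
    (F : M -> T -> R) :
  (forall j, continuous_vector_field (V j)) ->
  (forall y, measurable_fun setT (F y)) ->
  (forall y w, `|F y w| <= 1 + \sum_(j < J) `|dlog pbar (V j y) w| ^+ k.+1) ->
  {ae mu, forall w, continuous (F ^~ w)} ->
  continuous (fun y => \int[param m y]_w F y w).
Proof.
move=> cV mF leF cF x; apply: cvg_seqP => z zx.
apply: (model_integral_cvg zx cV) => //.
by apply: filterS cF => w Fw; apply: (@cvg_comp _ _ _ z (F^~ w) _ (nbhs x)) => //; exact: Fw.
Qed.

(** Along the coordinate segment [z s] through [x] the density has derivative [b s], score times
    density, where the score is taken along a field [V] with constant coordinates [v] near [x]. The
    integral of [|b s|] is that of the absolute score on the model, hence continuous in [s], which
    is the semicontinuity that differentiation under the integral asks for. *)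
Lemma is_tangent_derive_mass x (v : tangent x) :
  is_tangent_derive (mass m) v (\int[param m x]_w dlog pbar v w).
Proof.
have [V [cV Vx] Vv] := extend_tangent v.
pose c := chart_at x; have ac : atlas c := chart_at_atlas x.
have cx : chart_dom c x := chart_at_dom x.
pose y0 := chart_map c x; have ry0 : chart_range c y0 := chart_range_map cx.
pose z (s : R) := chart_inv c (s *: (v : chart_space c) + y0).
have cz : (s *: (v : chart_space c) + y0) @[s --> (0 : R)] --> y0.
  rewrite -[X in _ --> X]add0r -[X in _ --> X + _](scale0r (v : chart_space c)).
  by apply: cvgD; [apply: cvgZr_tmp; exact: cvg_id|exact: cvg_cst].
have z0 : z 0 = x by rewrite /z scale0r add0r /y0 chart_mapK.
have Vy : \forall y \near y0, tangent_coord c (V (chart_inv c y)) = v.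
  have /(_ [set y | tangent_coord c (V y) = v]) h := continuous_chart_inv ac ry0.
  by apply: h; rewrite /y0 chart_mapK.
have [r r0 rV] : exists2 r, 0 < r & forall s : R, `|s| < r ->
    chart_range c (s *: (v : chart_space c) + y0) /\ tangent_coord c (V (z s)) = v.
  have /cz/nbhs_normP[r /= r0 h] : nbhs y0 ((chart_range c) `&`
      [set y | tangent_coord c (V (chart_inv c y)) = v]).
    by apply: filterI => //; exact: near_chart_range.
  by exists r => // s sr; apply: h; rewrite /= sub0r normrN.
have zdom s : `|s| < r -> chart_dom c (z s).
  by move=> /rV[+ _]; exact: chart_inv_dom.
have zmap s : `|s| < r -> chart_map c (z s) = s *: (v : chart_space c) + y0.
  by move=> /rV[+ _]; exact: chart_invK.
have ctz s : `|s| < r -> {for s, continuous z}.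
  move=> sr; apply: (@continuous_comp _ _ _ (fun s : R => s *: (v : chart_space c) + y0)).
    by apply: cvgD; [apply: cvgZr_tmp; exact: cvg_id|exact: cvg_cst].
  by apply: continuous_chart_inv => //; exact: (rV s sr).1.
pose b s w := dlog pbar (V (z s)) w * pbar (z s) w.
have ib s : mu.-integrable setT (EFin \o b s).
  apply: (integrable_density (potential_density (z s)) (dlog_measurable (V (z s)))).1.
  have i1 : (param m (z s)).-integrable setT
     (EFin \o (cst 1 \+ (fun w => `|dlog pbar (V (z s)) w| ^+ k.+1))).
    apply: integrable_EFinD; first exact: finite_measure_integrable_cst.
    exact: dlog_pow_integrable.
  apply: le_integrable_norm i1; first exact: dlog_measurable.
  by move=> w /=; exact: ler_1Dexpn.
have dmass : is_derive (0 : R) 1 (fun s => \int[mu]_w pbar (z s) w) (\int[mu]_w b 0 w).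
  apply: (@is_derive_Rintegral _ _ _ mu (fun s w => pbar (z s) w) b r r0).
  - by move=> s _; exact: density_integrable (potential_density (z s)).
  - by move=> s _; exact: ib.
  - apply: filterS potential_regular => w [pw gw] s sr.
    have [dg _ _] := gw c ac.
    have pE : pbar^~ w \o z = expR \o (fun s : R => ((fun y => ln (pbar y w)) \o chart_inv c)
        (s *: (v : chart_space c) + y0)).
      by apply/funext => t /=; rewrite lnK// posrE.
    have dlogE : dlog pbar (V (z s)) w = 'D_(v : chart_space c)
        ((fun y => ln (pbar y w)) \o chart_inv c) (s *: (v : chart_space c) + y0).
      have := tangent_derive_coord (V (z s)) gw ac (zdom s sr).
      by rewrite (zmap s sr) (rV s sr).2.
    split.
      rewrite /b dlogE mulrC -[pbar (z s) w]/((pbar^~ w \o z) s).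
      rewrite -[X in is_derive _ _ X]/(pbar^~ w \o z) pE.
      apply: is_derive1_comp; apply: is_derive_segment.
      by apply: dg; exact: (rV s sr).1.
    apply: continuousM; last first.
      by apply: (@continuous_comp _ _ _ z (pbar ^~ w)); [exact: ctz|exact: continuous_potential].
    apply: (@continuous_comp _ _ _ z (fun y => dlog pbar (V y) w)); first exact: ctz.
    exact: (continuous_tangent_derive gw cV).
  - move=> e e0.
    have bE s : \int[mu]_w `|b s w| = \int[param m (z s)]_w `|dlog pbar (V (z s)) w|.
      have mnd : measurable_fun setT (fun w => `|dlog pbar (V (z s)) w|).
        by apply: measurableT_comp => //; exact: dlog_measurable.
      rewrite (Rintegral_density (potential_density (z s)))// /Rintegral; congr fine.
      have mpb := density_measurable (potential_density (z s)).
      apply: ae_eq_integral => //; try apply/measurable_EFinP.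
      - apply: measurableT_comp => //; apply: measurable_funM => //; exact: dlog_measurable.
      - exact: measurable_funM.
      - by apply: filterS potential_regular => w [pw _] _; rewrite normrM [`|pbar _ _|]gtr0_norm.
    have H : continuous (fun y => \int[param m y]_w `|dlog pbar (V y) w|).
      apply: (@continuous_model_integral 1 (fun=> V)) => //.
      - by move=> y; apply: measurableT_comp => //; exact: dlog_measurable.
      - by move=> y w; rewrite big_ord1 normr_id; exact: ler_1Dexpn.
      - apply: filterS potential_regular => w [pw gw] y.
        by apply: cvg_norm; exact: (continuous_tangent_derive gw cV).
    have : (\int[param m (z s)]_w `|dlog pbar (V (z s)) w|) @[s --> (0 : R)] -->
        \int[param m (z 0)]_w `|dlog pbar (V (z 0)) w|.
      apply: (@continuous_comp _ _ _ z (fun y => \int[param m y]_w `|dlog pbar (V y) w|)).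
        by apply: ctz; rewrite normr0.
      exact: H.
    move=> /cvgrPdist_lt/(_ _ e0); apply: filterS => s.
    by rewrite -!bE ltr_distlC => /andP[_ /ltW].
have -> : \int[param m x]_w dlog pbar v w = \int[mu]_w b 0 w.
  rewrite (Rintegral_density (potential_density x)); last exact: dlog_measurable.
  by rewrite /b z0 Vx.
have massE : mass m \o z = (fun s => \int[mu]_w pbar (z s) w).
  by apply/funext => s; rewrite /= mass_density.
move: dmass; rewrite -massE; exact: is_derive_line.
Qed.

Lemma tangent_derivable_mass x (v : tangent x) : tangent_derivable (mass m) v.
Proof. by have [] := is_tangent_derive_mass v. Qed.

Lemma tangent_derive_mass x (v : tangent x) :
  tangent_derive (mass m) v = \int[param m x]_w dlog pbar v w.
Proof. by have [] := is_tangent_derive_mass v. Qed.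

End model_integrals.

(** * Law-invariant multilinear forms *)

Section finitely_valued.
Context (R : realType) d (T : measurableType d) (mu : {finite_measure set T -> \bar R}).
Variables (kappa : T -> nat) (k : nat).
Hypothesis mkappa : measurable_fun setT kappa.
Hypothesis kappa_lt : forall w, (kappa w < k)%N.

Lemma measurable_nat_comp d' (T' : measurableType d') (g : nat -> T') :
  measurable_fun setT (g \o kappa).
Proof.
move=> _ B mB; rewrite setTI comp_preimage -[X in measurable X]setTI.
exact: mkappa.
Qed.

Lemma measurable_nat_preimage A : measurable (kappa @^-1` A).
Proof. by rewrite -[X in measurable X]setTI; exact: mkappa. Qed.

Lemma nat_compE (g : nat -> R) w :
  g (kappa w) = \sum_(i < k) g i * \1_(kappa @^-1` [set (i : nat)]) w.
Proof.
rewrite (bigD1 (Ordinal (kappa_lt w)))//= indicE mem_set// mulr1 big1 ?addr0// => i iw.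
rewrite indicE memNset ?mulr0//= => wi; move/eqP: iw; apply.
by apply/val_inj.
Qed.

Lemma integrable_nat_comp (g : nat -> R) : mu.-integrable setT (EFin \o (g \o kappa)).
Proof.
have -> : g \o kappa = (fun w => \sum_(i < k) g i * \1_(kappa @^-1` [set (i : nat)]) w).
  by apply/funext => w; rewrite /= nat_compE.
apply: integrable_EFin_sum => i; apply: integrable_EFinZ.
by apply: integrable_indic => //; exact: measurable_nat_preimage.
Qed.

Lemma Rintegral_nat_comp (g : nat -> R) :
  \int[mu]_w g (kappa w) = \sum_(i < k) g i * fine (mu (kappa @^-1` [set (i : nat)])).
Proof.
have ii i : mu.-integrable setT (EFin \o (\1_(kappa @^-1` [set i]) : T -> R)).
  by apply: integrable_indic => //; exact: measurable_nat_preimage.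
transitivity (\int[mu]_w (\sum_(i < k) g i * \1_(kappa @^-1` [set (i : nat)]) w)).
  by apply: eq_Rintegral => w _; rewrite nat_compE.
rewrite Rintegral_sum; last by move=> i; apply: integrable_EFinZ; exact: ii.
apply: eq_bigr => i _; rewrite RintegralZl//.
rewrite /Rintegral integral_indic// ?setIT//; exact: measurable_nat_preimage.
Qed.

Lemma sum_nat_law : \sum_(i < k) fine (mu (kappa @^-1` [set (i : nat)])) = fine (mu setT).
Proof.
transitivity (\int[mu]_w cst 1 (kappa w)).
  by rewrite Rintegral_nat_comp; apply: eq_bigr => i _; rewrite mul1r.
by rewrite Rintegral_cst// mul1r.
Qed.

Lemma Lfun_nat_comp n (g : nat -> R) : g \o kappa \in Lfun mu n.+1%:R%:E.
Proof.
apply/Lfun_pow_integrable; split; first exact: measurable_nat_comp.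
exact: (integrable_nat_comp (fun i => `|g i| ^+ n.+1)).
Qed.

End finitely_valued.

Section joint_code.
Context (R : realType) d (T : measurableType d).

Lemma nat_pair_measurable (k1 k2 : T -> nat) (f : nat -> nat -> nat) :
  measurable_fun setT k1 -> measurable_fun setT k2 ->
  measurable_fun setT (fun w => f (k1 w) (k2 w)).
Proof.
move=> m1 m2 _ B mB; rewrite setTI.
rewrite (_ : _ @^-1` B = \bigcup_(p : nat * nat)
  ((k1 @^-1` [set p.1] `&` k2 @^-1` [set p.2]) `&` [set w | B (f p.1 p.2)])); last first.
  apply/seteqP; split=> [w Bw|w [[i j] _ [[/= <- <-]]]//].
  by exists (k1 w, k2 w).
apply: countable_bigcupT_measurable => // p; apply: measurableI.
  apply: measurableI; exact: measurable_nat_preimage.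
have [h|h] := pselect (B (f p.1 p.2)).
- by rewrite (_ : [set w | _] = setT)//; apply/seteqP; split.
- by rewrite (_ : [set w | _] = set0)//; apply/seteqP; split.
Qed.

(** Digits in base [K]: quotient and remainder by [K] undo [code * K + kappa m]. This brings a tuple
    of finitely valued functions to the form [h j \o kappa] with one [kappa]. *)
Lemma joint_nat_code (kappa : nat -> T -> nat) (K m : nat) :
  (forall j, measurable_fun setT (kappa j)) -> (forall j w, (kappa j w < K)%N) ->
  exists (code : T -> nat) (k : nat) (dec : nat -> nat -> nat),
    [/\ measurable_fun setT code, forall w, (code w < k)%N &
      forall j, (j < m)%N -> kappa j = dec j \o code].
Proof.
move=> mk kK; elim: m => [|m [code [k [dec [mcode ck codeE]]]]].
  by exists (fun=> 0%N), 1%N, (fun _ _ => 0%N); split => //; exact: measurable_cst.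
exists (fun w => code w * K + kappa m w)%N, (k * K)%N,
  (fun j i => if (j < m)%N then dec j (i %/ K)%N else (i %% K)%N); split.
- exact: (nat_pair_measurable (fun a b => a * K + b)%N).
- move=> w; apply: (@leq_trans (code w * K + K)%N); first by rewrite ltn_add2l.
  by rewrite -mulSnr leq_mul2r ck orbT.
- move=> j jm; apply/funext => w /=.
  have K0 : (0 < K)%N by exact: leq_ltn_trans (kK m w).
  case: ifPn => [jm'|]; first by rewrite divnMDl// divn_small// addn0 codeE.
  rewrite -leqNgt => mj; have -> : j = m by apply/eqP; rewrite eqn_leq mj -ltnS jm.
  by rewrite modnMDl modn_small.
Qed.

End joint_code.

(** * Staircases and equal cells on an interval *)

Section staircase.
Context (R : realType).
Variable S : nat -> R.

(** The largest [i < k] with [S i <= x], and 0 if there is none, so that the first cell also takes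
    in everything to the left of [S 0]. *)
Fixpoint stair (k : nat) (x : R) : nat :=
  if k is k'.+1 then (if x < S k' then stair k' x else k') else 0.

Lemma stair_lt k x : (stair k.+1 x < k.+1)%N.
Proof.
elim: k => [|k IHk] /=; first by case: ifP.
by case: ifP => // _; exact: leq_trans IHk _.
Qed.

Lemma measurable_stair k : measurable_fun setT (stair k).
Proof.
elim: k => [|k IHk]; first exact: measurable_cst.
apply: measurable_fun_ifT => //.
by apply: measurable_fun_ltr => //; exact: measurable_cst.
Qed.

Lemma stair_bounds k x : ((0 < stair k.+1 x)%N -> S (stair k.+1 x) <= x) /\
  ((stair k.+1 x < k)%N -> x < S (stair k.+1 x).+1).
Proof.
elim: k => [|k [IH1 IH2]]; first by rewrite /=; case: ifP.
have -> : stair k.+2 x = if x < S k.+1 then stair k.+1 x else k.+1 by [].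
case: ltP => [xS|Sx]; last by split => //; rewrite ltnn.
split=> // lt1; have [lt2|ge2] := ltnP (stair k.+1 x) k; first exact: IH2.
have -> // : stair k.+1 x = k.
by apply/eqP; rewrite eqn_leq ge2 -ltnS stair_lt.
Qed.

Lemma stair_eq k x i : {homo S : i j / (i <= j)%N >-> i <= j} ->
  (i <= k)%N -> S i <= x -> ((i < k)%N -> x < S i.+1) -> stair k.+1 x = i.
Proof.
move=> nS ik Six xSi; have [h1 h2] := stair_bounds k x.
have slt := stair_lt k x.
case: (ltngtP (stair k.+1 x) i) => // h.
- have := h2 (leq_trans h ik); rewrite ltNge => /negP; case.
  by rewrite (le_trans _ Six)// nS.
- have := h1 (leq_ltn_trans (leq0n _) h); rewrite leNgt => /negP; case.
  have ik' : (i < k)%N by apply: leq_trans h _; rewrite -ltnS.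
  by apply: lt_le_trans (xSi ik') _; rewrite nS.
Qed.

(* Right continuity, in the form needed to sample a staircase on a fine grid. *)
Lemma stair_right_locally_constant k x :
  exists2 e, 0 < e & forall y, x <= y < x + e -> stair k y = stair k x.
Proof.
elim: k => [|k [e e0 IHk]]; first by exists 1.
have [xS|Sx] := ltP x (S k).
  exists (Num.min e (S k - x)); first by rewrite lt_min e0 subr_gt0.
  move=> y; rewrite -ltrBlDl lt_min => /andP[xy /andP[ye yS]] /=.
  by rewrite xS ifT ?IHk//; [rewrite xy -ltrBlDl|move: yS; rewrite ltrD2r].
exists 1 => // y /andP[xy _] /=.
by rewrite !ifF//; apply/negbTE; rewrite -leNgt// (le_trans Sx).
Qed.

End staircase.

Arguments stair R S k x : simpl never.

Section uniform_cells.
Context (R : realType) (r : R).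

Lemma interval_lty : (lebesgue_measure `[0%R, r[%classic < +oo)%E.
Proof. by rewrite lebesgue_measure_itv /=; case: ifP => // _; rewrite -EFinB ltry. Qed.

(** A restriction that remains a measure on the whole line: staircases are total functions, and
    their values off [[0, r[] do not count. *)
Definition lebesgue_on : {finite_measure set (measurableTypeR R) -> \bar R} :=
  @mfrestr _ (measurableTypeR R) R `[0%R, r[ lebesgue_measure (measurable_itv `[0%R, r[) interval_lty.


Lemma lebesgue_onE A : lebesgue_on A = lebesgue_measure (A `&` `[0%R, r[).
Proof. by []. Qed.

Hypothesis r0 : 0 < r.

Lemma lebesgue_on_mass : lebesgue_on setT = r%:E.
Proof. by rewrite lebesgue_onE setTI lebesgue_measure_itv /= lte_fin r0 sube0. Qed.

Lemma lebesgue_on_ae : {ae lebesgue_on, forall x, 0 <= x < r}.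
Proof.
exists (~` `[0%R, r[); split.
- by apply: measurableC; exact: measurable_itv.
- by rewrite lebesgue_onE setICl measure0.
- by move=> x /= h; rewrite in_itv.
Qed.

Lemma lebesgue_on_stair (S : nat -> R) k i : {homo S : i j / (i <= j)%N >-> i <= j} ->
  S 0%N = 0 -> S k.+1 = r -> (i < k.+1)%N ->
  lebesgue_on (stair S k.+1 @^-1` [set i]) = (S i.+1 - S i)%:E.
Proof.
move=> nS S0 Sk ik; rewrite lebesgue_onE.
rewrite (_ : _ `&` _ = `[S i, S i.+1[%classic).
  rewrite lebesgue_measure_itv /= lte_fin; case: ltP => // h.
  have -> : S i.+1 = S i by apply/eqP; rewrite eq_le h nS.
  by rewrite subrr.
apply/seteqP; split=> x /=; rewrite !in_itv /=.
- move=> [<- /andP[x0 xr]]; have [h1 h2] := stair_bounds S k x.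
  apply/andP; split.
    by case: posnP h1 => [-> _|_ ->//]; rewrite S0.
  have [/h2//|h] := ltnP (stair S k.+1 x) k.
  suff -> : stair S k.+1 x = k by rewrite Sk.
  by apply/eqP; rewrite eqn_leq h -ltnS stair_lt.
- move=> /andP[Six xSi]; split.
    by apply: stair_eq => //.
  rewrite (le_trans _ Six) ?(lt_le_trans xSi)//.
    by rewrite -Sk nS.
  by rewrite -S0 nS.
Qed.

Definition grid (N : nat) : nat -> R := fun i => i%:R * (r / N.+1%:R).

Lemma grid_homo N : {homo grid N : i j / (i <= j)%N >-> i <= j}.
Proof. by move=> i j ij; rewrite /grid ler_wpM2r ?ler_nat// divr_ge0// ltW. Qed.

Lemma grid0 N : grid N 0 = 0. Proof. by rewrite /grid mul0r. Qed.

Lemma gridN N : grid N N.+1 = r.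
Proof. by rewrite /grid mulrC divfK// pnatr_eq0. Qed.

Definition cell (N : nat) : R -> nat := stair (grid N) N.+1.

Lemma measurable_cell N : measurable_fun setT (cell N).
Proof. exact: measurable_stair. Qed.

Lemma cell_lt N x : (cell N x < N.+1)%N.
Proof. exact: stair_lt. Qed.

Lemma lebesgue_on_cell N i : (i < N.+1)%N ->
  lebesgue_on (cell N @^-1` [set i]) = (r / N.+1%:R)%:E.
Proof.
move=> iN; rewrite lebesgue_on_stair ?grid0 ?gridN//; last exact: grid_homo.
by rewrite /grid -natr1 mulrDl addrAC subrr add0r mul1r.
Qed.

(** A staircase is right continuous, so it is sampled at the right end of the cell of [x], which
    exceeds [x] by at most one cell width. *)
Lemma cell_sample N x : 0 <= x < r ->
  x < ((cell N x).+1)%:R * (r / N.+1%:R) <= x + r / N.+1%:R.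
Proof.
move=> /andP[x0 xr]; rewrite -natr1 mulrDl mul1r lerD2r -[_ * _]/(grid N (cell N x)).
have [h1 h2] := stair_bounds (grid N) N x.
apply/andP; split; last first.
  by case: (posnP (cell N x)) h1 => [-> _|p ->//]; rewrite grid0.
have -> : grid N (cell N x) + r / N.+1%:R = grid N (cell N x).+1.
  by rewrite /grid -[(cell N x).+1%:R]natr1 mulrDl mul1r.
have [/h2//|h] := ltnP (cell N x) N.
suff -> : cell N x = N by rewrite gridN.
by apply/eqP; rewrite eqn_leq h -ltnS cell_lt.
Qed.

End uniform_cells.

Lemma dfwithE (I : eqType) (U : Type) (u : I -> U) (i : I) (v : U) :
  dfwith u i v = (fun j => if j == i then v else u j).
Proof.
apply/funext => j; case: eqVneq => [->|ji]; first by rewrite dfwithin.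
by rewrite dfwithout// eq_sym.
Qed.

(* A tuple of finitely valued functions is written [h j \o kappa], with one
   [kappa] for the whole tuple. *)
Definition law_invariant (R : realType) n (r : R) (D : Ln_family (R := R) n) :=
  forall d1 (T1 : measurableType d1) (mu1 : {finite_measure set T1 -> \bar R})
    d2 (T2 : measurableType d2) (mu2 : {finite_measure set T2 -> \bar R})
    (kappa1 : T1 -> nat) (kappa2 : T2 -> nat) (k : nat) (h : 'I_n -> nat -> R),
  mu1 setT = r%:E -> mu2 setT = r%:E ->
  measurable_fun setT kappa1 -> measurable_fun setT kappa2 ->
  (forall w, (kappa1 w < k)%N) -> (forall w, (kappa2 w < k)%N) ->
  (forall i, mu1 (kappa1 @^-1` [set i]) = mu2 (kappa2 @^-1` [set i])) ->
  D d1 T1 mu1 (fun j => h j \o kappa1) = D d2 T2 mu2 (fun j => h j \o kappa2).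

Definition kron (R : realType) (i : nat) : nat -> R := fun x => (x == i)%:R.

Definition block (R : realType) (q b : nat) : nat -> R := fun x => (x %/ q.+1 == b)%N%:R.

Lemma block_sum (R : realType) q b x :
  block R q b x = \sum_(i <- iota (b * q.+1) q.+1) kron R i x.
Proof.
have memb : (x \in iota (b * q.+1) q.+1) = (x %/ q.+1 == b)%N.
  rewrite mem_iota; apply/idP/eqP => [/andP[h1 h2]|<-].
    apply/eqP; rewrite eqn_leq leq_divRL// h1 andbT -ltnS ltn_divLR//.
    by rewrite mulSn addnC.
  by rewrite leq_trunc_div /= {1}(divn_eq x q.+1) ltn_add2l ltn_mod.
rewrite /block -memb -(count_uniq_mem _ (iota_uniq _ _)).
elim: (iota _ _) => [|i s IHs]; first by rewrite big_nil.
by rewrite big_cons -IHs /= natrD /kron eq_sym.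
Qed.

(** The total mass and the other levels determine the mass of one level, so two laws may be compared
    away from a leftover level. *)
Lemma eq_law_rest (R : realType) d1 (T1 : measurableType d1) (mu1 : {finite_measure set T1 -> \bar R})
    d2 (T2 : measurableType d2) (mu2 : {finite_measure set T2 -> \bar R})
    (kappa1 : T1 -> nat) (kappa2 : T2 -> nat) (k i0 : nat) :
  mu1 setT = mu2 setT ->
  measurable_fun setT kappa1 -> measurable_fun setT kappa2 ->
  (forall w, (kappa1 w < k)%N) -> (forall w, (kappa2 w < k)%N) ->
  (forall i, i != i0 -> mu1 (kappa1 @^-1` [set i]) = mu2 (kappa2 @^-1` [set i])) ->
  forall i, mu1 (kappa1 @^-1` [set i]) = mu2 (kappa2 @^-1` [set i]).
Proof.
move=> mass_eq m1 m2 b1 b2 eqi i; have [->|/eqi//] := eqVneq i i0.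
have [ik|ki] := ltnP i0 k; last first.
  have e0 U (kap : U -> nat) : (forall w, (kap w < k)%N) -> kap @^-1` [set i0] = set0.
    by move=> h; apply/seteqP; split => // w /= wi; have := h w; rewrite wi ltnNge ki.
  by rewrite !e0// !measure0.
have := sum_nat_law mu1 m1 b1; rewrite mass_eq -(sum_nat_law mu2 m2 b2).
rewrite (bigD1 (Ordinal ik))//= [in RHS](bigD1 (Ordinal ik))//=.
rewrite (eq_bigr (fun i : 'I_k => fine (mu2 (kappa2 @^-1` [set (i : nat)])))); last first.
  by move=> l li; rewrite eqi.
move=> /addIr h; rewrite -[LHS]fineK ?h ?fineK//; apply: fin_num_measure;
  exact: measurable_nat_preimage.
Qed.

(** * Vanishing of law-invariant forms *)

Section kernel.
Context (R : realType) (n : nat) (D : Ln_family (R := R) n.+1) (r : R).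
Hypothesis r0 : 0 < r.
Hypothesis D_law : law_invariant r D.

Let lam := lebesgue_on r.

(** Each cell is relabelled by the place of its first occurrence in [codom phi], all cells outside
    [codom phi] sharing the label [n + 1]. The labels of the [phi l] depend on the coincidences
    only. A label up to [n] has the mass of one cell or none, and the last label takes the rest, so
    the relabelled maps for [phi] and [phi'] have the same law. *)
Lemma law_invariant_kernel N (phi phi' : 'I_n.+1 -> nat) :
  (forall l, (phi l < N.+1)%N) -> (forall l, (phi' l < N.+1)%N) ->
  (forall a b, (phi a == phi b) = (phi' a == phi' b)) ->
  D lam (fun l => kron R (phi l) \o cell r N) = D lam (fun l => kron R (phi' l) \o cell r N).
Proof.
move=> phiN phi'N ker.
pose tau (f : 'I_n.+1 -> nat) x := index x (codom f).
have tauE f l x : (tau f x == tau f (f l)) = (x == f l).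
  apply/eqP/eqP => [h|->//].
  have fl : f l \in codom f by exact: codom_f.
  have xl : x \in codom f by rewrite -index_mem -/(tau f x) h index_mem.
  by rewrite -(nth_index 0%N xl) -/(tau f x) h nth_index.
have tau_eq l : tau phi (phi l) = tau phi' (phi' l).
  rewrite /tau /index /codom /image_mem !find_map; apply: eq_find => l' /=.
  exact: ker.
have sz (f : 'I_n.+1 -> nat) : size (codom f) = n.+1 by rewrite size_codom card_ord.
have FE f : (forall l, (f l < N.+1)%N) -> D lam (fun l => kron R (f l) \o cell r N) =
    D lam (fun l => kron R (tau f (f l)) \o (tau f \o cell r N)).
  move=> _; congr (D lam _); apply/funext => l; apply/funext => x /=.
  by rewrite /kron tauE.
rewrite !FE//; under eq_fun do rewrite tau_eq.
apply: (D_law (k := n.+2)).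
- exact: lebesgue_on_mass.
- exact: lebesgue_on_mass.
- by apply: measurable_nat_comp; exact: measurable_cell.
- by apply: measurable_nat_comp; exact: measurable_cell.
- by move=> w /=; rewrite ltnS -(sz phi); exact: index_size.
- by move=> w /=; rewrite ltnS -(sz phi'); exact: index_size.
apply: (@eq_law_rest _ _ _ lam _ _ lam _ _ n.+2 n.+1) => //.
- by apply: measurable_nat_comp; exact: measurable_cell.
- by apply: measurable_nat_comp; exact: measurable_cell.
- by move=> w /=; rewrite ltnS -(sz phi); exact: index_size.
- by move=> w /=; rewrite ltnS -(sz phi'); exact: index_size.
move=> i ni.
have pre f : (forall l, (f l < N.+1)%N) -> lam ((tau f \o cell r N) @^-1` [set i]) =
    if [exists l, tau f (f l) == i] then (r / N.+1%:R)%:E else 0%E.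
  move=> fN; case: ifPn => [/existsP[l /eqP fl]|/existsPn nex].
    rewrite -(lebesgue_on_cell r0 (fN l)); congr (lam _).
    apply/seteqP; split=> x /=; last by move=> ->.
    by move=> h; apply/eqP; rewrite -tauE h fl.
  rewrite (_ : _ @^-1` _ = set0) ?measure0//; apply/seteqP; split=> // x /= h.
  have [xc|xc] := boolP (cell r N x \in codom f).
    by have /codomP[l xl] := xc; have := nex l; rewrite -xl h eqxx.
  have e : index (cell r N x) (codom f) = size (codom f).
    by apply/eqP; rewrite eqn_leq index_size leqNgt index_mem.
  by move/eqP: ni; apply; rewrite -h /tau e sz.
by rewrite !pre//; under eq_existsb do rewrite tau_eq.
Qed.

End kernel.

Section vanishing.
Context (R : realType) (n : nat) (D : Ln_family (R := R) n.+1) (r : R).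
Hypothesis r0 : 0 < r.
Hypothesis D_cml : forall d (T : measurableType d) (mu : {finite_measure set T -> \bar R}),
  mu setT = r%:E -> continuous_multilinear_Ln mu (D mu).
Hypothesis D_law : law_invariant r D.

Hypothesis D_test : forall d (T : measurableType d) (mu : {finite_measure set T -> \bar R})
    (kappa : T -> nat) (j : 'I_n.+1 -> nat),
  mu setT = r%:E -> measurable_fun setT kappa -> (forall w, (kappa w < n.+1)%N) ->
  (forall i, (i < n.+1)%N -> mu (kappa @^-1` [set i]) = (r / n.+1%:R)%:E) ->
  (forall l, (j l < n.+1)%N) ->
  D mu (fun l w => kron R (j l) (kappa w)) = 0.

Let lam := lebesgue_on r.

Let Fcell N (h : 'I_n.+1 -> nat -> R) : R := D lam (fun l => h l \o cell r N).

Let Fcell_lin N (h : 'I_n.+1 -> nat -> R) l a (g1 g2 : nat -> R) :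
  Fcell N (dfwith h l (a *: g1 + g2)) =
  a * Fcell N (dfwith h l g1) + Fcell N (dfwith h l g2).
Proof.
have Ln (g : nat -> R) : g \o cell r N \in Lfun lam n.+1%:R%:E.
  by apply: (@Lfun_nat_comp _ _ _ _ _ N.+1); [exact: measurable_cell|exact: cell_lt].
have [lin _] := D_cml (lebesgue_on_mass r0).
have e g : (fun l' => dfwith h l g l' \o cell r N) =
    dfwith (fun l' => h l' \o cell r N) l (g \o cell r N).
  by rewrite !dfwithE; apply/funext => l'; case: ifP.
by rewrite /Fcell !e -lin.
Qed.

Let Fcell_sum N (h : 'I_n.+1 -> nat -> R) l (s : seq nat) (c : nat -> R) (g : nat -> nat -> R) :
  Fcell N (dfwith h l (fun x => \sum_(i <- s) c i * g i x)) =
  \sum_(i <- s) c i * Fcell N (dfwith h l (g i)).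
Proof.
elim: s => [|i s IHs].
  rewrite big_nil; have := Fcell_lin N h l 1 0 0; rewrite scaler0 addr0 mul1r.
  have -> : (fun x => \sum_(i <- [::]) c i * g i x) = 0.
    by apply/funext => x; rewrite big_nil.
  lra.
rewrite big_cons -IHs -Fcell_lin; congr (Fcell N (dfwith h l _)).
by apply/funext => x; rewrite big_cons.
Qed.

(* Induction on the number of coinciding pairs of cells. The test value at the
   blocks [j l] is the sum over all [psi] with [psi l] in block [j l]; such a
   [psi] has fewer coincidences than [phi], or the same ones and the same value. *)
Let Fcell_kron q (N := (q.+1 * n.+1).-1) (phi : 'I_n.+1 -> nat) :
  (forall l, (phi l < N.+1)%N) -> Fcell N (fun l => kron R (phi l)) = 0.
Proof.
have NE : N.+1 = (q.+1 * n.+1)%N by rewrite prednK// muln_gt0.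
pose p (f : 'I_n.+1 -> nat) := #|[pred ab : 'I_n.+1 * 'I_n.+1 | f ab.1 == f ab.2]|.
move: {2}(p phi).+1 (ltnSn (p phi)) => t.
elim: t phi => // t IHt phi; rewrite ltnS => pt phiN.
have {}IHt psi : (p psi < p phi)%N -> (forall l, (psi l < N.+1)%N) ->
    Fcell N (fun l => kron R (psi l)) = 0.
  by move=> pp; apply: IHt; exact: leq_trans pp pt.
pose j l := index (phi l) (codom phi).
have jE a b : (j a == j b) = (phi a == phi b).
  apply/eqP/eqP => [h|h]; last by rewrite /j h.
  by rewrite -(nth_index 0%N (codom_f phi a)) -/(j a) h nth_index// codom_f.
have jn l : (j l < n.+1)%N.
  have <- : size (codom phi) = n.+1 by rewrite size_codom card_ord.
  by rewrite index_mem codom_f.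
have blockN b i : (b < n.+1)%N -> i \in iota (b * q.+1) q.+1 -> (i < N.+1)%N.
  move=> bn; rewrite mem_iota NE => /andP[_ /leq_trans]; apply.
  by rewrite -mulSnr mulnC leq_mul2l bn orbT.
set X := Fcell N (fun l => kron R (phi l)).
pose same (psi : 'I_n.+1 -> nat) := forall a b, (psi a == psi b) = (phi a == phi b).
(* The blocks are expanded into cells one index at a time. Every mixed value is a natural multiple
   of [X]. Nothing can cancel, so the multiple is positive once a single term has the coincidences
   of [phi]; this is what allows dividing by it at the end. *)
have Q k : forall psi : 'I_n.+1 -> nat, (forall l, psi l \in iota (j l * q.+1) q.+1) ->
    exists c : nat, Fcell N (fun l => if (l < k)%N then block R q (j l) else kron R (psi l)) =
      c%:R * X /\ (same psi -> (0 < c)%N).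
  elim: k => [|k IHk] psi psij.
    have psiN l : (psi l < N.+1)%N by exact: (blockN (j l)).
    have [sm|nsm] := pselect (same psi).
      exists 1%N; split => //; rewrite mul1r; exact: (law_invariant_kernel r0 D_law).
    exists 0%N; split => //; rewrite mul0r; apply: IHt => //.
    have divj l : (psi l %/ q.+1 = j l)%N.
      have := psij l; rewrite mem_iota => /andP[h1 h2].
      apply/eqP; rewrite eqn_leq leq_divRL// h1 andbT -ltnS ltn_divLR//.
      by rewrite mulSn addnC.
    have sub a b : psi a == psi b -> phi a == phi b by rewrite -jE -!divj => /eqP ->.
    apply: proper_card; apply/properP; split.
      by apply/fintype.subsetP => -[a b]; rewrite !inE /=; exact: sub.
    move/existsNP : nsm => [a /existsNP[b nab]].
    have npsi : ~~ (psi a == psi b).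
      by apply/negP => pab; apply: nab; rewrite pab sub.
    exists (a, b); rewrite inE /= ?npsi//.
    by apply: contrapT => /negP nphi; apply: nab; rewrite (negbTE npsi) (negbTE nphi).
  have [kn|nk] := ltnP k n.+1; last first.
    have [c cE] := IHk psi psij; exists c.
    rewrite -[X in X = _ /\ _](_ : Fcell N (fun l =>
      if (l < k)%N then block R q (j l) else kron R (psi l)) = _)//.
    congr (Fcell N _); apply/funext => l.
    by have lk := leq_trans (ltn_ord l) nk; rewrite !ifT// ltnS ltnW.
  pose l0 := Ordinal kn.
  pose h (l : 'I_n.+1) := if (l < k)%N then block R q (j l) else kron R (psi l).
  have -> : (fun l : 'I_n.+1 => if (l < k.+1)%N then block R q (j l) else kron R (psi l)) =
      dfwith h l0 (fun x => \sum_(i <- iota (j l0 * q.+1) q.+1) 1 * kron R i x).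
    rewrite dfwithE; apply/funext => l; rewrite /h; case: eqVneq => [->|ll0].
      rewrite ltnSn; apply/funext => x; rewrite block_sum.
      by under [RHS]eq_bigr do rewrite mul1r.
    by rewrite ltnS leq_eqVlt -[(l == k :> nat)]/(l == l0) (negbTE ll0).
  rewrite Fcell_sum.
  pose upd i l := if l == l0 then i else psi l.
  have step i : i \in iota (j l0 * q.+1) q.+1 ->
      exists c : nat, 1 * Fcell N (dfwith h l0 (kron R i)) = c%:R * X /\
        (same (upd i) -> (0 < c)%N).
    move=> ii; have [|c [cE cp]] := IHk (upd i).
      by move=> l; rewrite /upd; case: eqVneq => [->|].
    exists c; split=> //; rewrite mul1r -cE; congr (Fcell N _).
    rewrite dfwithE; apply/funext => l; rewrite /h /upd.
    by case: eqVneq => [->|//]; rewrite /= ltnn.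
  have psi0 : psi l0 \in iota (j l0 * q.+1) q.+1 by [].
  have updE : upd (psi l0) = psi.
    by apply/funext => l; rewrite /upd; case: eqVneq => [->|].
  have gen (s : seq nat) : {subset s <= iota (j l0 * q.+1) q.+1} ->
      exists c : nat, \sum_(i <- s) 1 * Fcell N (dfwith h l0 (kron R i)) = c%:R * X /\
        ((exists2 i, i \in s & same (upd i)) -> (0 < c)%N).
    elim: s => [|i s IHs] sub.
      by exists 0%N; rewrite big_nil mul0r; split=> // -[].
    have [|c [cE cp]] := IHs; first by move=> x xs; apply: sub; rewrite inE xs orbT.
    have [|c' [c'E c'p]] := step i; first by apply: sub; rewrite mem_head.
    exists (c' + c)%N; rewrite big_cons cE c'E natrD mulrDl; split=> // -[x].
    rewrite inE => /orP[/eqP->|xs] sx; first by rewrite addn_gt0 c'p.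
    by rewrite addn_gt0 cp ?orbT//; exists x.
  have [//|c [cE cp]] := gen (iota (j l0 * q.+1) q.+1).
  by exists c; split=> // sm; apply: cp; exists (psi l0) => //; rewrite updE.
(* The first cell of each block: the blocks [j l] coincide exactly when the [phi l] do, and so do
   these cells. *)
have [|c [cE cp]] := Q n.+1 (fun l => j l * q.+1)%N.
  by move=> l; rewrite mem_iota leqnn /= addnS ltnS leq_addr.
have c0 : (0 < c)%N by apply: cp => a b; rewrite eqn_mul2r /= jE.
suff F0 : Fcell N (fun l : 'I_n.+1 => if (l < n.+1)%N then block R q (j l) else
    kron R (j l * q.+1)%N) = 0.
  move/eqP: cE; rewrite F0 eq_sym mulf_eq0 pnatr_eq0 -[c == 0%N]negbK -lt0n c0 /=.
  by move=> /eqP.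
have -> : (fun l : 'I_n.+1 => if (l < n.+1)%N then block R q (j l) else
    kron R (j l * q.+1)%N) = (fun l => block R q (j l)).
  by apply/funext => l; rewrite ltn_ord.
(* Blocks of [q + 1] consecutive cells are themselves [n + 1] cells of equal mass, where the form
   vanishes by hypothesis. *)
apply: (@D_test _ _ lam (fun x => cell r N x %/ q.+1)%N j) => //.
- exact: lebesgue_on_mass.
- exact: (measurable_nat_comp (measurable_cell r N) (fun x => x %/ q.+1)%N).
- by move=> w; rewrite ltn_divLR// mulnC -NE; exact: cell_lt.
move=> b bn.
have mpre := @measurable_nat_preimage _ (measurableTypeR R) _ (measurable_nat_comp (measurable_cell r N) (fun x => x %/ q.+1)%N) [set b].
rewrite -[LHS]fineK; last exact: fin_num_measure.
congr EFin.
have -> : fine (lam ((fun x => cell r N x %/ q.+1)%N @^-1` [set b])) =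
    \int[lam]_x block R q b (cell r N x).
  have -> : (fun x => block R q b (cell r N x)) =
      \1_((fun x => cell r N x %/ q.+1)%N @^-1` [set b]).
    apply/funext => x; rewrite indicE /block.
    by case: eqP => e; [rewrite mem_set|rewrite memNset].
  by rewrite /Rintegral integral_indic// setIT.
transitivity (\int[lam]_x \sum_(i <- iota (b * q.+1) q.+1) kron R i (cell r N x)).
  by apply: eq_Rintegral => x _; rewrite block_sum.
have ik i : lam.-integrable setT (EFin \o (kron R i \o cell r N)).
  by apply: (@integrable_nat_comp _ _ _ _ _ N.+1); [exact: measurable_cell|exact: cell_lt].
rewrite Rintegral_sum//.
transitivity (\sum_(i <- iota (b * q.+1) q.+1) (r / N.+1%:R)).
  apply: eq_big_seq => i /(blockN _ _ bn) iN.
  have -> : (fun x => kron R i (cell r N x)) = \1_(cell r N @^-1` [set i]).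
    apply/funext => x; rewrite indicE /kron.
    by case: eqP => e; [rewrite mem_set|rewrite memNset].
  rewrite /Rintegral integral_indic// ?setIT; last exact: measurable_nat_preimage (measurable_cell r N) _.
  exact: (congr1 fine (lebesgue_on_cell r0 iN)).
rewrite big_const_seq count_predT size_iota iter_addr_0 NE -[LHS]mulr_natr natrM.
by rewrite invfM [q.+1%:R^-1 * _]mulrC mulrA divfK// pnatr_eq0.
Qed.

Let Fcell_eq0 q (N := (q.+1 * n.+1).-1) (h : 'I_n.+1 -> nat -> R) : Fcell N h = 0.
Proof.
suff Q k : forall phi : 'I_n.+1 -> nat, (forall l, (phi l < N.+1)%N) ->
    Fcell N (fun l => if (l < k)%N then h l else kron R (phi l)) = 0.
  rewrite -(Q n.+1 (fun=> 0%N))//; congr (Fcell N _).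
  by apply/funext => l; rewrite ltn_ord.
elim: k => [|k IHk] phi phiN; first exact: Fcell_kron.
have [kn|nk] := ltnP k n.+1; last first.
  rewrite -(IHk phi phiN); congr (Fcell N _); apply/funext => l.
  by have lk := leq_trans (ltn_ord l) nk; rewrite !ifT// ltnS ltnW.
pose l0 := Ordinal kn.
pose g (l : 'I_n.+1) := if (l < k)%N then h l else kron R (phi l).
have [s sE] : exists s, s = iota 0 N.+1 by exists (iota 0 N.+1).
transitivity (Fcell N (dfwith g l0 (fun x => \sum_(i <- s) h l0 i * kron R i x))).
  congr (D lam _); apply/funext => l; rewrite dfwithE /g.
  case: eqVneq => [->|ll0]; last first.
    by rewrite ltnS leq_eqVlt -[(l == k :> nat)]/(l == l0) (negbTE ll0).
  rewrite ltnSn; apply/funext => x /=.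
  have : cell r N x \in s by rewrite sE mem_iota add0n; exact: cell_lt.
  have : uniq s by rewrite sE; exact: iota_uniq.
  elim: s {sE} => // i s IHs /= /andP[is_ us].
  rewrite inE big_cons /kron; case: eqVneq => [xi _|xi /= xs].
    rewrite mulr1; rewrite -xi in is_ *; rewrite big_seq big1 ?addr0// => i' i's.
    by case: eqVneq => [xi'|]; [rewrite xi' i's in is_|rewrite mulr0].
  by rewrite mulr0 add0r; exact: IHs.
rewrite Fcell_sum big_seq big1// => i; rewrite sE mem_iota add0n => /andP[_ iN].
rewrite (_ : Fcell _ _ = 0) ?mulr0//.
rewrite -(IHk (fun l => if l == l0 then i else phi l)); last by move=> l; case: ifP.
congr (Fcell N _); rewrite dfwithE; apply/funext => l; rewrite /g.
by case: eqVneq => [->|//]; rewrite /= ltnn.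
Qed.

(* Sampling on a fine grid and right continuity of staircases. *)
Let D_stair (S : nat -> R) k (h : 'I_n.+1 -> nat -> R) :
  D lam (fun l => h l \o stair S k.+1) = 0.
Proof.
have mlam := lebesgue_on_mass r0.
have [_ cont] := D_cml mlam.
have mst := measurable_stair S k.+1.
have lst := stair_lt S k.
have LnV l : h l \o stair S k.+1 \in Lfun lam n.+1%:R%:E by exact: Lfun_nat_comp.
apply/eqP; rewrite -normr_eq0; apply/eqP/le_anti; rewrite normr_ge0 andbT.
apply/ler_addgt0Pr => e e0; rewrite add0r.
have [rho rho0 Drho] := cont _ LnV e e0.
(* The grid has [(q + 1) (n + 1)] cells, a multiple of [n + 1]; [cell] takes the number of cells
   minus one. *)
pose N q := (q.+1 * n.+1).-1.
pose v q l := (fun i : nat => h l (stair S k.+1 (i.+1%:R * (r / (N q).+1%:R)))) \o cell r (N q).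
have Lnv q l : v q l \in Lfun lam n.+1%:R%:E.
  by apply: (@Lfun_nat_comp _ _ _ _ _ (N q).+1); [exact: measurable_cell|exact: cell_lt].
pose C := \sum_(l < n.+1) \sum_(i < k.+1) `|h l i|.
have hC l i : (i < k.+1)%N -> `|h l i| <= C.
  move=> ik; rewrite /C (bigD1 l)//= (bigD1 (Ordinal ik))//= -addrA lerDl.
  by rewrite addr_ge0// ?sumr_ge0// => ? _; rewrite sumr_ge0.
have cvgl l : (\int[lam]_x (`|v q l x - h l (stair S k.+1 x)| ^+ n.+1)) @[q --> \oo] -->
    \int[lam]_x (0 : R).
  apply: (@pratt _ _ _ lam _ (fun _ _ => (C + C) ^+ n.+1) _ (fun _ => (C + C) ^+ n.+1)).
  - move=> q; apply: measurable_funX; apply: measurableT_comp => //.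
    by apply: measurable_funB; [case: ((Lfun_pow_integrable _ _ _).1 (Lnv q l))|
       case: ((Lfun_pow_integrable _ _ _).1 (LnV l))].
  - exact: measurable_cst.
  - move=> q x; rewrite ger0_norm ?exprn_ge0//; apply: lerXn2r; rewrite ?nnegrE//.
      by rewrite addr_ge0// (le_trans _ (hC l 0%N isT)).
    by apply: le_trans (ler_normB _ _) _; rewrite lerD// hC.
  - by move=> x; rewrite normr0 exprn_ge0// addr_ge0// (le_trans _ (hC l 0%N isT)).
  - by move=> q; exact: finite_measure_integrable_cst.
  - exact: finite_measure_integrable_cst.
  - have [A [mA A0 sA]] := lebesgue_on_ae r; exists A; split=> // x /= nx.
    apply: sA => /= xr; apply: nx.
    have [d0 d0_gt0 sd] := stair_right_locally_constant S k.+1 x.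
    apply/cvgrPdist_lt => e' e'0.
    have [q0 _ Hq] := near_infty_natSinv_lt (PosNum (divr_gt0 d0_gt0 r0)).
    exists q0 => // q /= q0q.
    have := cell_sample (N q) xr => /andP[s1 s2].
    rewrite /v /= sd ?subrr ?normr0 ?expr0n ?subrr ?normr0//.
    rewrite (ltW s1)/=; apply: le_lt_trans s2 _; rewrite ltrD2l.
    have := Hq q q0q; rewrite /= ltr_pdivlMr// mulrC; apply: le_lt_trans.
    rewrite ler_pM2l// lef_pV2 ?posrE// ler_nat /N prednK ?muln_gt0//.
    by rewrite leq_pmulr.
  - by apply: aeW => x; exact: cvg_cst.
  - by move=> e' e'0; apply: nearW => q; rewrite lerDl ltW.
have small : \forall q \near \oo, forall l,
    \int[lam]_x (`|v q l x - h l (stair S k.+1 x)| ^+ n.+1) < rho ^+ n.+1.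
  apply: filter_forall => l.
  have := cvgl l; rewrite (_ : \int[lam]_x (0 : R) = 0); last first.
    by rewrite Rintegral_cst// mul0r.
  have rn : 0 < rho ^+ n.+1 by rewrite exprn_gt0.
  move=> /cvgrPdist_lt/(_ _ rn); apply: filterS => q.
  by rewrite sub0r normrN => /(le_lt_trans (ler_norm _)).
have [q0 _ Hq] := small.
have := Drho (v q0) (Lnv q0) _; rewrite [D lam (v q0)](_ : _ = 0); last exact: Fcell_eq0.
rewrite sub0r normrN => /(_ _)/ltW; apply => l.
have Lnd : v q0 l \- (h l \o stair S k.+1) \in Lfun lam n.+1%:R%:E.
  have [mv _] := (Lfun_pow_integrable _ _ _).1 (Lnv q0 l).
  have [mV _] := (Lfun_pow_integrable _ _ _).1 (LnV l).
  apply/Lfun_pow_integrable; split; first exact: measurable_funB.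
  apply: (@le_integrable_norm _ _ _ _ _ (fun _ => (C + C) ^+ n.+1)).
  - by apply: measurable_funX; apply: measurableT_comp => //; exact: measurable_funB.
  - move=> x; rewrite ger0_norm ?exprn_ge0//; apply: lerXn2r; rewrite ?nnegrE//.
      by rewrite addr_ge0// (le_trans _ (hC l 0%N isT)).
    by apply: le_trans (ler_normB _ _) _; rewrite lerD// hC.
  - exact: finite_measure_integrable_cst.
by rewrite fine_Lnorm_lt//; exact: (Hq q0 (leqnn q0)).
Qed.

(** With the cumulated masses of the levels as thresholds, a staircase on [[0, r[] has the law of
    [kappa], and law invariance carries the vanishing over to [mu]. *)
Let D_simple d (T : measurableType d) (mu : {finite_measure set T -> \bar R})
    (kappa : T -> nat) k (h : 'I_n.+1 -> nat -> R) :
  mu setT = r%:E -> measurable_fun setT kappa -> (forall w, (kappa w < k)%N) ->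
  D mu (fun l => h l \o kappa) = 0.
Proof.
move=> mur mk lk.
(* A measurable type has a point, so the bound [k] is positive. *)
have [k' kE] : exists k', k = k'.+1.
  by case: k lk => [/(_ point)//|k' _]; exists k'.
rewrite kE in lk.
pose a i := fine (mu (kappa @^-1` [set i])).
pose S i := \sum_(i' < i) a i'.
have a0 i : 0 <= a i by apply: fine_ge0.
have nS : {homo S : i j / (i <= j)%N >-> i <= j}.
  apply: homo_leq => [x|x y z|i]; [exact: lexx|exact: le_trans|].
  by rewrite /S big_ord_recr lerDl.
have Sk : S k'.+1 = r by rewrite /S sum_nat_law// mur.
transitivity (D lam (fun l => h l \o stair S k'.+1)); last exact: D_stair.
apply: (D_law (k := k'.+1)) => //.
- exact: lebesgue_on_mass.
- exact: measurable_stair.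
- exact: stair_lt.
move=> i; have [ik|ki] := ltnP i k'.+1.
  rewrite lebesgue_on_stair//; last by rewrite /S big_ord0.
  rewrite /S big_ord_recr /= addrAC subrr add0r /a fineK//.
  by apply: fin_num_measure; exact: measurable_nat_preimage.
have e0 U (kap : U -> nat) : (forall w, (kap w < k'.+1)%N) -> kap @^-1` [set i] = set0.
  by move=> hk; apply/seteqP; split => // w /= wi; have := hk w; rewrite wi ltnNge ki.
by rewrite !e0 ?measure0//; exact: stair_lt.
Qed.

(** The interval from [-(q + 1)] to [q + 1] is cut into [2 (q + 1)^2] cells of width [1 / (q + 1)],
    and values outside are clipped to the end cells. [dequantize] returns the left end of a cell. *)
Let quantize q (u : R) : nat := cell (q.+1%:R *+ 2) (q.+1 * q.+1 * 2).-1 (u + q.+1%:R).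
Let dequantize q (i : nat) : R := i%:R / q.+1%:R - q.+1%:R.

Let quantize_err q u : `|u| < q.+1%:R ->
  `|dequantize q (quantize q u) - u| <= q.+1%:R^-1.
Proof.
have q0 : 0 < q.+1%:R :> R by [].
have NE : (q.+1 * q.+1 * 2).-1.+1 = (q.+1 * q.+1 * 2)%N by rewrite prednK// !muln_gt0.
rewrite ltr_norml => /andP[u1 u2].
have ur : 0 <= u + q.+1%:R < q.+1%:R *+ 2 by rewrite mulr2n; apply/andP; split; lra.
have := cell_sample (q.+1 * q.+1 * 2).-1 ur; rewrite NE.
have -> : q.+1%:R *+ 2 / (q.+1 * q.+1 * 2)%:R = q.+1%:R^-1 :> R.
  by rewrite !natrM -mulr_natr !invfM; field; rewrite ?pnatr_eq0.
rewrite -/(quantize q u) -[(quantize q u).+1%:R]natr1 mulrDl mul1r => /andP[].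
rewrite /dequantize ler_norml.
set a := (quantize q u)%:R / q.+1%:R; set b := q.+1%:R^-1 => h1 h2.
by apply/andP; split; lra.
Qed.

(** A bound free of [q], for dominated convergence. When [|u| >= q + 1] the quantized value is at
    most [q + 1] in absolute value, hence at most [|u|]. *)
Let quantize_bound q u : `|dequantize q (quantize q u) - u| <= 2 * `|u| + 1.
Proof.
have q0 : 0 < q.+1%:R :> R by [].
have [uq|qu] := ltP `|u| q.+1%:R.
  apply: le_trans (quantize_err uq) _; apply: (@le_trans _ _ 1).
    by rewrite invf_le1// ler1n.
  by rewrite lerDr mulr_ge0.
have qlt := cell_lt (q.+1%:R *+ 2) (q.+1 * q.+1 * 2).-1 (u + q.+1%:R).
rewrite prednK ?muln_gt0// -/(quantize q u) in qlt.
have dq : `|dequantize q (quantize q u)| <= q.+1%:R.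
  rewrite /dequantize ler_norml; apply/andP; split; first by rewrite lerBrDl addrN divr_ge0.
  rewrite lerBlDr ler_pdivrMr// -natrD -natrM ler_nat.
  by apply: ltnW; apply: leq_trans qlt _; rewrite mulnDl addnn muln2.
by apply: le_trans (ler_normB _ _) _; lra.
Qed.

Theorem law_invariant_form_eq0 d (T : measurableType d)
    (mu : {finite_measure set T -> \bar R}) (u : 'I_n.+1 -> T -> R) :
  mu setT = r%:E -> (forall l, u l \in Lfun mu n.+1%:R%:E) -> D mu u = 0.
Proof.
move=> mur Lu; have [_ cont] := D_cml mur.
have mu_ l : measurable_fun setT (u l) by have [] := (Lfun_pow_integrable _ _ _).1 (Lu l).
have iu l : mu.-integrable setT (EFin \o (fun w => `|u l w| ^+ n.+1)).
  by have [] := (Lfun_pow_integrable _ _ _).1 (Lu l).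
apply/eqP; rewrite -normr_eq0; apply/eqP/le_anti; rewrite normr_ge0 andbT.
apply/ler_addgt0Pr => e e0; rewrite add0r.
have [rho rho0 Drho] := cont _ Lu e e0.
have mq q l : measurable_fun setT (fun w => quantize q (u l w)).
  apply: (measurableT_comp (measurable_cell _ _)).
  by apply: measurable_funD => //; exact: measurable_cst.
have lq q l w : (quantize q (u l w) < (q.+1 * q.+1 * 2).-1.+1)%N by exact: cell_lt.
pose v q l w := dequantize q (quantize q (u l w)).
have Lv q l : v q l \in Lfun mu n.+1%:R%:E.
  exact: (@Lfun_nat_comp _ _ _ mu _ _ (mq q l) (lq q l) n (dequantize q)).
(* Uses [2 |u| + 1 <= 4 max(1, |u|)], and that a power of the maximum is at most the sum of the
   powers. *)
pose G l w := 4 ^+ n.+1 * (1 + `|u l w| ^+ n.+1).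
have iG l : mu.-integrable setT (EFin \o G l).
  apply: integrable_EFinZ; apply: integrable_EFinD => //.
  exact: finite_measure_integrable_cst.
have vG q l w : `|v q l w - u l w| ^+ n.+1 <= G l w.
  apply: (@le_trans _ _ ((4 * Num.max 1 `|u l w|) ^+ n.+1)).
    apply: lerXn2r; rewrite ?nnegrE ?mulr_ge0// ?le_max ?ler01//.
    apply: le_trans (quantize_bound q (u l w)) _.
    have : 1 <= Num.max 1 `|u l w| by rewrite le_max lexx.
    have : `|u l w| <= Num.max 1 `|u l w| by rewrite le_max lexx orbT.
    lra.
  rewrite exprMn ler_pM2l ?exprn_gt0//; case: (leP 1 `|u l w|) => _.
    by rewrite lerDr.
  by rewrite expr1n lerDl exprn_ge0.
have mvu q l : measurable_fun setT (fun w => `|v q l w - u l w| ^+ n.+1).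
  apply: measurable_funX; apply: measurableT_comp => //; apply: measurable_funB => //.
  by have [] := (Lfun_pow_integrable _ _ _).1 (Lv q l).
have Lvu q l : v q l \- u l \in Lfun mu n.+1%:R%:E.
  apply/Lfun_pow_integrable; split.
    by apply: measurable_funB => //; have [] := (Lfun_pow_integrable _ _ _).1 (Lv q l).
  apply: le_integrable_norm (iG l); first exact: mvu.
  by move=> w; rewrite ger0_norm ?exprn_ge0// vG.
have cvgl l : (\int[mu]_w (`|v q l w - u l w| ^+ n.+1)) @[q --> \oo] --> \int[mu]_w (0 : R).
  apply: (@pratt _ _ _ mu _ (fun _ => G l) _ (G l)) => //.
  - by move=> q w; rewrite ger0_norm ?exprn_ge0// vG.
  - by move=> w; rewrite normr0 (le_trans _ (vG 0%N l w))// exprn_ge0.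
  - apply: aeW => w; apply/cvgrPdist_lt => e' e'0.
    have e'1 : 0 < Num.min 1 e' by rewrite lt_min ltr01.
    have [q0 _ Hq] := near_infty_natSinv_lt (PosNum e'1).
    have [q1 q1u] : exists q1 : nat, `|u l w| < q1%:R by exists (Num.truncn `|u l w|).+1; exact: truncnS_gt.
    exists (maxn q0 q1) => // q /=; rewrite geq_max => /andP[q0q q1q].
    have uq : `|u l w| < q.+1%:R by apply: lt_le_trans q1u _; rewrite ler_nat ltnW.
    have := quantize_err uq; have := Hq q q0q; rewrite /= lt_min => /andP[h1 h2] h3.
    rewrite sub0r normrN ger0_norm ?exprn_ge0//.
    apply: le_lt_trans h2; apply: le_trans h3.
    rewrite -/(v q l w) exprS ler_piMr// exprn_ile1//.
    exact: le_trans (quantize_err uq) (ltW h1).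
  - by apply: aeW => w; exact: cvg_cst.
  - by move=> e' e'0; apply: nearW => q; rewrite lerDl ltW.
have small : \forall q \near \oo, forall l, \int[mu]_w (`|v q l w - u l w| ^+ n.+1) < rho ^+ n.+1.
  apply: filter_forall => l.
  have := cvgl l; rewrite (_ : \int[mu]_x (0 : R) = 0); last first.
    by rewrite Rintegral_cst// mul0r.
  have rn : 0 < rho ^+ n.+1 by rewrite exprn_gt0.
  move=> /cvgrPdist_lt/(_ _ rn); apply: filterS => q.
  by rewrite sub0r normrN => /(le_lt_trans (ler_norm _)).
have [q _ /(_ _ (leqnn q)) /= Hq] := small.
have Dv : D mu (v q) = 0.
  pose kap (j : nat) w := quantize q (u (inord j) w).
  have [code [k [dec [mcode lcode codeE]]]] :=
    @joint_nat_code _ T kap _ n.+1 (fun j => mq q _) (fun j w => lq q _ w).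
  rewrite -(D_simple (fun l i => dequantize q (dec l i)) mur mcode lcode).
  congr (D mu _); apply/funext => l; apply/funext => w.
  have := congr1 (fun f => f w) (codeE l (ltn_ord l)).
  by rewrite /kap inord_val /v /= => ->.
have := Drho (v q) (Lv q); rewrite Dv sub0r normrN => /(_ _)/ltW; apply => l.
by rewrite (fine_Lnorm_lt rho0 (Lvu q l)); exact: Hq.
Qed.

End vanishing.

(** * Products of integrals *)

Lemma exprn_root (R : realType) (S : R) n : 0 <= S -> exists2 y, 0 <= y & y ^+ n.+1 = S.
Proof.
move=> S0; exists (S `^ n.+1%:R^-1); first exact: powR_ge0.
by rewrite -powR_mulrn ?powR_ge0// -powRrM mulVf ?pnatr_eq0// powRr1.
Qed.

Lemma sum_pow_bound (R : realType) n (x : 'I_n.+1 -> R) (S : R) :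
  \sum_i `|x i| ^+ n.+1 <= S ->
  exists2 y, 0 <= y & y ^+ n.+1 = S /\ forall i, `|x i| <= y.
Proof.
move=> xS; have S0 : 0 <= S by apply: le_trans xS; apply: sumr_ge0 => i _; exact: exprn_ge0.
have [y y0 yS] := exprn_root n S0; exists y => //; split=> // i.
rewrite -(@ler_pXn2r _ n.+1) ?nnegrE// yS; apply: le_trans xS.
by rewrite (bigD1 i)//= lerDl; apply: sumr_ge0 => j _; exact: exprn_ge0.
Qed.

(** Let [y] be the root of order [n + 1] of the right-hand side. Each factor is at most [y], and so
    is 1, which stands in for the indices left out of a partial product. *)
Lemma prod_bound (R : realType) n (P : pred 'I_n.+1) (x : 'I_n.+1 -> R) :
  `|\prod_(i | P i) x i| <= 1 + \sum_i `|x i| ^+ n.+1.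
Proof.
have [|y y0 [yS xy]] := @sum_pow_bound R n x (1 + \sum_i `|x i| ^+ n.+1).
  by rewrite lerDr.
have y1 : 1 <= y.
  rewrite -(@ler_pXn2r _ n.+1) ?nnegrE// yS expr1n lerDl.
  by apply: sumr_ge0 => j _; exact: exprn_ge0.
rewrite -yS normr_prod big_mkcond -[n.+1 in leRHS]card_ord -prodr_const.
by apply: ler_prod => i _; case: ifP => _; rewrite ?normr_ge0 ?xy ?ler01.
Qed.

Lemma prodD_dist (R : realType) (I : Type) (s : seq I) (u w : I -> R) (A B : R) :
  (forall i, `|w i| <= A) -> (forall i, `|u i| <= B) ->
  `|\prod_(i <- s) (u i + w i) - \prod_(i <- s) u i| <= (A + B) ^+ size s - B ^+ size s.
Proof.
move=> wA uB; elim: s => [|i s IHs]; first by rewrite !big_nil !subrr normr0.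
rewrite !big_cons /= !exprS.
set p := \prod_(j <- s) _ in IHs *; set q := \prod_(j <- s) u j in IHs *.
have -> : (u i + w i) * p - u i * q = w i * p + u i * (p - q) by ring.
have A0 : 0 <= A := le_trans (normr_ge0 _) (wA i).
have B0 : 0 <= B := le_trans (normr_ge0 _) (uB i).
have pAB : `|p| <= (A + B) ^+ size s.
  rewrite /p; elim: (s) => [|j l IHl]; first by rewrite big_nil normr1.
  rewrite big_cons normrM exprS ler_pM//.
  by rewrite (le_trans (ler_normD _ _))// addrC lerD.
apply: le_trans (ler_normD _ _) _; rewrite !normrM.
have -> : (A + B) * (A + B) ^+ size s - B * B ^+ size s =
  A * (A + B) ^+ size s + B * ((A + B) ^+ size s - B ^+ size s) by ring.
by apply: lerD; apply: ler_pM.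
Qed.

(** In the role of Hölder's inequality, for the continuity of products on L^(n+1). The [u i] are
    bounded by [B] and the [w i] by [A], roots of the two sums. If [A <= delta B], the difference is
    at most [((1 + delta)^(n+1) - 1) B^(n+1)]; otherwise [B < A / delta], and a multiple of
    [A^(n+1)] bounds everything. *)
Lemma prodD_dist_pow (R : realType) n (P : pred 'I_n.+1) (e : R) : 0 < e ->
  exists2 K : R, 0 < K & forall u w : 'I_n.+1 -> R,
    `|\prod_(i | P i) (u i + w i) - \prod_(i | P i) u i| <=
    e * (1 + \sum_i `|u i| ^+ n.+1) + K * \sum_i `|w i| ^+ n.+1.
Proof.
move=> e0.
have [delta delta0 deltaE] : exists2 delta : R, 0 < delta & (1 + delta) ^+ n.+1 - 1 <= e.
  have := @exprn_continuous R n.+1 1; rewrite /continuous_at expr1n => /cvgrPdist_le /(_ e e0) /nbhs_ballP[/= t t0 ht].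
  exists (t / 2); first by rewrite divr_gt0.
  have : ball (1 : R) t (1 + t / 2).
    by rewrite /ball /= opprD addrA subrr sub0r normrN gtr0_norm ?divr_gt0//; lra.
  by move=> /ht /=; rewrite ler_norml => /andP[h _]; lra.
exists ((1 + delta^-1) ^+ n.+1).
  by rewrite exprn_gt0// addr_gt0// invr_gt0.
move=> u w.
have [|B B0 [BS uB]] := @sum_pow_bound R n u (1 + \sum_i `|u i| ^+ n.+1).
  by rewrite lerDr.
have [A A0 [AS wA]] := @sum_pow_bound R n w _ (lexx _).
rewrite -BS -AS.
have B1 : 1 <= B.
  rewrite -(@ler_pXn2r _ n.+1) ?nnegrE// BS expr1n lerDl.
  by apply: sumr_ge0 => j _; exact: exprn_ge0.
have := @prodD_dist R 'I_n.+1 (index_enum _) (fun i => if P i then u i else 1)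
  (fun i => if P i then w i else 0) A B.
rewrite -big_mkcond (eq_bigr (fun i => if P i then u i + w i else 1)); last first.
  by move=> i _; case: ifP => //; rewrite addr0.
rewrite -big_mkcond => /(_ _ _)/le_trans; apply.
- by move=> i; case: ifP; rewrite ?normr0.
- by move=> i; case: ifP; rewrite ?normr1.
rewrite -[X in _ ^+ X]/(size (index_enum _)) /index_enum -enumT size_enum_ord.
have [AB|BA] := leP A (delta * B).
  apply: (@le_trans _ _ (e * B ^+ n.+1)); last first.
    by rewrite lerDl mulr_ge0// exprn_ge0// addr_ge0// invr_ge0 ltW.
  apply: (@le_trans _ _ (((1 + delta) * B) ^+ n.+1 - B ^+ n.+1)).
    rewrite lerD2r lerXn2r ?nnegrE ?mulr_ge0 ?addr_ge0 ?(ltW delta0)//; lra.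
  by rewrite exprMn -[X in _ - X]mul1r -mulrBl ler_wpM2r// exprn_ge0.
apply: (@le_trans _ _ (((1 + delta^-1) * A) ^+ n.+1)); last first.
  by rewrite exprMn lerDr mulr_ge0 ?(ltW e0)// exprn_ge0.
apply: (@le_trans _ _ ((A + B) ^+ n.+1)); first by rewrite gerBl exprn_ge0.
rewrite lerXn2r ?nnegrE ?mulr_ge0 ?addr_ge0 ?invr_ge0 ?(ltW delta0)// mulrDl mul1r lerD2l.
by rewrite ler_pdivlMl// ltW.
Qed.

Section product_forms.
Context (R : realType) (n : nat).
Local Notation N := n.+1.

Definition prod_int (P : pred 'I_N) : Ln_family (R := R) N :=
  fun d T mu u => \int[mu]_w \prod_(i | P i) u i w.

Section on_measure.
Context d (T : measurableType d) (mu : {finite_measure set T -> \bar R}).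
Local Notation Ln := (Lfun mu N%:R%:E).

Lemma Lfun_measurable u : u \in Ln -> measurable_fun setT u.
Proof. by move=> /Lfun_pow_integrable[]. Qed.

Lemma measurable_prod_fun (P : pred 'I_N) (u : 'I_N -> T -> R) :
  (forall j, u j \in Ln) -> measurable_fun setT (fun w => \prod_(i | P i) u i w).
Proof.
move=> Lu; under eq_fun do rewrite big_mkcond.
apply: measurable_prod => i _; case: (P i); last exact: measurable_cst.
exact: Lfun_measurable.
Qed.

Lemma Lfun_linear a u v : u \in Ln -> v \in Ln -> a *: u + v \in Ln.
Proof.
have [_ L] := Lfun_submod_closed mu (p := N%:R%:E) ltac:(by rewrite lee_fin ler1n).
exact: L.
Qed.

Lemma LfunB u v : u \in Ln -> v \in Ln -> v \- u \in Ln.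
Proof.
move=> Lu Lv; rewrite (_ : v \- u = -1 *: u + v); first exact: Lfun_linear.
by apply/funext => w; rewrite scaleN1r /= addrC.
Qed.

Lemma integrable_1Dsum_pow (u : 'I_N -> T -> R) : (forall j, u j \in Ln) ->
  mu.-integrable setT (EFin \o (fun w => 1 + \sum_i `|u i w| ^+ N)).
Proof.
move=> Lu; apply: integrable_EFinD; first exact: finite_measure_integrable_cst.
by apply: integrable_EFin_sum => i; have /Lfun_pow_integrable[] := Lu i.
Qed.

Lemma integrable_prod_fun (P : pred 'I_N) (u : 'I_N -> T -> R) :
  (forall j, u j \in Ln) ->
  mu.-integrable setT (EFin \o (fun w => \prod_(i | P i) u i w)).
Proof.
move=> Lu; apply: (@le_integrable_norm _ _ _ _ _ (fun w => 1 + \sum_i `|u i w| ^+ N)).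
- exact: measurable_prod_fun.
- by move=> w; exact: prod_bound.
- exact: integrable_1Dsum_pow.
Qed.

Lemma prod_int_dfwith (P : pred 'I_N) (l : 'I_N) (u : 'I_N -> T -> R) v :
  ~~ P l -> prod_int P mu (dfwith u l v) = prod_int P mu u.
Proof.
move=> Pl; apply: eq_Rintegral => w _; apply: eq_bigr => i Pi; rewrite dfwithE.
by case: eqVneq => // il; move: Pl; rewrite -il Pi.
Qed.

Lemma Lfun_dfwith (u : 'I_N -> T -> R) l v : (forall j, u j \in Ln) -> v \in Ln ->
  forall j, dfwith u l v j \in Ln.
Proof. by move=> Lu Lv j; rewrite dfwithE; case: eqP. Qed.

Lemma prod_int_linear (P : pred 'I_N) (l : 'I_N) (u : 'I_N -> T -> R) a v w :
  (forall j, u j \in Ln) -> v \in Ln -> w \in Ln -> P l ->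
  prod_int P mu (dfwith u l (a *: v + w)) =
  a * prod_int P mu (dfwith u l v) + prod_int P mu (dfwith u l w).
Proof.
move=> Lu Lv Lw Pl; rewrite /prod_int.
have pE v' x : \prod_(i | P i) dfwith u l v' i x =
    v' x * \prod_(i | P i && (i != l)) u i x.
  rewrite (bigD1 l)//= dfwithin; congr (_ * _); apply: eq_bigr => i /andP[_ il].
  by rewrite dfwithout// eq_sym.
have iv := integrable_prod_fun P (Lfun_dfwith l Lu Lv).
have iw := integrable_prod_fun P (Lfun_dfwith l Lu Lw).
rewrite -RintegralZl// -RintegralD//; last exact: (integrable_EFinZ a iv).
by apply: eq_Rintegral => x _; rewrite !pE /= mulrDl mulrA.
Qed.

(** Continuity in the seminorm becomes convergence along a filter, to which the limit rules for sums
    and products apply. *)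
Definition Ln_near (u : 'I_N -> T -> R) : set_system ('I_N -> T -> R) :=
  filter_from [set r : R | 0 < r] (fun r => [set v | (forall j, v j \in Ln) /\
    forall j, fine (Lnorm mu N%:R%:E (EFin \o (v j \- u j))) < r]).

Global Instance Ln_near_filter u : Filter (Ln_near u).
Proof.
apply: filter_from_filter; first by exists 1 => /=.
move=> r s /= r0 s0; exists (Num.min r s); first by rewrite /= lt_min r0 s0.
move=> v /= [Lv vu]; split; split=> // j; have := vu j; rewrite lt_min => /andP[]//.
Qed.

Definition Ln_continuous (tau : ('I_N -> T -> R) -> R) :=
  forall u, (forall j, u j \in Ln) -> tau v @[v --> Ln_near u] --> tau u.

Lemma Ln_continuousP tau : Ln_continuous tau <->
  (forall u : 'I_N -> T -> R, (forall j, u j \in Ln) ->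
     forall e : R, 0 < e -> exists2 r : R, 0 < r &
       forall v : 'I_N -> T -> R, (forall j, v j \in Ln) ->
         (forall j, fine (Lnorm mu N%:R%:E (EFin \o (v j \- u j))) < r) ->
         `|tau v - tau u| < e).
Proof.
split=> [ct u Lu e e0|ct u Lu].
  have /cvgrPdist_lt /(_ e e0) [r r0 rP] := ct u Lu.
  by exists r => // v Lv vu; rewrite distrC; apply: rP.
apply/cvgrPdist_lt => e /(ct u Lu)[r r0 rP]; exists r => // v [Lv vu].
by rewrite distrC; exact: rP.
Qed.

Lemma prod_int_continuous (P : pred 'I_N) : Ln_continuous (prod_int P mu).
Proof.
apply/Ln_continuousP => u Lu e e0.
set S := \int[mu]_w (1 + \sum_i `|u i w| ^+ N).
have S0 : 0 <= S.
  by apply: Rintegral_ge0 => w _; rewrite addr_ge0// sumr_ge0// => i _; exact: exprn_ge0.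
(* Each term receives half of [e]: the first is [S e / (2 (S + 1)) < e / 2]; in the second, [r <= 1]
   gives [r^N <= r], so that [K N r^N <= e / 2]. *)
have h0 : 0 < e / (2 * (S + 1)) by rewrite divr_gt0// mulr_gt0// ltr_wpDl.
have [K K0 KP] := prodD_dist_pow P h0.
pose r := Num.min 1 (e / (2 * (K * N%:R))).
have q0 : 0 < e / (2 * (K * N%:R)) by rewrite divr_gt0 ?mulr_gt0.
have r0 : 0 < r by rewrite lt_min ltr01.
exists r => // v Lv vu.
have Lw j : v j \- u j \in Ln by exact: LfunB.
have iw i : mu.-integrable setT (EFin \o (fun w => `|(v i \- u i) w| ^+ N)).
  by have /Lfun_pow_integrable[] := Lw i.
rewrite /prod_int -RintegralB//; try exact: integrable_prod_fun.
apply: (@le_lt_trans _ _ (\int[mu]_w (e / (2 * (S + 1)) * (1 + \sum_i `|u i w| ^+ N) +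
   K * \sum_i `|(v i \- u i) w| ^+ N))).
  have ig : mu.-integrable setT (EFin \o (fun w =>
     e / (2 * (S + 1)) * (1 + \sum_i `|u i w| ^+ N) +
   K * \sum_i `|(v i \- u i) w| ^+ N)).
    apply: integrable_EFinD; apply: integrable_EFinZ; first exact: integrable_1Dsum_pow.
    exact: integrable_EFin_sum.
  have iB := integrable_EFinB (integrable_prod_fun P Lv) (integrable_prod_fun P Lu).
  apply: (le_trans (le_normr_Rintegral _ _)) => //.
  apply: le_Rintegral => //; first exact: integrable_norm iB.
  move=> w _ /=; have := KP (fun i => u i w) (fun i => (v i \- u i) w).
  by under eq_bigr do rewrite /= addrC subrK.
rewrite RintegralD//; last 2 first.
- by apply: integrable_EFinZ; exact: integrable_1Dsum_pow.
- by apply: integrable_EFinZ; exact: integrable_EFin_sum.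
rewrite !RintegralZl//; last 2 first.
- exact: integrable_EFin_sum.
- exact: integrable_1Dsum_pow.
rewrite -/S Rintegral_sum//.
rewrite [ltRHS]splitr ltr_leD//.
  by rewrite invfM mulrA -mulrA gtr_pMr ?divr_gt0// mulrC ltr_pdivrMr ?ltr_wpDl// mul1r ltrDl.
have rN : r ^+ N <= e / (2 * (K * N%:R)).
  apply: le_trans (_ : r <= _); last by rewrite ge_min lexx orbT.
  by rewrite exprS ger_pMr// exprn_ile1 ?(ltW r0)// ge_min lexx.
apply: le_trans (_ : K * (N%:R * (e / (2 * (K * N%:R)))) <= _); last first.
  by rewrite le_eqVlt; apply/orP; left; apply/eqP; field; rewrite ?pnatr_eq0 ?gt_eqF.
rewrite ler_wpM2l ?(ltW K0)//.
apply: le_trans (_ : \sum_(i < N) e / (2 * (K * N%:R)) <= _); last first.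
  by rewrite sumr_const card_ord [leRHS]mulr_natl.
apply: ler_sum => i _; apply: le_trans rN; apply: ltW.
by rewrite -fine_Lnorm_lt.
Qed.

End on_measure.

Definition monomial (Ps : seq (pred 'I_N)) : Ln_family (R := R) N :=
  fun d T mu u => \prod_(P <- Ps) prod_int P mu u.

(** Each index lies in exactly one block of [Ps], so exactly one factor sees the varying argument,
    and it is linear in it. *)
Lemma monomial_cml (Ps : seq (pred 'I_N)) :
  (forall l, count (fun P : pred 'I_N => P l) Ps = 1%N) ->
  forall d (T : measurableType d) (mu : {finite_measure set T -> \bar R}),
  continuous_multilinear_Ln mu (monomial Ps mu).
Proof.
move=> Ps1 d T mu; split; last first.
  apply/Ln_continuousP => u Lu; rewrite /monomial; elim: Ps {Ps1} => [|P Ps IHs].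
    rewrite [X in X v @[v --> _]](_ : _ = fun=> 1); last first.
      by apply/funext => v; rewrite big_nil.
    by rewrite big_nil; exact: cvg_cst.
  rewrite big_cons; under eq_fun do rewrite big_cons.
  by apply: cvgM => //; exact: prod_int_continuous.
move=> l u a v w Lu Lv Lw; move: (Ps1 l); rewrite /monomial.
elim: Ps {Ps1} => [//|P Ps IHs] /=; rewrite !big_cons.
have [Pl|Pl] := boolP (P l); last first.
  by rewrite add0n !prod_int_dfwith// => /IHs ->; rewrite mulrDr; ring.
move=> /eqP; rewrite eqSS => /eqP c0.
rewrite prod_int_linear// mulrDl.
have cE v' : \prod_(Q <- Ps) prod_int Q mu (dfwith u l v') =
    \prod_(Q <- Ps) prod_int Q mu u.
  elim: Ps c0 {IHs} => [_|Q Ps IHs] /=; first by rewrite !big_nil.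
  by case Ql : (Q l) => // /IHs h; rewrite !big_cons h prod_int_dfwith// Ql.
by rewrite !cE mulrA.
Qed.

Lemma monomial_law (Ps : seq (pred 'I_N)) (r : R) : law_invariant r (monomial Ps).
Proof.
move=> d1 T1 mu1 d2 T2 mu2 k1 k2 k h _ _ mk1 mk2 k1k k2k law.
apply: eq_bigr => P _; rewrite /prod_int.
rewrite (Rintegral_nat_comp mu1 mk1 k1k (fun x => \prod_(i | P i) h i x)).
rewrite (Rintegral_nat_comp mu2 mk2 k2k (fun x => \prod_(i | P i) h i x)).
by apply: eq_bigr => i _; rewrite law.
Qed.

Lemma prod_int_kron (r : R) (P : pred 'I_N) (j : 'I_N -> nat) : 0 < r ->
  prod_int P (lebesgue_on r) (fun l => kron R (j l) \o cell r n) =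
  (r / N%:R) * \sum_(i < N) \prod_(l | P l) ((i : nat) == j l)%:R.
Proof.
move=> r0; rewrite /prod_int.
have h := @Rintegral_nat_comp _ _ _ (lebesgue_on r) _ _ (measurable_cell r n) (@cell_lt _ r n)
  (fun x => \prod_(i | P i) kron R (j i) x).
etransitivity; first exact: h.
rewrite mulr_sumr.
by apply: eq_bigr => i _; rewrite lebesgue_on_cell//= mulrC.
Qed.

End product_forms.

Lemma cml_combine (R : realType) n d (T : measurableType d)
    (mu : {finite_measure set T -> \bar R}) (F G : ('I_n.+1 -> T -> R) -> R) (c : R) :
  continuous_multilinear_Ln mu F -> continuous_multilinear_Ln mu G ->
  continuous_multilinear_Ln mu (fun u => F u - c * G u).
Proof.
move=> [lF cF] [lG cG]; split=> [l u a v w Lu Lv Lw|].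
  by rewrite lF// lG//; ring.
apply/Ln_continuousP => u Lu.
apply: cvgB; first by move/Ln_continuousP: cF => /(_ u Lu).
by apply: cvgZr; move/Ln_continuousP: cG => /(_ u Lu).
Qed.

Lemma law_combine (R : realType) n (r : R) (F G : Ln_family (R := R) n) (c : R) :
  law_invariant r F -> law_invariant r G ->
  law_invariant r (fun d T mu u => F d T mu u - c * G d T mu u).
Proof.
move=> lF lG d1 T1 mu1 d2 T2 mu2 k1 k2 k h m1 m2 mk1 mk2 b1 b2 law.
by rewrite (lF _ _ mu1 _ _ mu2 _ k2 k h)// (lG _ _ mu1 _ _ mu2 _ k2 k h).
Qed.

(** * Coefficients of invariant forms in degrees one, two and three *)

Definition test_value (R : realType) n (D : Ln_family (R := R) n.+1) (r : R)
    (j : 'I_n.+1 -> nat) : R :=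
  D _ _ (lebesgue_on r) (fun l => kron R (j l) \o cell r n).

(** Symmetry of a field says something about [tau] at scores only, hence the restriction to finitely
    valued tuples, which exponential families realize. *)
Definition law_symmetric (R : realType) n (r : R) (D : Ln_family (R := R) n) :=
  forall d (T : measurableType d) (mu : {finite_measure set T -> \bar R})
    (kappa : T -> nat) (k : nat) (h : 'I_n -> nat -> R) (s : 'S_n),
  mu setT = r%:E -> measurable_fun setT kappa -> (forall w, (kappa w < k)%N) ->
  D d T mu (fun j => h (s j) \o kappa) = D d T mu (fun j => h j \o kappa).

Section classification.
Context (R : realType) (n : nat) (r : R).
Hypothesis r0 : 0 < r.
Local Notation N := n.+1.

Lemma test_value_kernel (D : Ln_family (R := R) N) (phi phi' : 'I_N -> nat) :
  law_invariant r D ->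
  (forall l, (phi l < N)%N) -> (forall l, (phi' l < N)%N) ->
  (forall a b, (phi a == phi b) = (phi' a == phi' b)) ->
  test_value D r phi = test_value D r phi'.
Proof. by move=> D_law; exact: law_invariant_kernel. Qed.

Lemma test_value_sym (D : Ln_family (R := R) N) (phi : 'I_N -> nat) (s : 'S_N) :
  law_symmetric r D -> test_value D r (fun l => phi (s l)) = test_value D r phi.
Proof.
move=> D_sym; apply: (D_sym _ _ _ _ N (fun l => kron R (phi l))).
- exact: lebesgue_on_mass.
- exact: measurable_cell.
- exact: cell_lt.
Qed.

Lemma test_value_eq0 (D : Ln_family (R := R) N) :
  (forall d (T : measurableType d) (mu : {finite_measure set T -> \bar R}),
    mu setT = r%:E -> continuous_multilinear_Ln mu (D d T mu)) ->
  law_invariant r D ->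
  (forall j, (forall l, (j l < N)%N) -> test_value D r j = 0) ->
  forall d (T : measurableType d) (mu : {finite_measure set T -> \bar R}) u,
  mu setT = r%:E -> (forall l, u l \in Lfun mu N%:R%:E) -> D d T mu u = 0.
Proof.
move=> D_cml D_law D0; apply: law_invariant_form_eq0 => //.
move=> d T mu kappa j mur mk kN law jN; rewrite -(D0 j jN).
apply: (D_law _ _ mu _ _ (lebesgue_on r) kappa (cell r n) N (fun l => kron R (j l))) => //.
- exact: lebesgue_on_mass.
- exact: measurable_cell.
- exact: cell_lt.
- move=> i; have [iN|Ni] := ltnP i N; first by rewrite law// lebesgue_on_cell.
  have e0 U (k : U -> nat) : (forall w, (k w < N)%N) -> k @^-1` [set i] = set0.
    by move=> kb; apply/seteqP; split=> // w /= wi; have := kb w; rewrite wi ltnNge Ni.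
  by rewrite !e0// ?measure0//; exact: cell_lt.
Qed.

End classification.

Section classification1.
Context (R : realType) (tau : Ln_family (R := R) 1) (r : R).
Hypothesis r0 : 0 < r.
Hypothesis tau_cml : forall d (T : measurableType d) (mu : {finite_measure set T -> \bar R}),
  mu setT = r%:E -> continuous_multilinear_Ln mu (tau mu).
Hypothesis tau_law : law_invariant r tau.

Lemma classification1 d (T : measurableType d) (mu : {finite_measure set T -> \bar R})
    (u : 'I_1 -> T -> R) : mu setT = r%:E -> (forall l, u l \in Lfun mu 1%:R%:E) ->
  tau mu u = test_value tau r (fun=> 0%N) / r * \int[mu]_w u 0 w.
Proof.
move=> mur Lu; set c := _ / r.
pose mon := @monomial R 0 [:: xpredT].
have cml d' (T' : measurableType d') (nu : {finite_measure set T' -> \bar R}) :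
    nu setT = r%:E -> continuous_multilinear_Ln nu (fun v => tau nu v - c * mon _ _ nu v).
  by move=> nur; apply: cml_combine; [exact: tau_cml|exact: monomial_cml].
have law : law_invariant r (fun d T nu u => tau nu u - c * mon _ _ nu u).
  by apply: law_combine => //; exact: monomial_law.
have D0 j : (forall l, (j l < 1)%N) ->
    test_value (fun d T nu v => tau nu v - c * mon d T nu v) r j = 0.
  move=> j1; rewrite (_ : j = fun=> 0%N); last first.
    by apply/funext => l; case: (j l) (j1 l) => [|[]].
  rewrite /test_value /mon /monomial big_seq1 prod_int_kron//.
  by rewrite !big_ord1 eqxx mulr1 divr1 -/(test_value _ _ _) /c divfK ?subrr// gt_eqF.
have /eqP := @test_value_eq0 R 0 r r0 _ cml law D0 d T mu u mur Lu.
rewrite /mon /monomial big_seq1 /prod_int subr_eq0 => /eqP ->.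
by congr (_ * _); apply: eq_Rintegral => w _; rewrite big_ord1.
Qed.

End classification1.

Lemma ord2E (i : 'I_2) : i = 0 \/ i = 1.
Proof. by case: i => [[|[|//]] i2]; [left|right]; apply/val_inj. Qed.

Lemma prod_ord2 (R : comPzRingType) (F : 'I_2 -> R) : \prod_(i < 2) F i = F 0 * F 1.
Proof.
by rewrite !big_ord_recl big_ord0 mulr1; congr (F _ * F _); exact/val_inj.
Qed.

Section classification2.
Context (R : realType) (tau : Ln_family (R := R) 2) (r : R).
Hypothesis r0 : 0 < r.
Hypothesis tau_cml : forall d (T : measurableType d) (mu : {finite_measure set T -> \bar R}),
  mu setT = r%:E -> continuous_multilinear_Ln mu (tau mu).
Hypothesis tau_law : law_invariant r tau.

(* The coefficients are read off from the values at indicators of n + 1 cells of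
   equal mass r / (n + 1): all equal, all distinct, or (n = 2) two equal. *)
Definition coef2_d := test_value tau r (fun l => l : nat) / (r / 2%:R) ^+ 2.
Definition coef2_f := (test_value tau r (fun=> 0%N) - coef2_d * (r / 2%:R) ^+ 2) / (r / 2%:R).

Lemma classification2 d (T : measurableType d) (mu : {finite_measure set T -> \bar R})
    (u : 'I_2 -> T -> R) : mu setT = r%:E -> (forall l, u l \in Lfun mu 2%:R%:E) ->
  tau mu u = coef2_f * \int[mu]_w (u 0 w * u 1 w) +
    coef2_d * (\int[mu]_w u 0 w * \int[mu]_w u 1 w).
Proof.
move=> mur Lu.
pose C := @monomial R 1 [:: xpredT].
pose A := @monomial R 1 [:: xpred1 (0 : 'I_2); xpred1 1].
pose D d' (T' : measurableType d') (nu : {finite_measure set T' -> \bar R}) v :=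
  tau nu v - coef2_d * A _ _ nu v - coef2_f * C _ _ nu v.
have cml d' (T' : measurableType d') (nu : {finite_measure set T' -> \bar R}) :
    nu setT = r%:E -> continuous_multilinear_Ln nu (D d' T' nu).
  move=> nur; apply: cml_combine; last exact: monomial_cml.
  apply: cml_combine; first exact: tau_cml.
  by apply: monomial_cml => -[[|[]]].
have law : law_invariant r D.
  apply: law_combine; last exact: monomial_law.
  by apply: law_combine => //; exact: monomial_law.
have a0 : r / 2%:R != 0 by rewrite mulf_neq0 ?invr_eq0 ?pnatr_eq0// gt_eqF.
have D00 : test_value D r (fun=> 0%N) = 0.
  rewrite /test_value /D /A /C /monomial big_seq1 big_cons big_seq1 !prod_int_kron//.
  rewrite !big_ord_recl !big_ord0 !big_pred1_eq /=.
  rewrite -/(test_value _ _ _) /coef2_f; set t := test_value _ _ _; set q := coef2_d.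
  by move: (r / 2%:R) a0 => a a0; field.
have D01 : test_value D r (fun l => l : nat) = 0.
  rewrite /test_value /D /A /C /monomial big_seq1 big_cons big_seq1 !prod_int_kron//.
  rewrite !big_ord_recl !big_ord0 !big_pred1_eq /=.
  rewrite -/(test_value _ _ _) /coef2_d; set t := test_value _ _ _.
  by move: (r / 2%:R) a0 => a a0; field.
have D0 j : (forall l, (j l < 2)%N) -> test_value D r j = 0.
  move=> j1; have [j01|j01] := eqVneq (j 0) (j 1).
    rewrite -D00; apply: test_value_kernel => // a b.
    by case: (ord2E a) => ->; case: (ord2E b) => ->; rewrite ?j01 ?eqxx.
  rewrite -D01; apply: test_value_kernel => // a b.
  by case: (ord2E a) => ->; case: (ord2E b) => ->;
    rewrite ?eqxx// ?[j 1 == _]eq_sym (negPf j01).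
have /eqP := @test_value_eq0 R 1 r r0 _ cml law D0 d T mu u mur Lu.
rewrite /D subr_eq0 => /eqP; rewrite -[RHS]addr0 => /eqP.
rewrite subr_eq addr0 => /eqP ->; congr (_ * _ + _ * _).
  rewrite /C /monomial big_seq1; apply: eq_Rintegral => w _.
  by rewrite prod_ord2.
rewrite /A /monomial big_cons big_seq1; congr (_ * _); apply: eq_Rintegral => w _;
  by rewrite big_pred1_eq.
Qed.

End classification2.

Lemma ord3E (i : 'I_3) : [\/ i = 0, i = 1 | i = 2%:R].
Proof.
by case: i => [[|[|[|//]]] i3]; [apply: Or31|apply: Or32|apply: Or33]; apply/val_inj.
Qed.

Lemma prod_ord3 (R : comPzRingType) (F : 'I_3 -> R) : \prod_(i < 3) F i = F 0 * F 1 * F 2%:R.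
Proof.
rewrite !big_ord_recl big_ord0 mulr1 mulrA; congr (_ * F _ * F _); exact/val_inj.
Qed.

Lemma prod_ord3C (R : comPzRingType) (F : 'I_3 -> R) :
  [/\ \prod_(i < 3 | i != 0) F i = F 1 * F 2%:R,
      \prod_(i < 3 | i != 1) F i = F 0 * F 2%:R
    & \prod_(i < 3 | i != 2%:R) F i = F 0 * F 1].
Proof. by split; rewrite big_mkcond prod_ord3 /= ?mul1r ?mulr1. Qed.

Lemma sum_delta (R : comPzRingType) n (G : nat -> R) x : (x < n)%N ->
  \sum_(i < n) ((i : nat) == x)%:R * G i = G x.
Proof.
move=> xn; rewrite (bigD1 (Ordinal xn))//= eqxx mul1r big1 ?addr0// => i ix.
rewrite (_ : (i : nat) == x = false) ?mul0r//; apply: contraNF ix => /eqP ix.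
exact/eqP/val_inj.
Qed.

Section classification3.
Context (R : realType) (tau : Ln_family (R := R) 3) (r : R).
Hypothesis r0 : 0 < r.
Hypothesis tau_cml : forall d (T : measurableType d) (mu : {finite_measure set T -> \bar R}),
  mu setT = r%:E -> continuous_multilinear_Ln mu (tau mu).
Hypothesis tau_law : law_invariant r tau.
Hypothesis tau_sym : law_symmetric r tau.

(** The indices 0 and 1 share a cell and 2 has another one. Permutations of it give the three
    patterns with exactly two equal indices. *)
Definition j001 (l : 'I_3) : nat := (l == 2%:R).

Let a := r / 3%:R.
Definition coef3_a := test_value tau r (fun l => l : nat) / a ^+ 3.
Definition coef3_b := (test_value tau r j001 - coef3_a * a ^+ 3) / a ^+ 2.
(** The factor 3 counts the three ways of isolating one index; all of them contribute when the three
    cells coincide. *)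
Definition coef3_g :=
  (test_value tau r (fun=> 0%N) - coef3_a * a ^+ 3 - 3%:R * coef3_b * a ^+ 2) / a.

Lemma classification3 d (T : measurableType d) (mu : {finite_measure set T -> \bar R})
    (u : 'I_3 -> T -> R) : mu setT = r%:E -> (forall l, u l \in Lfun mu 3%:R%:E) ->
  tau mu u = coef3_g * \int[mu]_w (u 0 w * u 1 w * u 2%:R w) +
    coef3_a * \prod_(i < 3) \int[mu]_w u i w +
    coef3_b * (\int[mu]_w u 0 w * \int[mu]_w (u 1 w * u 2%:R w) +
               \int[mu]_w u 1 w * \int[mu]_w (u 0 w * u 2%:R w) +
               \int[mu]_w u 2%:R w * \int[mu]_w (u 0 w * u 1 w)).
Proof.
move=> mur Lu.
pose C := @monomial R 2 [:: xpredT].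
pose A := @monomial R 2 [:: xpred1 (0 : 'I_3); xpred1 1; xpred1 2%:R].
pose B i := @monomial R 2 [:: xpred1 (i : 'I_3); fun l => l != i].
pose D d' (T' : measurableType d') (nu : {finite_measure set T' -> \bar R}) v :=
  tau nu v - coef3_a * A _ _ nu v - coef3_g * C _ _ nu v - coef3_b * B 0 _ _ nu v
   - coef3_b * B 1 _ _ nu v - coef3_b * B 2%:R _ _ nu v.
have cml d' (T' : measurableType d') (nu : {finite_measure set T' -> \bar R}) :
    nu setT = r%:E -> continuous_multilinear_Ln nu (D d' T' nu).
  move=> nur; do !apply: cml_combine; try exact: monomial_cml; first exact: tau_cml.
  - by apply: monomial_cml => l; case: (ord3E l) => ->.
  - by apply: monomial_cml => l; case: (ord3E l) => ->.
  - by apply: monomial_cml => l; case: (ord3E l) => ->.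
  - by apply: monomial_cml => l; case: (ord3E l) => ->.
have law : law_invariant r D.
  by do !apply: law_combine; try exact: monomial_law.
have a0 : a != 0 by rewrite mulf_neq0 ?invr_eq0 ?pnatr_eq0// gt_eqF.
(* At indicators of cells of mass [a], an integral of a product is [a] if the cells coincide and 0
   otherwise. *)
have DE j : (forall l, (j l < 3)%N) -> test_value D r j = test_value tau r j
    - coef3_a * a ^+ 3 - coef3_g * (a * ((j 0 == j 1)%:R * (j 0 == j 2%:R)%:R))
    - coef3_b * a ^+ 2 * ((j 1 == j 2%:R)%:R + (j 0 == j 2%:R)%:R + (j 0 == j 1)%:R).
  move=> j3; rewrite /test_value /D /A /B /C /monomial !big_cons !big_nil !prod_int_kron//.
  have s1 k : \sum_(i < 3) \prod_(l < 3 | l == k) ((i : nat) == j l)%:R = 1 :> R.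
    rewrite -[RHS](@sum_delta R 3 (fun=> 1) (j k))//.
    by apply: eq_bigr => i _; rewrite big_pred1_eq mulr1.
  have s2 p q : \sum_(i < 3) ((i : nat) == j p)%:R * ((i : nat) == j q)%:R =
      (j p == j q)%:R :> R.
    exact: (@sum_delta R 3 (fun i => (i == j q)%:R) (j p)).
  have s3 : \sum_(i < 3) \prod_(l < 3) ((i : nat) == j l)%:R =
      (j 0 == j 1)%:R * (j 0 == j 2%:R)%:R :> R.
    rewrite -(@sum_delta R 3 (fun i => (i == j 1)%:R * (i == j 2%:R)%:R) (j 0))//.
    by apply: eq_bigr => i _; rewrite prod_ord3 mulrA.
  rewrite !s1 s3.
  have h0 : \sum_(i < 3) \prod_(l < 3 | l != 0) ((i : nat) == j l)%:R = (j 1 == j 2%:R)%:R :> R.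
    by rewrite -s2; apply: eq_bigr => i _; have [-> _ _] := prod_ord3C (fun l => ((i : nat) == j l)%:R : R).
  have h1 : \sum_(i < 3) \prod_(l < 3 | l != 1) ((i : nat) == j l)%:R = (j 0 == j 2%:R)%:R :> R.
    by rewrite -s2; apply: eq_bigr => i _; have [_ -> _] := prod_ord3C (fun l => ((i : nat) == j l)%:R : R).
  have h2 : \sum_(i < 3) \prod_(l < 3 | l != 2%:R) ((i : nat) == j l)%:R = (j 0 == j 1)%:R :> R.
    by rewrite -s2; apply: eq_bigr => i _; have [_ _ ->] := prod_ord3C (fun l => ((i : nat) == j l)%:R : R).
  by rewrite h0 h1 h2 /a; ring.
have D0_kernel (j j' : 'I_3 -> nat) : (forall l, (j l < 3)%N) -> (forall l, (j' l < 3)%N) ->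
    (j 0 == j 1) = (j' 0 == j' 1) -> (j 0 == j 2%:R) = (j' 0 == j' 2%:R) ->
    (j 1 == j 2%:R) = (j' 1 == j' 2%:R) -> test_value D r j = test_value D r j'.
  move=> j3 j'3 e01 e02 e12; apply: test_value_kernel => // p q.
  by case: (ord3E p) => ->; case: (ord3E q) => ->; rewrite ?eqxx// ?e01 ?e02 ?e12// eq_sym
    ?e01 ?e02 ?e12 eq_sym.
have j001_sym (s : 'S_3) : test_value tau r (j001 \o s) = test_value tau r j001.
  exact: test_value_sym.
have j001_lt l : (j001 l < 3)%N by rewrite /j001; case: (_ == _).
have D0 j : (forall l, (j l < 3)%N) -> test_value D r j = 0.
  move=> j3.
  have D001 (s : 'S_3) : test_value D r (j001 \o s) = 0.
    rewrite DE; last by move=> l; exact: j001_lt.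
    rewrite j001_sym /coef3_b /j001 /=.
    have sE l : (s l == 2%:R) = (l == (s^-1)%g 2%:R).
      by rewrite -{2}(permK s l) (inj_eq perm_inj).
    by rewrite !sE; case: (ord3E ((s^-1)%g 2%:R)) => -> /=; field.
  (* Of the eight patterns, those with exactly two coincidences contradict transitivity. The other
     five are all equal, all distinct, and [j001] up to a permutation. *)
  case E01 : (j 0 == j 1); case E02 : (j 0 == j 2%:R); case E12 : (j 1 == j 2%:R);
    try by move: E01 E02 E12; repeat (move=> /eqP ->); rewrite eqxx.
  - rewrite (D0_kernel j (fun=> 0%N))//.
    by rewrite DE// !eqxx /coef3_g /=; field.
  - by move: E02 E12; rewrite (eqP E01) => ->.
  - rewrite (D0_kernel j (j001 \o (1%g : 'S_3)))//; first by move=> l; exact: j001_lt.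
    by rewrite E01 /j001 /= !perm1.
    by rewrite E02 /j001 /= !perm1.
    by rewrite E12 /j001 /= !perm1.
  - by move: E01 E12; rewrite (eqP E02) eq_sym => ->.
  - rewrite (D0_kernel j (j001 \o tperm 1 2%:R))//; first by move=> l; exact: j001_lt.
    by rewrite E01 /j001 /= !permE.
    by rewrite E02 /j001 /= !permE.
    by rewrite E12 /j001 /= !permE.
  - rewrite (D0_kernel j (j001 \o tperm 0 2%:R))//; first by move=> l; exact: j001_lt.
    by rewrite E01 /j001 /= !permE.
    by rewrite E02 /j001 /= !permE.
    by rewrite E12 /j001 /= !permE.
  - rewrite (D0_kernel j (fun l => l : nat))//.
    by rewrite DE//= /coef3_a; field.
have /eqP := @test_value_eq0 R 2 r r0 _ cml law D0 d T mu u mur Lu.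
rewrite /D.
have AE : A _ _ mu u = \prod_(i < 3) \int[mu]_w u i w.
  rewrite /A /monomial !big_cons big_nil /prod_int prod_ord3 mulr1 mulrA.
  by congr (_ * _ * _); apply: eq_Rintegral => w _; rewrite big_pred1_eq.
have CE : C _ _ mu u = \int[mu]_w (u 0 w * u 1 w * u 2%:R w).
  by rewrite /C /monomial big_seq1; apply: eq_Rintegral => w _; rewrite prod_ord3.
have BE i : B i _ _ mu u = \int[mu]_w u i w * \int[mu]_w \prod_(l < 3 | l != i) u l w.
  rewrite /B /monomial big_cons big_seq1; congr (_ * _).
  by apply: eq_Rintegral => w _; rewrite big_pred1_eq.
rewrite AE CE !BE.
have -> : \int[mu]_w \prod_(l < 3 | l != 0) u l w = \int[mu]_w (u 1 w * u 2%:R w).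
  by apply: eq_Rintegral => w _; have [-> _ _] := prod_ord3C (fun l => u l w).
have -> : \int[mu]_w \prod_(l < 3 | l != 1) u l w = \int[mu]_w (u 0 w * u 2%:R w).
  by apply: eq_Rintegral => w _; have [_ -> _] := prod_ord3C (fun l => u l w).
have -> : \int[mu]_w \prod_(l < 3 | l != 2%:R) u l w = \int[mu]_w (u 0 w * u 1 w).
  by apply: eq_Rintegral => w _; have [_ _ ->] := prod_ord3C (fun l => u l w).
by move=> h; apply/eqP; rewrite -subr_eq0 -(eqP h); apply/eqP; ring.
Qed.

End classification3.

(** * Exponential models *)

(** Lets row vectors serve as a chart space, which has to be complete. *)
HB.instance Definition _ (R : realType) n := Uniform_isComplete.Build 'rV[R]_n.+1 cauchy_cvg.

Section row_manifold.
Context (R : realType) (n : nat).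
Local Notation E := 'rV[R]_n.+1.

Definition row_chart : chart R E := @Chart R E E setT id id.

Lemma row_chart_is_chart : is_chart row_chart.
Proof.
split => //; rewrite ?/chart_range ?image_id //=; try exact: openT.
- by apply: continuous_subspaceT => x; exact: cvg_id.
- by apply: continuous_subspaceT => x; exact: cvg_id.
Qed.

Lemma row_chart_smooth : smooth_transition row_chart row_chart.
Proof.
exists (fun x s => match s with [::] => x | [:: v] => v | _ => 0 end) => x _; split => //.
- by move=> [|b [|b' s]] [|c t] a u v //=; rewrite ?scaler0 ?addr0//; case: s => //=; rewrite ?scaler0 ?addr0.
- case=> [|[|q]].
  + by exists `|x| => -[//|//] _; rewrite big_nil mulr1.
  + by exists 1 => -[|v []]// _; rewrite big_seq1 mul1r.
  + by exists 0 => -[|v [|w s]]// _; rewrite normr0 mul0r.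
- move=> q e e0; near=> h => -[|v [|w s]] _ /=.
  + by rewrite [x + h]addrC addrK subrr normr0 big_nil mulr1 mulr_ge0// ltW.
  + by rewrite subrr subr0 normr0 !mulr_ge0 ?prodr_ge0 ?(ltW e0).
  + rewrite !subr0 normr0 !mulr_ge0 ?(ltW e0)//.
    by rewrite !big_cons !mulr_ge0// prodr_ge0.
Unshelve. all: by end_near. Qed.

(** The parameter space of all exponential families below. It is transparent, so that its points are
    row vectors by conversion. *)
Definition row_manifold : banach_manifold R.
Proof.
refine (@BanachManifold R E (fun c => c = row_chart) _ _ _ _ _).
- by move=> c ->; exact: row_chart_is_chart.
- by move=> x; exists row_chart.
- by move=> c c' -> ->; exact: row_chart_smooth.
- exact: norm_hausdorff.
- exact: uniform_regular.
Defined.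

Local Notation M := row_manifold.

Definition global_chart : chart R M := row_chart.

Lemma row_atlas : @atlas R M global_chart. Proof. by []. Qed.

Definition row_tangent (x : M) (v : E) : tangent x := tangent_of (c := global_chart) x v.

Lemma row_tangentK (x : M) (v : E) : tangent_coord global_chart (row_tangent x v) = v.
Proof. exact: tangent_coordK. Qed.

Lemma row_tangent_continuous (v : E) : continuous_vector_field (fun x : M => row_tangent x v).
Proof.
move=> c ->; rewrite -[row_chart]/global_chart.
have -> : (fun x : M => tangent_coord global_chart (row_tangent x v)) = (fun=> v).
  by apply/funext => y; exact: row_tangentK.
apply: continuous_subspaceT => x A /nbhs_singleton Av.
by apply: (@filterE _ _ (nbhs_filter x)) => y.
Qed.

Lemma row_gateaux (f : M -> R) (df : E -> E -> R) :
  (forall x v : E, is_derive x v (f : E -> R) (df x v)) -> (forall x, scalar (df x)) ->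
  continuous (fun xv : E * E => df xv.1 xv.2) -> continuously_gateaux f.
Proof.
move=> fdf ldf cdf c ->; split => /= [y _ v|y _|].
- by have [] := fdf y v.
- by move=> a u v; rewrite !(@derive_val _ _ _ _ _ _ _ (fdf _ _)); exact: ldf.
- apply: continuous_subspaceT; rewrite (_ : (fun _ => _) = fun xv : E * E => df xv.1 xv.2)//.
  by apply/funext => xv; rewrite (@derive_val _ _ _ _ _ _ _ (fdf _ _)).
Qed.

Lemma row_tangent_derive (f : M -> R) (df : E -> E -> R) (x : M) (v : tangent x) :
  (forall x v : E, is_derive x v (f : E -> R) (df x v)) -> (forall x, scalar (df x)) ->
  continuous (fun xv : E * E => df xv.1 xv.2) ->
  tangent_derive f v = df x (tangent_coord global_chart v).
Proof.
move=> fdf ldf cdf; rewrite (@tangent_derive_coord _ _ _ global_chart)//; last exact: (row_gateaux fdf).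
exact: (@derive_val _ _ _ _ _ _ _ (fdf _ _)).
Qed.

Lemma continuous_row_field (V : forall x : M, tangent x) : continuous_vector_field V ->
  continuous (fun x : M => tangent_coord global_chart (V x)).
Proof. move=> /(_ _ row_atlas) h.
by apply/(@continuous_subspace_setT M); exact: h. Qed.

End row_manifold.

Section weighted_measure.
Context (R : realType) d (T : measurableType d) (mu : {finite_measure set T -> \bar R}).
Variables (kappa : T -> nat) (k : nat).
Hypothesis mkappa : measurable_fun setT kappa.
Hypothesis kappa_lt : forall w, (kappa w < k)%N.

Let level_lty (i : nat) : (mu (kappa @^-1` [set i]) < +oo)%E.
Proof.
by rewrite -ge0_fin_numE//; apply: fin_num_measure; exact: measurable_nat_preimage.
Qed.

(** The measure with density [expR (l (kappa w))] with respect to [mu], as a sum of scaled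
    restrictions to the levels of [kappa]: it is a measure by construction, and finite because the
    sum is. *)
Definition weighted_sum (l : nat -> R) : {measure set T -> \bar R} :=
  msum (fun i => mscale (NngNum (expR_ge0 (l i)))
    (mfrestr (measurable_nat_preimage mkappa [set i]) (level_lty i))) k.

Lemma weighted_sumE (l : nat -> R) A : weighted_sum l A =
  (\sum_(i < k) (expR (l i))%:E * mu (A `&` kappa @^-1` [set (i : nat)]))%E.
Proof. by []. Qed.

Lemma weighted_sum_fin (l : nat -> R) : fin_num_fun (weighted_sum l).
Proof.
move=> A mA; rewrite weighted_sumE; apply/sum_fin_numP => i _ _.
rewrite fin_numM//; apply: fin_num_measure; apply: measurableI => //.
exact: measurable_nat_preimage.
Qed.

Definition weighted_measure (l : nat -> R) : {finite_measure set T -> \bar R} :=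
  HB.pack (weighted_sum l : set T -> \bar R) (Measure.on (weighted_sum l))
    (@Measure_isFinite.Build _ T R (weighted_sum l) (weighted_sum_fin l)).

Lemma weighted_measureE (l : nat -> R) A : weighted_measure l A =
  (\sum_(i < k) (expR (l i))%:E * mu (A `&` kappa @^-1` [set (i : nat)]))%E.
Proof. by []. Qed.

Lemma weighted_measure_density (l : nat -> R) A : measurable A ->
  weighted_measure l A = (\int[mu]_(w in A) (expR (l (kappa w)))%:E)%E.
Proof.
move=> mA; rewrite weighted_measureE.
transitivity (\int[mu]_(w in A)
    \sum_(i < k) ((expR (l i))%:E * (\1_(kappa @^-1` [set (i : nat)]) w)%:E))%E; last first.
  apply: eq_integral => w _; rewrite -[expR _]/((fun i => expR (l i)) (kappa w)).
  by rewrite (nat_compE kappa_lt) -sumEFin; apply: eq_bigr => i _; rewrite EFinM.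
have m1 i : measurable_fun A (\1_(kappa @^-1` [set i]) : T -> R).
  by apply: measurable_indic; exact: measurable_nat_preimage.
rewrite ge0_integral_sum//; last first.
  by move=> i; apply/measurable_EFinP; apply: measurable_funM.
apply: eq_bigr => i _; rewrite ge0_integralZl ?lee_fin ?expR_ge0//; last first.
- by apply/measurable_EFinP; apply: measurable_indic; exact: measurable_nat_preimage.
by rewrite integral_indic; [rewrite setIC|exact: mA|exact: measurable_nat_preimage].
Qed.

End weighted_measure.

(** Superadditivity of powers gives [|s - t|^(n+1) <= |s^(n+1) - t^(n+1)|] for nonnegative [s] and
    [t], which settles continuity at zeros of [f] as well. *)
Lemma powR_root_continuous (R : realType) (U : topologicalType) (f : U -> R) n :
  (forall x, 0 <= f x) -> continuous f -> continuous (fun x => f x `^ n.+1%:R^-1).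
Proof.
move=> f0 cf x; apply/cvgrPdist_lt => e e0.
have /cvgrPdist_lt /(_ (e ^+ n.+1) (exprn_gt0 _ e0)) := cf x.
have rootK (a : R) : 0 <= a -> (a `^ n.+1%:R^-1) ^+ n.+1 = a.
  by move=> a0; rewrite -powR_mulrn ?powR_ge0// -powRrM mulVf ?pnatr_eq0// powRr1.
have super (a b : R) : 0 <= a -> 0 <= b -> a ^+ n.+1 + b ^+ n.+1 <= (a + b) ^+ n.+1.
  move=> a0 b0; elim: (n) => [//|m IHm]; rewrite [in leRHS]exprS.
  apply: le_trans (_ : (a + b) * (a ^+ m.+1 + b ^+ m.+1) <= _); last first.
    by rewrite ler_wpM2l// addr_ge0.
  rewrite (_ : _ * _ = a ^+ m.+2 + b ^+ m.+2 + (a * b ^+ m.+1 + b * a ^+ m.+1)).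
    by rewrite lerDl addr_ge0// mulr_ge0// exprn_ge0.
  by rewrite !(exprS _ m.+1); ring.
apply: filterS => y; have := f0 x; have := f0 y.
move: (f x) (f y) => a b b0 a0; move: (rootK a a0) (rootK b b0).
move: (a `^ _) (b `^ _) (powR_ge0 a n.+1%:R^-1) (powR_ge0 b n.+1%:R^-1) => s t s0 t0.
move=> <- <- h.
rewrite -(@ltr_pXn2r _ n.+1) ?nnegrE ?(ltW e0)//; apply: le_lt_trans h.
have H (p q : R) : 0 <= q -> q <= p -> `|p - q| ^+ n.+1 <= `|p ^+ n.+1 - q ^+ n.+1|.
  move=> q0 qp; rewrite ger0_norm ?subr_ge0// ger0_norm ?subr_ge0 ?lerXn2r ?nnegrE ?(le_trans q0 qp)//.
  by rewrite lerBrDr -[in leRHS](subrK q p) super// subr_ge0.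
by case: (leP t s) => [ts|/ltW st]; [exact: H|rewrite distrC [leRHS]distrC; exact: H].
Qed.

Lemma continuous_pair_comp (R : realType) (U E F : topologicalType) (f : U -> E) (g : U -> F)
    (h : E * F -> R) : continuous f -> continuous g -> continuous h ->
  continuous (fun x => h (f x, g x)).
Proof.
move=> cf cg ch x; apply: (@cvg_comp _ _ _ (fun x => (f x, g x)) h); last exact: ch.
by apply: cvg_pair; [exact: cf|exact: cg].
Qed.

Lemma continuous_sum_pow_expR (R : realType) (U : topologicalType) k (f g : nat -> U -> R)
    (c : nat -> R) n : (forall i, continuous (f i)) -> (forall i, continuous (g i)) ->
  continuous (fun x => \sum_(i < k) `|f i x| ^+ n.+1 * (expR (g i x) * c i)).
Proof.
move=> cf cg x; apply: cvg_sumr => i; apply: cvgM.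
  apply: (@cvg_comp _ _ _ (fun x => `|f i x|) (fun z : R => z ^+ n.+1)); last first.
    exact: exprn_continuous.
  by apply: cvg_norm; exact: cf.
apply: cvgMl.
by apply: continuous_cvg; [exact: continuous_expR|exact: cg].
Qed.

Lemma cvg_sum_expR_dist (R : realType) (U : topologicalType) k (g : nat -> U -> R)
    (c : nat -> R) x : (forall i, continuous (g i)) ->
  (\sum_(i < k) `|expR (g i y) - expR (g i x)| * c i)%:E @[y --> x] --> 0%E.
Proof.
move=> cg; apply: cvg_EFin; first by near=> y.
rewrite [X in _ --> X](_ : 0 = \sum_(i < k) `|expR (g i x) - expR (g i x)| * c i); last first.
  by rewrite big1// => i _; rewrite subrr normr0 mul0r.
apply: cvg_sumr => i; apply: cvgMl; apply: cvg_norm; apply: cvgB; last exact: cvg_cst.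
by apply: continuous_cvg; [exact: continuous_expR|exact: cg].
Unshelve. all: by end_near. Qed.

Section exponential_model.
Context (R : realType) (n : nat).
Local Notation E := 'rV[R]_n.+1.
Local Notation M := (row_manifold R n).

(** The logarithm of a density on finitely many levels, with its derivative [dexpo] in the
    parameter; [expo0] places the base measure at the origin. *)
Record exponent := Exponent {
  expo :> E -> nat -> R ;
  dexpo : E -> E -> nat -> R ;
  expo0 : forall i, expo 0 i = 0 ;
  expo_derive : forall i x v, is_derive x v (expo ^~ i) (dexpo x v i) ;
  dexpo_linear : forall i x, scalar (fun v => dexpo x v i) ;
  dexpo_continuous : forall i, continuous (fun xv : E * E => dexpo xv.1 xv.2 i) }.

Variable l : exponent.

Lemma expo_gateaux i : continuously_gateaux (fun x : M => l x i).
Proof.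
exact: (@row_gateaux _ _ _ (fun x v => dexpo l x v i) (@expo_derive l i) (@dexpo_linear l i)
  (@dexpo_continuous l i)).
Qed.

Lemma expo_continuous i : continuous (fun x : M => l x i).
Proof. exact: continuously_gateaux_continuous (expo_gateaux i). Qed.

Lemma expo_tangent_derive i (x : M) (v : tangent x) :
  tangent_derive (fun y : M => l y i) v = dexpo l x (tangent_coord (global_chart R n) v) i.
Proof.
exact: (@row_tangent_derive _ _ _ (fun x v => dexpo l x v i) _ _ (@expo_derive l i)
  (@dexpo_linear l i) (@dexpo_continuous l i)).
Qed.

Section on_measure.
Context d (T : measurableType d) (mu : {finite_measure set T -> \bar R}).
Variables (kappa : T -> nat) (k : nat).
Hypothesis mkappa : measurable_fun setT kappa.
Hypothesis kappa_lt : forall w, (kappa w < k)%N.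

(* The density at [x = 0] is 1, but [mu] itself is required there: a tensor field
   takes the whole record, whose values on non-measurable sets are arbitrary. *)
Definition expo_param (x : M) : {finite_measure set T -> \bar R} :=
  if x == 0 :> E then mu else weighted_measure mu k mkappa (l x).

Definition expo_density (x : M) (w : T) : R := expR (l x (kappa w)).

Lemma expo_paramE x A : measurable A ->
  expo_param x A = weighted_measure mu k mkappa (l x) A.
Proof.
move=> mA; rewrite /expo_param; case: eqP => // ->.
rewrite weighted_measure_density//.
under eq_integral do rewrite expo0 expR0.
by rewrite integral_cst// mul1e.
Qed.

Lemma expo_positive_density x : positive_density mu (expo_param x) (expo_density x).
Proof.
split.
- exact: (@Lfun_nat_comp _ _ _ mu _ _ mkappa kappa_lt 0 (fun i => expR (l x i))).
- by apply/aeW => w; exact: expR_gt0.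
- move=> A mA; transitivity (weighted_measure mu k mkappa (l x) A); first exact: expo_paramE.
  exact: weighted_measure_density.
Qed.

Lemma expo_param_level x i : fine (expo_param x (kappa @^-1` [set i])) =
  expR (l x i) * fine (mu (kappa @^-1` [set i])).
Proof.
have mi := measurable_nat_preimage mkappa [set i].
have [_ _ ->//] := expo_positive_density x.
rewrite (eq_integral (fun=> (expR (l x i))%:E)); last first.
  by move=> w; rewrite inE /expo_density /= => ->.
rewrite integral_cst// fineM//; exact: fin_num_measure.
Qed.

Lemma expo_integral x (g : nat -> R) : \int[expo_param x]_w g (kappa w) =
  \sum_(i < k) g i * (expR (l x i) * fine (mu (kappa @^-1` [set (i : nat)]))).
Proof.
rewrite (Rintegral_nat_comp _ mkappa kappa_lt).
by apply: eq_bigr => i _; rewrite expo_param_level.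
Qed.

Lemma expo_param_continuous : continuous_to_Mplus mu expo_param.
Proof.
exists expo_density; first exact: expo_positive_density.
move=> x.
have e y : Lnorm mu 1%E (EFin \o (expo_density y \- expo_density x)) =
    (\sum_(i < k) `|expR (l y i) - expR (l x i)| * fine (mu (kappa @^-1` [set (i : nat)])))%:E.
  rewrite Lnorm1 -(@Rintegral_nat_comp _ _ _ mu _ _ mkappa kappa_lt
    (fun i => `|expR (l y i) - expR (l x i)|)).
  rewrite /Rintegral fineK//; apply: integrable_fin_num => //.
  exact: (@integrable_nat_comp _ _ _ mu _ _ mkappa kappa_lt (fun i => `|expR (l y i) - expR (l x i)|)).
under eq_fun do rewrite e.
exact: (@cvg_sum_expR_dist _ M k (fun i x => l x i)
  (fun i => fine (mu (kappa @^-1` [set i]))) x (@expo_continuous)).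
Qed.

Lemma expo_dlog x (v : tangent x) w : dlog expo_density v w =
  dexpo l x (tangent_coord (global_chart R n) v) (kappa w).
Proof.
rewrite -expo_tangent_derive /dlog.
by congr (tangent_derive _ v); apply/funext => y; rewrite /expo_density expRK.
Qed.

(** All integrals are finite sums over the levels of [kappa], so the norm of a score is a root of a
    finite sum of continuous terms. *)
Lemma expo_potential : density_potential n.+1 mu expo_param expo_density.
Proof.
split; first exact: expo_positive_density.
- apply/aeW => w; split; first by move=> x; exact: expR_gt0.
  rewrite (_ : (fun _ => _) = fun x : M => l x (kappa w)); first exact: expo_gateaux.
  by apply/funext => x; rewrite /expo_density expRK.
move=> V cV.
have dE x : dlog expo_density (V x) =
    (fun i => dexpo l x (tangent_coord (global_chart R n) (V x)) i) \o kappa.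
  by apply/funext => w; rewrite expo_dlog.
have LV x : dlog expo_density (V x) \in Lfun (expo_param x) n.+1%:R%:E.
  by rewrite dE; exact: (Lfun_nat_comp _ mkappa kappa_lt).
split=> //.
have e x : fine (Lnorm (expo_param x) n.+1%:R%:E (EFin \o dlog expo_density (V x))) =
    (\sum_(i < k) `|dexpo l x (tangent_coord (global_chart R n) (V x)) i| ^+ n.+1 *
       (expR (l x i) * fine (mu (kappa @^-1` [set (i : nat)])))) `^ n.+1%:R^-1.
  rewrite fine_Lnorm// dE; congr (_ `^ _).
  exact: (expo_integral x (fun i => `|dexpo l x (tangent_coord (global_chart R n) (V x)) i| ^+ n.+1)).
rewrite (funext e); apply: powR_root_continuous => [x|].
  apply: sumr_ge0 => i _; rewrite mulr_ge0 ?exprn_ge0// mulr_ge0 ?expR_ge0//.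
  exact: fine_ge0.
apply: (@continuous_sum_pow_expR _ M k
  (fun i x => dexpo l x (tangent_coord (global_chart R n) (V x)) i)
  (fun i x => l x i) (fun i => fine (mu (kappa @^-1` [set i])))) => i.
  apply: (@continuous_pair_comp _ M E E (fun x => x) _ _ _ _ (@dexpo_continuous l i)).
    by move=> x; exact: cvg_id.
  exact: continuous_row_field.
exact: expo_continuous.
Qed.

Definition expo_model : measure_model n.+1 M T :=
  @MeasureModel R n.+1 M d T mu expo_param expo_param_continuous
    (ex_intro _ expo_density expo_potential).

End on_measure.
End exponential_model.

Section continuity.
Context (R : realType) (U V W : topologicalType).

Lemma continuous_sumr k (f : 'I_k -> U -> R) :
  (forall i, continuous (f i)) -> continuous (fun x => \sum_(i < k) f i x).
Proof. by move=> cf x; apply: cvg_sumr => i; exact: cf. Qed.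

Lemma continuous_mulr (f g : U -> R) :
  continuous f -> continuous g -> continuous (fun x => f x * g x).
Proof. by move=> cf cg x; apply: cvgM; [exact: cf|exact: cg]. Qed.

Lemma continuous_subr (f g : U -> R) :
  continuous f -> continuous g -> continuous (fun x => f x - g x).
Proof. by move=> cf cg x; apply: cvgB; [exact: cf|exact: cg]. Qed.

Lemma continuous_invr (f : U -> R) : (forall x, f x != 0) ->
  continuous f -> continuous (fun x => (f x)^-1).
Proof. by move=> f0 cf x; apply: cvgV; [exact: f0|exact: cf]. Qed.

Lemma continuous_const (c : R) : continuous (fun _ : U => c).
Proof. by move=> x; exact: cvg_cst. Qed.

Lemma continuous_fst : continuous (fun p : U * V => p.1).
Proof. by move=> p; exact: cvg_fst. Qed.

Lemma continuous_snd : continuous (fun p : U * V => p.2).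
Proof. by move=> p; exact: cvg_snd. Qed.

Lemma continuous_compose (f : U -> V) (g : V -> W) :
  continuous f -> continuous g -> continuous (fun x => g (f x)).
Proof. by move=> cf cg x; apply: (@cvg_comp _ _ _ f g); [exact: cf|exact: cg]. Qed.

End continuity.

(** * Linear and normalized exponents *)

Section exponents.
Context (R : realType) (n : nat).
Local Notation E := 'rV[R]_n.+1.
Variable h : 'I_n.+1 -> nat -> R.

Definition lincomb (x : E) (i : nat) : R := \sum_j x 0 j * h j i.

Lemma lincomb_linear i : scalar (lincomb ^~ i).
Proof.
move=> a u v; rewrite /lincomb /= mulr_sumr -big_split; apply: eq_bigr => j _ /=.
by rewrite !mxE mulrDl mulrA.
Qed.

Lemma lincomb0 i : lincomb 0 i = 0.
Proof. by rewrite /lincomb big1// => j _; rewrite mxE mul0r. Qed.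

Lemma lincomb_delta a j i : lincomb (a *: delta_mx 0 j) i = a * h j i.
Proof.
rewrite /lincomb (bigD1 j)//= !mxE !eqxx mulr1 big1 ?addr0// => l lj.
by rewrite !mxE (negPf lj) andbF mulr0 mul0r.
Qed.

Lemma lincomb_continuous i : continuous (lincomb ^~ i).
Proof.
apply: continuous_sumr => j; apply: continuous_mulr; last exact: (@continuous_const _ E).
exact: coord_continuous.
Qed.

Lemma lincomb1_continuous i : continuous (fun xv : E * E => lincomb xv.1 i).
Proof. exact: continuous_compose (@continuous_fst E E) (@lincomb_continuous i). Qed.

Lemma lincomb2_continuous i : continuous (fun xv : E * E => lincomb xv.2 i).
Proof. exact: continuous_compose (@continuous_snd E E) (@lincomb_continuous i). Qed.

Lemma is_derive_affine (a b t : R) : is_derive t 1 (fun t : R => t * a + b) a.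
Proof. by apply: is_derive_eq; rewrite scaler0 add0r addr0 /GRing.scale /= mulr1. Qed.

Lemma lincomb_derive i x v : is_derive x v (lincomb ^~ i) (lincomb v i).
Proof.
apply: is_derive_line.
rewrite (_ : (fun _ => _) = fun t : R => t * lincomb v i + lincomb x i); first exact: is_derive_affine.
by apply/funext => t; rewrite lincomb_linear.
Qed.

Definition linear_exponent : exponent R n :=
  @Exponent R n lincomb (fun x v i => lincomb v i) lincomb0 lincomb_derive
    (fun i x => lincomb_linear i)
    lincomb2_continuous.

Variables (k : nat) (p : nat -> R).
Hypothesis p0 : forall i, 0 <= p i.
Hypothesis p1 : \sum_(i < k) p i = 1.

Definition partition_fun (x : E) : R := \sum_(i < k) p i * expR (lincomb x i).
Definition dpartition_fun (x v : E) : R := \sum_(i < k) p i * expR (lincomb x i) * lincomb v i.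

Lemma partition_fun_gt0 x : 0 < partition_fun x.
Proof.
have pe0 (i : 'I_k) : 0 <= p i * expR (lincomb x i) by rewrite mulr_ge0 ?expR_ge0.
rewrite lt_neqAle sumr_ge0// andbT eq_sym; apply/eqP => /eqP.
rewrite psumr_eq0// => /allP z; have : 1 = 0 :> R.
  rewrite -p1 big1// => i _; have := z i (mem_index_enum _).
  by rewrite /= mulf_eq0 [expR _ == 0]gt_eqF ?expR_gt0// orbF => /eqP.
by move/eqP; rewrite oner_eq0.
Qed.

Lemma partition_fun0 : partition_fun 0 = 1.
Proof. by rewrite -p1; apply: eq_bigr => i _; rewrite lincomb0 expR0 mulr1. Qed.

Lemma partition_fun_derive (x v : E) :
  is_derive (0 : R) 1 (fun t : R => partition_fun (t *: v + x)) (dpartition_fun x v).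
Proof.
rewrite (_ : (fun _ => _) = \sum_(i < k) fun t : R => p i * expR (t * lincomb v i + lincomb x i)).
  rewrite /dpartition_fun; apply: is_derive_sum => i.
  have := is_derive_affine (lincomb v i) (lincomb x i) 0.
  move=> /(is_derive1_comp (is_derive_expR _)) => D.
  rewrite -mulrA -{2}[lincomb x i]add0r -{2}(mul0r (lincomb v i)).
  exact: (is_deriveZ (p i) D).
by apply/funext => t; rewrite fct_sumE; apply: eq_bigr => i _; rewrite lincomb_linear.
Qed.

Definition normalized (x : E) (i : nat) : R := lincomb x i - ln (partition_fun x).
(** The quotient is the mean of [lincomb v] under the tilted probability weights, so these scores
    are centered; at [x = 0] the weights are the [p i]. *)
Definition dnormalized (x v : E) (i : nat) : R := lincomb v i - dpartition_fun x v / partition_fun x.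

Lemma normalized0 i : normalized 0 i = 0.
Proof. by rewrite /normalized lincomb0 partition_fun0 ln1 subrr. Qed.

Lemma normalized_derive i x v : is_derive x v (normalized ^~ i) (dnormalized x v i).
Proof.
apply: is_derive_line.
have D1 := is_derive_affine (lincomb v i) (lincomb x i) 0.
have D2 := partition_fun_derive x v.
have P0 : 0 < partition_fun (0 *: v + x) by exact: partition_fun_gt0.
have D3 := is_derive1_comp (is_derive1_ln P0) D2.
have D4 := is_deriveB D1 D3.
rewrite (_ : (fun _ => _) = (fun t : R => t * lincomb v i + lincomb x i) -
  (@ln R \o (fun t : R => partition_fun (t *: v + x)))); last first.
  by apply/funext => t; rewrite /normalized lincomb_linear.
by apply: is_derive_eq; rewrite scale0r add0r mulrC.
Qed.

Lemma dpartition_fun_linear x : scalar (dpartition_fun x).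
Proof.
move=> a u v; rewrite /dpartition_fun mulr_sumr -big_split; apply: eq_bigr => j _ /=.
by rewrite lincomb_linear; ring.
Qed.

Lemma dnormalized_linear i x : scalar (fun v => dnormalized x v i).
Proof. by move=> a u v; rewrite /dnormalized dpartition_fun_linear lincomb_linear; ring. Qed.

Lemma dnormalized_continuous i : continuous (fun xv : E * E => dnormalized xv.1 xv.2 i).
Proof.
have c3 j : continuous (fun xv : E * E => p j * expR (lincomb xv.1 j)).
  apply: continuous_mulr; first exact: (@continuous_const _ (E * E)%type).
  exact: continuous_compose (@lincomb1_continuous j) (@continuous_expR R).
apply: continuous_subr; first exact: lincomb2_continuous.
apply: continuous_mulr.
  by apply: continuous_sumr => j; apply: continuous_mulr; [exact: c3|exact: lincomb2_continuous].
apply: continuous_invr => [xv|]; first by rewrite gt_eqF// partition_fun_gt0.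
by apply: continuous_sumr => j; exact: c3.
Qed.

Definition normalized_exponent : exponent R n :=
  Exponent normalized0 normalized_derive dnormalized_linear dnormalized_continuous.

End exponents.

(** * Invariance under the partition map *)

Section push_to_nat.
Context (R : realType).

Lemma level_decomposition d (T : measurableType d) (mu : {finite_measure set T -> \bar R})
    (kappa : T -> nat) (k : nat) A :
  measurable_fun setT kappa -> (forall w, (kappa w < k)%N) -> measurable A ->
  mu A = (\sum_(i < k) mu (A `&` kappa @^-1` [set (i : nat)]))%E.
Proof.
move=> mk kk mA; have := weighted_measure_density mu mk kk (fun=> 0) mA.
rewrite weighted_measureE; under eq_bigr do rewrite expR0 mul1e.
by move=> ->; under eq_integral do rewrite expR0; rewrite integral_cst// mul1e.
Qed.

Lemma law_preimage d1 (T1 : measurableType d1) (mu1 : {finite_measure set T1 -> \bar R})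
    d2 (T2 : measurableType d2) (mu2 : {finite_measure set T2 -> \bar R})
    (kappa1 : T1 -> nat) (kappa2 : T2 -> nat) (k : nat) :
  measurable_fun setT kappa1 -> measurable_fun setT kappa2 ->
  (forall w, (kappa1 w < k)%N) -> (forall w, (kappa2 w < k)%N) ->
  (forall i, mu1 (kappa1 @^-1` [set i]) = mu2 (kappa2 @^-1` [set i])) ->
  forall B, mu1 (kappa1 @^-1` B) = mu2 (kappa2 @^-1` B).
Proof.
move=> mk1 mk2 b1 b2 law B.
rewrite (level_decomposition _ mk1 b1); last exact: measurable_nat_preimage.
rewrite (level_decomposition _ mk2 b2); last exact: measurable_nat_preimage.
apply: eq_bigr => i _; rewrite -!preimage_setI.
have [iB|niB] := pselect (B i).
  by rewrite setIidr// => _ /= ->.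
rewrite (_ : B `&` _ = set0) ?preimage_set0 ?measure0//.
by apply/seteqP; split => // j [Bj /= ji]; rewrite -ji in niB.
Qed.

Variables (d : measure_display) (T : measurableType d) (mu : {finite_measure set T -> \bar R}).
Variables (kappa : T -> nat) (k : nat).
Hypothesis mkappa : measurable_fun setT kappa.
Hypothesis kappa_lt : forall w, (kappa w < k.+1)%N.

Definition nat_mfun : {mfun T >-> nat} :=
  HB.pack kappa (@isMeasurableFun.Build _ _ _ _ kappa mkappa).

Lemma image_fin : fin_num_fun (image_measure mu nat_mfun).
Proof.
move=> A _; rewrite /image_measure /= /pushforward; apply: fin_num_measure.
exact: measurable_nat_preimage.
Qed.

Definition nat_image : {finite_measure set nat -> \bar R} :=
  HB.pack (image_measure mu nat_mfun : set nat -> \bar R) (Measure.on (image_measure mu nat_mfun))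
    (@Measure_isFinite.Build _ nat R (image_measure mu nat_mfun) image_fin).

(** The level map of an exponential model has to be bounded everywhere. On [nat] the identity is
    not; [truncate] is, and it agrees with the identity on the values of [kappa]. *)
Definition truncate (i : nat) := minn i k.

Lemma measurable_truncate : measurable_fun setT truncate. Proof. by []. Qed.

Lemma truncate_lt i : (truncate i < k.+1)%N.
Proof. by rewrite ltnS geq_minr. Qed.

Lemma truncateK w : truncate (kappa w) = kappa w.
Proof. by apply/minn_idPl; rewrite -ltnS. Qed.

Variables (n : nat) (l : exponent R n).

Lemma expo_sufficient : sufficient (expo_model l mu mkappa kappa_lt) nat_mfun.
Proof.
exists (expo_density l kappa), (fun x i => expR (l x (truncate i))), (cst 1); split.
- exact: expo_potential.
- move=> x; exact: (@Lfun_nat_comp _ _ _ nat_image _ _ measurable_truncate truncate_lt 0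
    (fun i => expR (l x i))).
- exact: (@Lfun_cst _ _ _ mu 1 1).
- by move=> x; apply/aeW => w; rewrite /expo_density /= truncateK mulr1.
Qed.

(** [nu] is only asked to have the values of the image of [mu], so a single model over [nat] is an
    image model of every space with the same law. *)
Lemma expo_image_model (nu : {finite_measure set nat -> \bar R}) :
  (forall B, nu B = mu (kappa @^-1` B)) ->
  image_model nat_mfun (expo_model l mu mkappa kappa_lt)
    (expo_model l nu measurable_truncate truncate_lt).
Proof.
move=> nuE; split=> [B _|x B _]; first exact: nuE.
transitivity (weighted_measure nu k.+1 measurable_truncate (l x) B).
  by apply: expo_paramE => //; exact: truncate_lt.
rewrite /image_measure /= /pushforward.
transitivity (weighted_measure mu k.+1 mkappa (l x) (kappa @^-1` B)); last first.
  by symmetry; apply: expo_paramE => //; exact: measurable_nat_preimage.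
rewrite !weighted_measureE; apply: eq_bigr => i _; congr (_ * _)%E.
etransitivity; first exact: (nuE (B `&` truncate @^-1` [set (i : nat)])).
rewrite preimage_setI; congr (mu (_ `&` _)).
by apply/seteqP; split => w /=; rewrite truncateK.
Qed.

End push_to_nat.

Section invariance.
Context (R : realType) (n : nat) (P : model_class (R := R) n.+1).
Variables (A : tensor_family (R := R) n.+1) (tau : Ln_family (R := R) n.+1).
Hypothesis A_inv : local_invariant_field P A tau.

Lemma tau_expo d (T : measurableType d) (mu : {finite_measure set T -> \bar R})
    (kappa : T -> nat) k (mk : measurable_fun setT kappa) (bk : forall w, (kappa w < k)%N)
    (l : exponent R n) (v : 'I_n.+1 -> 'rV[R]_n.+1) x : P (expo_model l mu mk bk) ->
  A (expo_model l mu mk bk) (fun j => row_tangent x (v j)) =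
  tau (expo_param l mu k mk x) (fun j => dexpo l x (v j) \o kappa).
Proof.
move=> Pm; have [_ _ loc _] := A_inv.
rewrite (loc _ _ _ _ Pm (expo_density l kappa)); last exact: expo_potential.
congr (tau _); apply/funext => j; apply/funext => w.
by rewrite expo_dlog row_tangentK.
Qed.

(** Both sides are the value of [A] at one model over [nat], the one built on the image of [mu1].
    Locality identifies each side with [A] on its own exponential model at the origin, and the level
    map is a sufficient statistic onto the common model. *)
Lemma tau_expo_law d1 (T1 : measurableType d1) (mu1 : {finite_measure set T1 -> \bar R})
    d2 (T2 : measurableType d2) (mu2 : {finite_measure set T2 -> \bar R})
    (kappa1 : T1 -> nat) (kappa2 : T2 -> nat) (k : nat)
    (l : exponent R n) (v : 'I_n.+1 -> 'rV[R]_n.+1) :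
  (forall d (T : measurableType d) (mu : {finite_measure set T -> \bar R})
    (kappa : T -> nat) (mk : measurable_fun setT kappa) (bk : forall w, (kappa w < k.+1)%N),
    (forall i, mu (kappa @^-1` [set i]) = mu1 (kappa1 @^-1` [set i])) ->
    P (expo_model l mu mk bk)) ->
  measurable_fun setT kappa1 -> measurable_fun setT kappa2 ->
  (forall w, (kappa1 w < k)%N) -> (forall w, (kappa2 w < k)%N) ->
  (forall i, mu1 (kappa1 @^-1` [set i]) = mu2 (kappa2 @^-1` [set i])) ->
  tau mu1 (fun j => dexpo l 0 (v j) \o kappa1) = tau mu2 (fun j => dexpo l 0 (v j) \o kappa2).
Proof.
move=> Pl mk1 mk2 b1 b2 law; have [_ _ loc suff] := A_inv.
(* The maps into [nat] are set up with bounds of the form [k.+1], so [k] is enlarged by one. *)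
have lt_S U (kap : U -> nat) : (forall w, (kap w < k)%N) -> forall w, (kap w < k.+1)%N.
  by move=> b w; rewrite ltnS ltnW.
have nuE B : nat_image mu1 mk1 B = mu1 (kappa1 @^-1` B) by [].
have E d (T : measurableType d) (mu : {finite_measure set T -> \bar R})
    (kappa : T -> nat) (mk : measurable_fun setT kappa) (bk : forall w, (kappa w < k)%N) :
    (forall i, mu1 (kappa1 @^-1` [set i]) = mu (kappa @^-1` [set i])) ->
    tau mu (fun j => dexpo l 0 (v j) \o kappa) =
    A (expo_model l (nat_image mu1 mk1) (measurable_truncate k) (truncate_lt k))
      (fun j => row_tangent (0 : row_manifold R n) (v j)).
  move=> lw; have Pm : P (expo_model l mu mk (lt_S _ _ bk)).
    by apply: Pl => i; rewrite lw.
  have := suff _ _ _ _ _ _ _ _ Pm (expo_sufficient mu mk (lt_S _ _ bk) l)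
    (expo_image_model mk (lt_S _ _ bk) l _) 0 (fun j => row_tangent _ (v j)).
  move=> /(_ (nat_image mu1 mk1)) <-; last first.
    by move=> B; rewrite nuE; exact: (law_preimage mk1 mk).
  by rewrite tau_expo// /expo_param eqxx.
by rewrite (E _ _ mu1)// (E _ _ mu2).
Qed.

End invariance.

(** * Law invariance and continuity of the test values *)

Section all_models.
Context (R : realType) (n : nat).
Variables (A : tensor_family (R := R) n.+1) (tau : Ln_family (R := R) n.+1).
Hypothesis A_inv : local_invariant_field (@all_models R n.+1) A tau.

Let linE (h : 'I_n.+1 -> nat -> R) j i :
  dexpo (linear_exponent h) 0 (delta_mx 0 j) i = h j i.
Proof. by have := lincomb_delta h 1 j i; rewrite scale1r mul1r. Qed.

Let linE' (U : Type) (kap : U -> nat) (h : 'I_n.+1 -> nat -> R) :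
  (fun j => h j \o kap) = (fun j => dexpo (linear_exponent h) 0 (delta_mx 0 j) \o kap).
Proof. by apply/funext => j; apply/funext => w /=; rewrite -linE. Qed.

Lemma invariant_field_law (r : R) : law_invariant r tau.
Proof.
move=> d1 T1 mu1 d2 T2 mu2 k1 k2 k h _ _ mk1 mk2 b1 b2 law; rewrite (linE' k1 h) (linE' k2 h).
exact: (tau_expo_law A_inv).
Qed.

Lemma invariant_field_symmetric (r : R) : symmetric_field (@all_models R n.+1) A ->
  law_symmetric r tau.
Proof.
move=> A_sym d T mu kappa k h s _ mk bk; rewrite (linE' kappa h).
rewrite (linE' kappa (fun j => h (s j))).
have tE v := @tau_expo _ _ _ _ _ A_inv _ _ mu kappa k mk bk (linear_exponent h) v 0 I.
rewrite /expo_param eqxx in tE.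
rewrite -tE -(A_sym _ _ _ (expo_model (linear_exponent h) mu mk bk) I _ s) tE.
congr (tau _); apply/funext => j; apply/funext => w.
by transitivity (h (s j) (kappa w)); [exact: (linE (fun j0 => h (s j0)))|symmetry; exact: linE].
Qed.

Lemma test_value_continuous (j : 'I_n.+1 -> nat) (r : R) : (forall l, (j l < n.+1)%N) ->
  0 < r -> {for r, continuous (fun r => test_value tau r j)}.
Proof.
move=> jn r0; pose N : R := n.+1%:R.
have N0 : 0 < N by rewrite ltr0n.
pose h (a : 'I_n.+1) := kron R a.
pose l := linear_exponent h.
pose m := expo_model l (lebesgue_on N) (measurable_cell N n) (@cell_lt _ N n).
(* With one parameter for each cell, the diagonal multiplies all cell masses by [expR s]. The field
   at [x s] thus gives the test value at mass [N * expR s], and its weak continuity is continuity in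
   [s]. *)
pose x (s : R) : row_manifold R n := s *: const_mx 1.
pose v (a : 'I_n.+1) : 'rV[R]_n.+1 := delta_mx 0 (Ordinal (jn a)).
have vE a : dexpo l 0 (v a) = kron R (j a) by apply/funext => i; rewrite linE.
have dlE y a : dexpo l y (v a) = kron R (j a) by rewrite -vE.
have xE s (i : 'I_n.+1) : l (x s) i = s.
  rewrite /l /= /lincomb (bigD1 i)//= !mxE /h /kron eqxx !mulr1 big1 ?addr0// => a ai.
  by rewrite [_ == _](_ : _ = false) ?mulr0//; apply: contraNF ai => /eqP/val_inj ->.
have G s : A m (fun a => row_tangent (x s) (v a)) = test_value tau (N * expR s) j.
  rewrite (@tau_expo _ _ _ _ _ A_inv _ _ _ _ _ _ _ _ _ _ I).
  have S0 : 0 < N * expR s by rewrite mulr_gt0 ?expR_gt0.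
  rewrite /test_value; under eq_fun do rewrite dlE.
  have lev i : (i < n.+1)%N -> expo_param l (lebesgue_on N) n.+1 (measurable_cell N n) (x s)
      (cell N n @^-1` [set i]) = (expR s)%:E.
    move=> ni; rewrite -[LHS]fineK; last by apply: fin_num_measure; exact: measurable_nat_preimage (measurable_cell N n) _.
    have lv := @expo_param_level R n l _ _ (lebesgue_on N) (cell N n) n.+1
      (measurable_cell N n) (@cell_lt _ N n) (x s) i.
    congr EFin; etransitivity; first exact: lv.
    by rewrite (xE s (Ordinal ni)) lebesgue_on_cell// divff ?gt_eqF//= mulr1.
  apply: (@invariant_field_law (N * expR s) _ _
    (expo_param l (lebesgue_on N) n.+1 (measurable_cell N n) (x s)) _ _
    (lebesgue_on (N * expR s)) (cell N n) (cell (N * expR s) n) n.+1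
    (fun a => kron R (j a))).
  - rewrite -[LHS]fineK; last exact: fin_num_measure.
    have sl := sum_nat_law (expo_param l (lebesgue_on N) n.+1 (measurable_cell N n) (x s))
      (measurable_cell N n) (@cell_lt _ N n).
    congr EFin; etransitivity; first exact: esym sl.
    transitivity (\sum_(i < n.+1) expR s); last by rewrite sumr_const card_ord mulr_natl.
    by apply: eq_bigr => i _; rewrite lev.
  - exact: lebesgue_on_mass.
  - exact: measurable_cell.
  - exact: measurable_cell.
  - exact: cell_lt.
  - exact: cell_lt.
  - move=> i; have [ni|ni] := ltnP i n.+1.
      by rewrite lev// lebesgue_on_cell//; congr _%:E; rewrite mulrAC divff ?gt_eqF// mul1r.
    have e0 (q : R) : cell q n @^-1` [set i] = set0.
      apply/seteqP; split => // w /= wi; have := cell_lt q n w.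
      by rewrite wi ltnNge ni.
    by rewrite !e0 !measure0.
have [cA _ _ _] := A_inv.
have cG : continuous (fun s : R => test_value tau (N * expR s) j).
  rewrite -(funext G).
  have [_ /(_ (fun a y => row_tangent y (v a)))] := cA _ _ _ m I.
  move=> /(_ (fun a => @row_tangent_continuous R n (v a))) cV.
  apply: (@continuous_compose _ (row_manifold R n) _ x _ _ cV).
  by move=> s; exact: scalel_continuous.
(* Back from [s] to the mass by [s = ln (t / N)]. *)
have e : \forall t \near r, test_value tau (N * expR (ln (t / N))) j = test_value tau t j.
  near=> t; have t0 : 0 < t by near: t; exact: lt_nbhsr.
  by rewrite lnK ?posrE ?divr_gt0// mulrC divfK ?gt_eqF.
have er : test_value tau (N * expR (ln (r / N))) j = test_value tau r j := nbhs_singleton e.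
suff : test_value tau t j @[t --> r] --> test_value tau r j by [].
rewrite -er; apply: cvg_trans (near_eq_cvg e) _.
apply: (@cvg_comp _ _ _ (fun t : R => ln (t / N)) (fun s => test_value tau (N * expR s) j)
  _ _ _ _ (cG _)).
apply: (@cvg_comp _ _ _ (fun t : R => t / N) (@ln R)); first by apply: cvgMl; exact: cvg_id.
by apply: continuous_ln; rewrite divr_gt0.
Unshelve. all: by end_near. Qed.

End all_models.

(** * Fields on all models *)

Section positive_continuity.
Context (R : realType).

Definition cts_pos (f : R -> R) := forall r : R, 0 < r -> f t @[t --> r] --> f r.

Lemma cts_pos_within f : cts_pos f -> {within `]0, +oo[, continuous f}.
Proof.
move=> cf; rewrite continuous_open_subspace; last exact: interval_open.
by move=> r; rewrite inE /= in_itv /= andbT => r0; exact: cf.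
Qed.

Lemma cts_posM f g : cts_pos f -> cts_pos g -> cts_pos (fun t => f t * g t).
Proof. by move=> cf cg r r0; apply: cvgM; [exact: cf|exact: cg]. Qed.

Lemma cts_posB f g : cts_pos f -> cts_pos g -> cts_pos (fun t => f t - g t).
Proof. by move=> cf cg r r0; apply: cvgB; [exact: cf|exact: cg]. Qed.

Lemma cts_posV f : (forall r, 0 < r -> f r != 0) -> cts_pos f -> cts_pos (fun t => (f t)^-1).
Proof. by move=> f0 cf r r0; apply: cvgV; [exact: f0|exact: cf]. Qed.

Lemma cts_pos_cst c : cts_pos (fun=> c).
Proof. by move=> r r0; exact: cvg_cst. Qed.

Lemma cts_pos_id : cts_pos id.
Proof. by move=> r r0; exact: cvg_id. Qed.

Lemma cts_posX f k : cts_pos f -> cts_pos (fun t => f t ^+ k).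
Proof.
move=> cf; elim: k => [|k IHk].
  by rewrite (_ : (fun _ => _) = fun=> 1)//; exact: cts_pos_cst.
by under eq_fun do rewrite exprS; exact: cts_posM.
Qed.

Lemma cts_pos_ratio k : cts_pos (fun r => r / k.+1%:R).
Proof. by apply: cts_posM; [exact: cts_pos_id|exact: cts_pos_cst]. Qed.

Lemma ratio_neq0 k (r : R) : 0 < r -> r / k.+1%:R != 0.
Proof. by move=> r0; rewrite mulf_neq0 ?invr_eq0 ?pnatr_eq0// gt_eqF. Qed.

Definition cube_root (a : R) : R := Num.sg a * `|a| `^ 3%:R^-1.

Lemma cube_rootK a : cube_root a ^+ 3 = a.
Proof.
have P : (`|a| `^ 3%:R^-1) ^+ 3 = `|a|.
  by rewrite -powR_mulrn ?powR_ge0// -powRrM mulVf ?pnatr_eq0// powRr1.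
rewrite /cube_root exprMn P [RHS]numEsg; congr (_ * _).
by case: (sgrP a) => _; rewrite ?expr0n ?expr1n// -signr_odd expr1.
Qed.

(** Comes from [4 (s^2 + s t + t^2) - (s - t)^2 = 3 (s + t)^2], and makes the signed cube root
    continuous, at 0 included. *)
Lemma cube_dist (s t : R) : `|s - t| ^+ 3 <= 4 * `|s ^+ 3 - t ^+ 3|.
Proof.
have -> : s ^+ 3 - t ^+ 3 = (s - t) * (s ^+ 2 + s * t + t ^+ 2) by ring.
rewrite normrM exprS real_normK ?num_real// [leRHS]mulrCA ler_wpM2l//.
apply: le_trans (_ : 4 * (s ^+ 2 + s * t + t ^+ 2) <= _); last by rewrite ler_wpM2l// ler_norm.
rewrite -subr_ge0 (_ : _ - _ = 3 * (s + t) ^+ 2); last by ring.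
by rewrite mulr_ge0// sqr_ge0.
Qed.

Lemma cts_pos_cube_root f : cts_pos f -> cts_pos (cube_root \o f).
Proof.
move=> cf r r0; apply/cvgrPdist_lt => e e0.
have e4 : 0 < e ^+ 3 / 4 by rewrite divr_gt0// exprn_gt0.
have /cvgrPdist_lt /(_ _ e4) := cf r r0.
apply: filterS => t h; rewrite -(@ltr_pXn2r _ 3) ?nnegrE ?(ltW e0)//.
apply: le_lt_trans (cube_dist _ _) _; rewrite /= !cube_rootK mulrC -ltr_pdivlMr//.
Qed.

End positive_continuity.

Section null_mass.
Context (R : realType) d (T : measurableType d) (mu : {finite_measure set T -> \bar R}).
Hypothesis mu0 : mu setT = 0%E.

Lemma Rintegral_null_mass (f : T -> R) : measurable_fun setT f -> \int[mu]_w f w = 0.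
Proof.
move=> mf; rewrite /Rintegral null_set_integral//; exact/measurable_EFinP.
Qed.

(** All seminorms vanish, so continuity makes [tau] constant; linearity in one argument then reads
    [tau u = tau u + tau u]. *)
Lemma cml_null_mass n (tau : ('I_n.+1 -> T -> R) -> R) u :
  continuous_multilinear_Ln mu tau -> (forall j, u j \in Lfun mu n.+1%:R%:E) -> tau u = 0.
Proof.
move=> [lin ct] Lu.
have const v : (forall j, v j \in Lfun mu n.+1%:R%:E) -> tau v = tau u.
  move=> Lv; apply/eqP; rewrite -subr_eq0 -normr_eq0; apply/eqP/le_anti/andP; split => //.
  apply/ler_addgt0Pl => e e0; rewrite addr0.
  have [r r0 /(_ v Lv) h] := ct u Lu e e0.
  apply/ltW/h => j; have LB : v j \- u j \in Lfun mu n.+1%:R%:E by exact: LfunB.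
  rewrite fine_Lnorm_lt// Rintegral_null_mass ?exprn_gt0//.
  by have /Lfun_pow_integrable[_ /integrable_measurable] := LB.
have Ldf v : v \in Lfun mu n.+1%:R%:E -> forall j, dfwith u ord0 v j \in Lfun mu n.+1%:R%:E.
  by move=> Lv; exact: Lfun_dfwith.
have := lin ord0 u 1 (u ord0) (u ord0) Lu (Lu _) (Lu _).
rewrite !const; [|exact: Ldf|apply: Ldf; exact: Lfun_linear].
by move/eqP; rewrite mul1r -{1}[tau u]addr0 (inj_eq (addrI _)) eq_sym => /eqP.
Qed.

End null_mass.

Lemma mass_gt0P (R : realType) d (T : measurableType d) (mu : {finite_measure set T -> \bar R}) :
  mu setT = 0%E \/ 0 < fine (mu setT) /\ mu setT = (fine (mu setT))%:E.
Proof.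
have fin : mu setT \is a fin_num by exact: fin_num_measure.
have [->|m0] := eqVneq (mu setT) 0%E; first by left.
right; split; last by rewrite fineK.
by rewrite fine_gt0// lt_neqAle eq_sym m0 measure_ge0/= -ge0_fin_numE.
Qed.

Section all_models_forms.
Context (R : realType).

Theorem invariant_1form (A : tensor_family (R := R) 1) (tau : Ln_family (R := R) 1) :
  local_invariant_field (@all_models R 1) A tau ->
  exists2 c : R -> R, {within `]0, +oo[, continuous c} &
    (forall d (Omega : measurableType d)
        (mu : {finite_measure set Omega -> \bar R}) (V : Omega -> R),
      V \in Lfun mu 1%E ->
      tau d Omega mu (fun=> V) = c (fine (mu setT)) * \int[mu]_o V o) /\
    (forall M d (Omega : measurableType d) (m : measure_model 1 M Omega)
        (x : M) (v : tangent x),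
      tangent_derivable (mass m) v /\
      A M d Omega m x (fun=> v) = c (mass m x) * tangent_derive (mass m) v).
Proof.
move=> A_inv; have [_ cov loc _] := A_inv.
pose c r := test_value tau r (fun=> 0%N) / r.
have tauE d (Omega : measurableType d)
    (mu : {finite_measure set Omega -> \bar R}) (V : Omega -> R) : V \in Lfun mu 1%E ->
    tau d Omega mu (fun=> V) = c (fine (mu setT)) * \int[mu]_o V o.
  move=> LV; have [m0|[m0 me]] := mass_gt0P mu.
    rewrite (cml_null_mass m0 (cov _ _ mu))// Rintegral_null_mass ?mulr0//.
    exact: (@Lfun_measurable _ 0 _ _ mu).
  apply: (classification1 m0 _ _ me) => //.
  exact: invariant_field_law A_inv _.
exists c.
  apply: cts_pos_within; apply: cts_posM.
    by move=> r r0; apply: (test_value_continuous A_inv) => // l.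
  by apply: cts_posV => [r r0|]; [rewrite gt_eqF|exact: cts_pos_id].
split=> // M d Omega m x v; have [pbar mp] := param_potential m.
split; first exact: (tangent_derivable_mass mp).
rewrite (loc _ _ _ m I pbar mp) tauE ?(tangent_derive_mass mp)//.
exact: (dlog_Lfun mp).
Qed.

Theorem invariant_quadratic_form (F : tensor_family (R := R) 2) (tau : Ln_family (R := R) 2) :
  local_invariant_field (@all_models R 2) F tau ->
  symmetric_field (@all_models R 2) F ->
  exists f d : R -> R,
    [/\ {within `]0, +oo[, continuous f},
        {within `]0, +oo[, continuous d}
      & forall M disp (Omega : measurableType disp)
          (m : measure_model 2 M Omega) pbar, potential m pbar ->
        forall x : M,
          (forall v : tangent x, is_tangent_derive (mass m) v
             (\int[param m x]_o dlog pbar v o)) /\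
          (forall V : 'I_2 -> tangent x,
             F M disp Omega m x V =
               f (mass m x) * fisher m pbar (V 0) (V 1)
               + d (mass m x) * (tangent_derive (mass m) (V 0) *
                                 tangent_derive (mass m) (V 1))) ].
Proof.
move=> F_inv _; have [_ cov loc _] := F_inv.
have t_cts j : (forall l, (j l < 2)%N) -> cts_pos (fun r => test_value tau r j).
  by move=> j2 r r0; apply: (test_value_continuous F_inv).
have d_cts : cts_pos (coef2_d tau).
  apply: cts_posM; first exact: t_cts.
  apply: cts_posV => [r r0|]; first by rewrite expf_neq0// ratio_neq0.
  by apply: cts_posX; exact: cts_pos_ratio.
exists (coef2_f tau), (coef2_d tau); split.
- apply: cts_pos_within; apply: cts_posM.
    apply: cts_posB; first exact: t_cts.
    by apply: cts_posM => //; apply: cts_posX; exact: cts_pos_ratio.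
  by apply: cts_posV => [r r0|]; [exact: ratio_neq0|exact: cts_pos_ratio].
- exact: cts_pos_within.
move=> M disp Omega m pbar mp x.
split=> [v|V]; first exact: is_tangent_derive_mass.
rewrite (loc _ _ _ m I pbar mp) !(tangent_derive_mass mp).
have LV l : dlog pbar (V l) \in Lfun (param m x) 2%:R%:E by exact: (dlog_Lfun mp).
have [m0|[m0 me]] := mass_gt0P (param m x).
  rewrite (cml_null_mass m0 (cov _ _ (param m x)))// /fisher !Rintegral_null_mass ?mulr0 ?addr0//.
  - exact: (dlog_measurable mp).
  - exact: (dlog_measurable mp).
  - by apply: measurable_funM; exact: (dlog_measurable mp).
by apply: (classification2 m0 _ _ me) => //; exact: invariant_field_law F_inv _.
Qed.

Theorem invariant_cubic_form (T : tensor_family (R := R) 3) (tau : Ln_family (R := R) 3) :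
  local_invariant_field (@all_models R 3) T tau ->
  symmetric_field (@all_models R 3) T ->
  exists t c1 c2 : R -> R,
    [/\ {within `]0, +oo[, continuous t},
        {within `]0, +oo[, continuous c1},
        {within `]0, +oo[, continuous c2}
      & forall M d (Omega : measurableType d)
          (m : measure_model 3 M Omega) pbar, potential m pbar ->
        forall (x : M) (V : 'I_3 -> tangent x),
          (forall i, tangent_derivable (mass m) (V i)) /\
          T M d Omega m x V =
            t (mass m x) * amari_chentsov m pbar (V 0) (V 1) (V 2)
            + \prod_(i < 3) mass_form c1 m (V i)
            + symmetric_product (mass_form c2 m (x := x))
                (fisher m pbar (x := x)) (V 0) (V 1) (V 2) ].
Proof.
move=> T_inv T_sym; have [_ cov loc _] := T_inv.
have t_cts j : (forall l, (j l < 3)%N) -> cts_pos (fun r => test_value tau r j).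
  by move=> j2 r r0; apply: (test_value_continuous T_inv).
have a_cts k : cts_pos (fun r : R => (r / 3%:R) ^+ k).
  by apply: cts_posX; exact: cts_pos_ratio.
have va_cts k : cts_pos (fun r : R => ((r / 3%:R) ^+ k)^-1).
  by apply: cts_posV => // r r0; rewrite expf_neq0// ratio_neq0.
have j001_lt l : (j001 l < 3)%N by rewrite /j001; case: (_ == _).
have al_cts : cts_pos (coef3_a tau) by apply: cts_posM => //; exact: t_cts.
have be_cts : cts_pos (coef3_b tau).
  by apply: cts_posM => //; apply: cts_posB; [exact: t_cts|exact: cts_posM].
(* The cube of the first 1-form has to produce [coef3_a], hence the signed cube root; the 3 cancels
   the normalization of [symmetric_product]. *)
exists (coef3_g tau), (fun r => cube_root (coef3_a tau r)), (fun r => 3%:R * coef3_b tau r); split.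
- apply: cts_pos_within; apply: cts_posM; last exact: (va_cts 1%N).
  apply: cts_posB; last by apply: cts_posM => //; apply: cts_posM => //; exact: cts_pos_cst.
  by apply: cts_posB; [exact: t_cts|exact: cts_posM].
- by apply: cts_pos_within; exact: cts_pos_cube_root.
- by apply: cts_pos_within; apply: cts_posM => //; exact: cts_pos_cst.
move=> M d Omega m pbar mp x V; split=> [i|]; first exact: (tangent_derivable_mass mp).
rewrite (loc _ _ _ m I pbar mp) prod_ord3 /symmetric_product /mass_form !(tangent_derive_mass mp).
have LV l : dlog pbar (V l) \in Lfun (param m x) 3%:R%:E by exact: (dlog_Lfun mp).
have mV l := dlog_measurable mp (V l).
have [m0|[m0 me]] := mass_gt0P (param m x).
  rewrite (cml_null_mass m0 (cov _ _ (param m x)))// /amari_chentsov /fisher.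
  rewrite !Rintegral_null_mass ?mulr0 ?addr0 ?mul0r ?addr0//; do ?[exact: mV|apply: measurable_funM].
rewrite (classification3 m0 _ _ _ me) => //.
- rewrite prod_ord3 /amari_chentsov /fisher -/(mass m x) /=.
  have := cube_rootK (coef3_a tau (mass m x)).
  set q := cube_root _ => qE; rewrite -qE.
  have H (g b p a0 a1 a2 c b0 b1 b2 : R) :
      g * c + p ^+ 3 * (a0 * a1 * a2) + b * (a0 * b0 + a1 * b1 + a2 * b2) =
      g * c + p * a0 * (p * a1) * (p * a2) +
      (3%:R * b * a0 * b0 + 3%:R * b * a1 * b1 + 3%:R * b * a2 * b2) / 3%:R by field.
  exact: H.
- exact: invariant_field_law T_inv _.
- exact: invariant_field_symmetric T_inv _ T_sym.
Qed.

End all_models_forms.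

(** * Fields on statistical models *)

Definition center (R : realType) d (T : measurableType d) (mu : {finite_measure set T -> \bar R})
    (u : T -> R) : T -> R := fun w => u w - \int[mu]_x u x.

Section centering.
Context (R : realType) d (T : measurableType d) (mu : {finite_measure set T -> \bar R}).
Hypothesis mu1 : mu setT = 1%E.
Variable n : nat.
Local Notation Ln := (Lfun mu n.+1%:R%:E).

Lemma center_Lfun u : u \in Ln -> center mu u \in Ln.
Proof. by move=> Lu; apply: (LfunB (Lfun_cst _ _ _) Lu). Qed.

Lemma Lfun_integrable u : u \in Ln -> mu.-integrable setT (EFin \o u).
Proof.
move=> Lu; have /Lfun_pow_integrable[mu_ iu] := Lu.
apply: (@le_integrable_norm _ _ _ _ _ (fun w => 1 + `|u w| ^+ n.+1)) => //.
- by move=> w; exact: ler_1Dexpn.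
- by apply: integrable_EFinD => //; exact: finite_measure_integrable_cst.
Qed.

Lemma center_linear a u v : u \in Ln -> v \in Ln ->
  center mu (a *: u + v) = a *: center mu u + center mu v.
Proof.
move=> Lu Lv; apply/funext => w; rewrite /center.
have -> : \int[mu]_x (a *: u + v) x = a * \int[mu]_x u x + \int[mu]_x v x.
  have iu := Lfun_integrable Lu; have iv := Lfun_integrable Lv.
  by rewrite -RintegralZl// -RintegralD//; exact: (integrable_EFinZ a iu).
by rewrite !fctE /GRing.scale /=; ring.
Qed.

(** The bound [|u| <= r + |u|^(n+1) / r^n] puts the mean within [2 r]. With [|a - b|^(n+1) <=
    2^(n+1) (|a|^(n+1) + |b|^(n+1))] the total factor is [2^(n+1) (1 + 2^(n+1))], which is at most
    [8^(n+1)]. *)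
Lemma center_norm (u : T -> R) r : 0 < r -> u \in Ln ->
  fine (Lnorm mu n.+1%:R%:E (EFin \o u)) < r ->
  fine (Lnorm mu n.+1%:R%:E (EFin \o center mu u)) < r * 8%:R.
Proof.
move=> r0 Lu; rewrite !fine_Lnorm_lt ?mulr_gt0//; last exact: center_Lfun.
move=> ur; set m := \int[mu]_x u x.
have iu := Lfun_integrable Lu; have [mu_ iup] := (Lfun_pow_integrable _ _ _).1 Lu.
have ic (c : R) : mu.-integrable setT (EFin \o cst c) by exact: finite_measure_integrable_cst.
have cE (c : R) : \int[mu]_x cst c x = c.
  by rewrite Rintegral_cst// [fine _](congr1 fine mu1) mulr1.
have mr : `|m| <= 2%:R * r.
  apply: (@le_trans _ _ (\int[mu]_x (r + (r ^+ n)^-1 * `|u x| ^+ n.+1))).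
    apply: (le_trans (le_normr_Rintegral _ _)) => //.
    apply: le_Rintegral => //; first exact: integrable_norm.
      by apply: integrable_EFinD; [exact: ic|exact: integrable_EFinZ].
    move=> x _ /=; have [ur'|/ltW ru] := leP `|u x| r.
      by apply: (le_trans ur'); rewrite lerDl mulr_ge0 ?invr_ge0 ?exprn_ge0// ltW.
    apply: (@le_trans _ _ ((r ^+ n)^-1 * `|u x| ^+ n.+1)); last by rewrite lerDr ltW.
    rewrite ler_pdivlMl ?exprn_gt0// exprSr ler_wpM2r// lerXn2r ?nnegrE ?(ltW r0)//.
  rewrite RintegralD//; [|exact: ic|exact: integrable_EFinZ].
  rewrite [X in X + _]cE RintegralZl// mulr_natl mulr2n lerD2l.
  by rewrite ler_pdivrMl ?exprn_gt0// -exprSr ltW.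
apply: (@le_lt_trans _ _ (\int[mu]_x (2%:R ^+ n.+1 * (`|u x| ^+ n.+1 + (2%:R * r) ^+ n.+1)))).
  have [mc icp] := (Lfun_pow_integrable _ _ _).1 (center_Lfun Lu).
  apply: le_Rintegral => //.
    by apply: integrable_EFinZ; apply: integrable_EFinD => //; exact: ic.
  move=> x _.
  have K (a b : R) : `|a - b| ^+ n.+1 <= 2%:R ^+ n.+1 * (`|a| ^+ n.+1 + `|b| ^+ n.+1).
    have [ab|/ltW ba] := leP `|a| `|b|.
      apply: (@le_trans _ _ ((2%:R * `|b|) ^+ n.+1)).
        rewrite lerXn2r ?nnegrE ?mulr_ge0//; apply: (le_trans (ler_normB _ _)).
        by rewrite mulr_natl mulr2n lerD2r.
      by rewrite exprMn ler_wpM2l ?exprn_ge0// lerDr exprn_ge0.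
    apply: (@le_trans _ _ ((2%:R * `|a|) ^+ n.+1)).
      rewrite lerXn2r ?nnegrE ?mulr_ge0//; apply: (le_trans (ler_normB _ _)).
      by rewrite mulr_natl mulr2n lerD2l.
    by rewrite exprMn ler_wpM2l ?exprn_ge0// lerDl exprn_ge0.
  apply: (le_trans (K _ _)); rewrite ler_wpM2l ?exprn_ge0// lerD2l.
  by rewrite lerXn2r ?nnegrE ?mulr_ge0 ?(ltW r0).
rewrite RintegralZl//; last by apply: integrable_EFinD => //; exact: ic.
rewrite RintegralD//; last exact: ic.
rewrite [X in _ + X]cE.
apply: (@lt_le_trans _ _ (2%:R ^+ n.+1 * (r ^+ n.+1 + (2%:R * r) ^+ n.+1))).
  by rewrite ltr_pM2l ?exprn_gt0// ltrD2r.
rewrite !exprMn -[X in _ * (X + _)]mul1r -mulrDl mulrA [leRHS]mulrC ler_wpM2r ?exprn_ge0 ?(ltW r0)//.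
have -> : 8%:R = 2%:R * (2%:R * 2%:R) :> R by ring.
rewrite !exprMn ler_wpM2l ?exprn_ge0//.
have : 1 <= (2 : R) ^+ n.+1 by rewrite exprn_ege1// ler1n.
have : 2 <= (2 : R) ^+ n.+1.
  by rewrite exprS ler_peMr// exprn_ege1// ler1n.
by nra.
Qed.

Lemma center_cml (tau : ('I_n.+1 -> T -> R) -> R) : continuous_multilinear_Ln mu tau ->
  continuous_multilinear_Ln mu (fun u => tau (fun j => center mu (u j))).
Proof.
move=> [lin ct]; split=> [l u a v w Lu Lv Lw|u Lu e e0].
  have cE x : (fun j => center mu (dfwith u l x j)) =
      dfwith (fun j => center mu (u j)) l (center mu x).
    by apply/funext => j; rewrite !dfwithE; case: eqP.
  rewrite !cE center_linear// lin//; [|exact: center_Lfun|exact: center_Lfun].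
  by move=> j; exact: center_Lfun.
have [|r r0 rP] := ct (fun j => center mu (u j)) _ e e0.
  by move=> j; exact: center_Lfun.
exists (r / 8%:R) => [|v Lv vu]; first by rewrite divr_gt0.
apply: rP => [j|j]; first exact: center_Lfun.
have -> : center mu (v j) \- center mu (u j) = center mu (v j \- u j).
  have e' f g : g \- f = -1 *: f + g :> (T -> R).
    by apply/funext => w; rewrite scaleN1r /= addrC.
  by rewrite !e' center_linear.
rewrite -[ltRHS](divfK (_ : 8%:R != 0)) ?pnatr_eq0//.
by apply: center_norm; [rewrite divr_gt0|exact: LfunB|exact: vu].
Qed.

End centering.

(* On a statistical model the scores have mean zero, so [tau] may be replaced by
   its centered version, for which all tuples of functions are admissible. *)
Section statistical.
Context (R : realType) (n : nat).
Variables (A : tensor_family (R := R) n.+1) (tau : Ln_family (R := R) n.+1).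
Hypothesis A_inv : local_invariant_field (@statistical_models R n.+1) A tau.

Definition centered : Ln_family (R := R) n.+1 :=
  fun d T mu u => tau mu (fun j => center mu (u j)).

Lemma centered_cml d (T : measurableType d) (mu : {finite_measure set T -> \bar R}) :
  mu setT = 1%:E -> continuous_multilinear_Ln mu (centered mu).
Proof. by move=> mu1; apply: center_cml => //; have [_ + _ _] := A_inv; exact. Qed.

Section normalized_model.
Context d (T : measurableType d) (mu : {finite_measure set T -> \bar R}).
Variables (kappa : T -> nat) (k : nat).
Hypothesis mkappa : measurable_fun setT kappa.
Hypothesis kappa_lt : forall w, (kappa w < k)%N.
Variables (h : 'I_n.+1 -> nat -> R) (p : nat -> R).
Hypothesis p0 : forall i, 0 <= p i.
Hypothesis p1 : \sum_(i < k) p i = 1.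
Hypothesis mup : forall i, fine (mu (kappa @^-1` [set i])) = p i.

Let l := normalized_exponent h p0 p1.

Lemma normalized_statistical : statistical_models (expo_model l mu mkappa kappa_lt).
Proof.
move=> x; rewrite -[LHS]fineK; last exact: fin_num_measure.
have sl := sum_nat_law (expo_param l mu k mkappa x) mkappa kappa_lt.
congr EFin; etransitivity; first exact: esym sl.
transitivity (\sum_(i < k) p i * expR (lincomb h x i) / partition_fun h k p x); last first.
  by rewrite -mulr_suml divff// gt_eqF// partition_fun_gt0.
apply: eq_bigr => i _; rewrite (expo_param_level l _ mkappa kappa_lt) mup.
by rewrite /l /= /normalized expRD expRN lnK ?posrE ?partition_fun_gt0// mulrC mulrA.
Qed.

Lemma center_normalized j : center mu (h j \o kappa) = dexpo l 0 (delta_mx 0 j) \o kappa.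
Proof.
apply/funext => w; rewrite /center /l /= /dnormalized.
rewrite (partition_fun0 h p1) divr1 (Rintegral_nat_comp mu mkappa kappa_lt).
have lE i : lincomb h (delta_mx 0 j) i = h j i.
  by have := lincomb_delta h 1 j i; rewrite scale1r mul1r.
rewrite lE; congr (_ - _); apply: eq_bigr => i _.
by rewrite lE lincomb0 expR0 mulr1 mup mulrC.
Qed.

End normalized_model.

Let weights d (T : measurableType d) (mu : {finite_measure set T -> \bar R}) (kappa : T -> nat) i :=
  fine (mu (kappa @^-1` [set i])).

Let weights0 d (T : measurableType d) (mu : {finite_measure set T -> \bar R}) kappa i :
  0 <= weights mu kappa i.
Proof. exact: fine_ge0. Qed.

Let weights1 d (T : measurableType d) (mu : {finite_measure set T -> \bar R}) kappa k :
  mu setT = 1%:E -> measurable_fun setT kappa -> (forall w, (kappa w < k)%N) ->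
  \sum_(i < k) weights mu kappa i = 1.
Proof. by move=> mu1 mk bk; rewrite sum_nat_law// mu1. Qed.

Lemma centered_law : law_invariant 1 centered.
Proof.
move=> d1 T1 mu1 d2 T2 mu2 k1 k2 k h m1 m2 mk1 mk2 b1 b2 law.
have lt_S U (kap : U -> nat) : (forall w, (kap w < k)%N) -> forall w, (kap w < k.+1)%N.
  by move=> b w; rewrite ltnS ltnW.
have p1 := weights1 m1 mk1 (lt_S _ _ b1).
pose l := normalized_exponent h (weights0 mu1 k1) p1.
have e1 j := center_normalized mk1 (lt_S _ _ b1) h (weights0 mu1 k1) p1 (fun=> erefl) j.
(* The exponent normalized by the weights of [mu1] also serves [mu2], since the weights agree. *)
have e2 j : center mu2 (h j \o k2) = dexpo l 0 (delta_mx 0 j) \o k2.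
  by apply: (center_normalized mk2 (lt_S _ _ b2)) => i; rewrite /weights law.
rewrite /centered (funext e1) (funext e2).
apply: (tau_expo_law A_inv) => // d T mu kappa mk bk lw.
by apply: normalized_statistical => i; rewrite /weights lw.
Qed.

Lemma centered_symmetric : symmetric_field (@statistical_models R n.+1) A ->
  law_symmetric 1 centered.
Proof.
move=> A_sym d T mu kappa k h s mu1 mk bk.
have p1 := weights1 mu1 mk bk.
pose l := normalized_exponent h (weights0 mu kappa) p1.
have st : statistical_models (expo_model l mu mk bk) by exact: normalized_statistical.
have e1 j : center mu (h j \o kappa) = dexpo l 0 (delta_mx 0 j) \o kappa.
  exact: center_normalized.
have tE v := @tau_expo _ _ _ _ _ A_inv _ _ mu kappa k mk bk l v 0 st.
rewrite /expo_param eqxx in tE.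
rewrite /centered (funext e1) (funext (fun j => e1 (s j))).
rewrite -[LHS](tE (fun j => delta_mx 0 (s j))) -[RHS](tE (fun j => delta_mx 0 j)).
by rewrite -[RHS](A_sym _ _ _ (expo_model l mu mk bk) st _ s).
Qed.

(** The mass is constantly 1, and its derivative is the mean of the score. *)
Lemma statistical_mean M d (T : measurableType d) (m : measure_model n.+1 M T)
    (pbar : M -> T -> R) (x : M) (v : tangent x) : is_statistical m -> potential m pbar ->
  \int[param m x]_w dlog pbar v w = 0.
Proof.
move=> st mp; rewrite -(tangent_derive_mass mp) /tangent_derive.
rewrite (_ : mass m \o _ = cst 1); first exact: derive_cst.
by apply/funext => y; rewrite /= /mass st.
Qed.

Lemma statistical_centered M d (T : measurableType d) (m : measure_model n.+1 M T)
    (pbar : M -> T -> R) (x : M) (V : 'I_n.+1 -> tangent x) : is_statistical m -> potential m pbar ->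
  A m V = centered (param m x) (fun j => dlog pbar (V j)).
Proof.
move=> st mp; have [_ _ loc _] := A_inv; rewrite (loc _ _ _ m st pbar mp).
congr (tau _); apply/funext => j; apply/funext => w.
by rewrite /center (statistical_mean _ st mp) subr0.
Qed.

End statistical.

Section statistical_forms.
Context (R : realType).

Theorem statistical_1form_eq0 (A : tensor_family (R := R) 1) (tau : Ln_family (R := R) 1) :
  local_invariant_field (@statistical_models R 1) A tau ->
  forall M d (Omega : measurableType d) (m : measure_model 1 M Omega),
    is_statistical m ->
    forall (x : M) (V : 'I_1 -> tangent x), A M d Omega m x V = 0.
Proof.
move=> A_inv M d Omega m st x V; have [pbar mp] := param_potential m.
rewrite (statistical_centered A_inv _ st mp).
rewrite (classification1 ltr01 (centered_cml A_inv) (centered_law A_inv)) //.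
- by rewrite (statistical_mean _ st mp) mulr0.
- by move=> l; exact: (dlog_Lfun mp).
Qed.

Theorem statistical_quadratic_form (F : tensor_family (R := R) 2) (tau : Ln_family (R := R) 2) :
  local_invariant_field (@statistical_models R 2) F tau ->
  exists a : R, forall M d (Omega : measurableType d) (m : measure_model 2 M Omega) pbar,
    is_statistical m -> potential m pbar ->
    forall (x : M) (V : 'I_2 -> tangent x),
      F M d Omega m x V = a * fisher m pbar (V 0) (V 1).
Proof.
move=> F_inv; exists (coef2_f (centered tau) 1) => M d Omega m pbar st mp x V.
rewrite (statistical_centered F_inv _ st mp).
rewrite (classification2 ltr01 (centered_cml F_inv) (centered_law F_inv)) //.
- by rewrite !(statistical_mean _ st mp) !mulr0 addr0.
- by move=> l; exact: (dlog_Lfun mp).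
Qed.

Theorem statistical_cubic_form (T : tensor_family (R := R) 3) (tau : Ln_family (R := R) 3) :
  local_invariant_field (@statistical_models R 3) T tau ->
  symmetric_field (@statistical_models R 3) T ->
  exists a : R, forall M d (Omega : measurableType d) (m : measure_model 3 M Omega) pbar,
    is_statistical m -> potential m pbar ->
    forall (x : M) (V : 'I_3 -> tangent x),
      T M d Omega m x V = a * amari_chentsov m pbar (V 0) (V 1) (V 2).
Proof.
move=> T_inv T_sym; exists (coef3_g (centered tau) 1) => M d Omega m pbar st mp x V.
rewrite (statistical_centered T_inv _ st mp).
rewrite (classification3 ltr01 (centered_cml T_inv) (centered_law T_inv)
  (centered_symmetric T_inv T_sym)) //.
- have H (g c a b b0 b1 b2 : R) :
      g * c + a * (0 * 0 * 0) + b * (0 * b0 + 0 * b1 + 0 * b2) = g * c by ring.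
  by rewrite prod_ord3 !(statistical_mean (V _) st mp); exact: H.
- by move=> l; exact: (dlog_Lfun mp).
Qed.

End statistical_forms.

(** * The Fisher and Amari-Chentsov fields *)

Lemma derivable_seq (R : realType) (F : normedModType R) (h : F -> R) (y v : F) :
  derivable h y v ->
  n.+1%:R * (h (n.+1%:R^-1 *: v + y) - h y) @[n --> \oo] --> 'D_v h y.
Proof.
move=> dh.
have hc : (n.+1%:R^-1 : R) @[n --> \oo] --> 0^'.
  move=> B /= B0.
  have H : \forall n \near \oo, n.+1%:R^-1 != 0 :> R -> B n.+1%:R^-1 := @cvg_harmonic R _ B0.
  by apply: (@filterS _ _ _ _ (fun n : nat => B n.+1%:R^-1) _ H) => n; apply; rewrite invr_eq0 pnatr_eq0.
have := cvg_comp _ _ hc dh.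
by apply: cvg_trans; apply: near_eq_cvg; near=> n; rewrite /= invrK.
Unshelve. all: by end_near. Qed.

(** Written as [1 / f = f * (f^2)^(-1)], with a measurable real power of a nonnegative function; at
    a zero of [f] both sides are 0. *)
Lemma measurable_invr d (T : measurableType d) (R : realType) (f : T -> R) :
  measurable_fun setT f -> measurable_fun setT (fun w => (f w)^-1).
Proof.
move=> mf; rewrite (_ : (fun _ => _) = fun w => f w * (f w ^+ 2) `^ (-1)).
  apply: measurable_funM => //.
  apply: (measurableT_comp (measurable_powR (-1))); exact: measurable_funX.
apply/funext => w; rewrite powR_inv1 ?sqr_ge0//.
by have [->|fw] := eqVneq (f w) 0; [rewrite invr0 mul0r|field].
Qed.

Section log_increments.
Context (R : realType) (M : banach_manifold R) d (T : measurableType d).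
Variable mu : {measure set T -> \bar R}.

(* A derivative at x is the limit of difference quotients along one sequence of
   points, so countably many null sets suffice. *)
Lemma dlog_ae_eq (f g : M -> T -> R) (x : M) (v : tangent x) :
  {ae mu, forall w, continuously_gateaux (fun y => ln (f y w))} ->
  {ae mu, forall w, continuously_gateaux (fun y => ln (g y w))} ->
  (forall y, {ae mu, forall w, ln (f y w) - ln (f x w) = ln (g y w) - ln (g x w)}) ->
  {ae mu, forall w, dlog f v w = dlog g v w}.
Proof.
move=> gf gg fg; pose c := chart_at x; pose y0 := chart_map c x.
have ry0 : chart_range c y0 by exact: chart_range_map (chart_at_dom x).
have cx : chart_inv c y0 = x by apply: chart_mapK; [exact: chart_at_atlas|exact: chart_at_dom].
have H := ae_foralln (fun n : nat => fg (chart_inv c (n.+1%:R^-1 *: v + y0))).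
apply: filterS3 gf gg H => w gfw ggw fgw.
have [df _ _] := gfw c (chart_at_atlas x).
have [dg _ _] := ggw c (chart_at_atlas x).
apply: (cvg_unique _ (derivable_seq (df _ ry0 v))) => //=.
apply: cvg_trans (derivable_seq (dg _ ry0 v)).
apply: near_eq_cvg; near=> n => /=; congr (_ * _).
by rewrite -/c -/y0 cx; have := fgw n.
Unshelve. all: by end_near. Qed.

Lemma ae_Rintegral (f g : T -> R) : measurable_fun setT f -> measurable_fun setT g ->
  {ae mu, forall w, f w = g w} -> \int[mu]_w f w = \int[mu]_w g w.
Proof.
move=> mf mg fg; rewrite /Rintegral; congr fine; apply: ae_eq_integral => //.
- exact/measurable_EFinP.
- exact/measurable_EFinP.
- by apply: filterS fg => w fgw _; rewrite fgw.
Qed.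

Lemma ae_integrable (f g : T -> R) : measurable_fun setT g ->
  {ae mu, forall w, f w = g w} -> mu.-integrable setT (EFin \o f) ->
  mu.-integrable setT (EFin \o g).
Proof.
move=> mg fg /integrableP[/measurable_EFinP mf fi]; apply/integrableP; split.
  exact/measurable_EFinP.
apply: le_lt_trans fi; rewrite le_eqVlt; apply/orP; left; apply/eqP.
apply: ae_eq_integral => //.
- by apply/measurable_EFinP; exact: measurableT_comp.
- by apply/measurable_EFinP; exact: measurableT_comp.
- by apply: filterS fg => w fgw _; rewrite /= fgw.
Qed.

Lemma positive_density_unique (nu : {measure set T -> \bar R}) phi psi :
  positive_density mu nu phi -> positive_density mu nu psi ->
  {ae mu, forall w, phi w = psi w}.
Proof.
move=> mp ms; have [_ _ ep] := mp; have [_ _ es] := ms.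
have := @integral_ae_eq _ _ _ mu setT measurableT (EFin \o psi) (EFin \o phi).
move=> /(_ (density_integrable mp) _ _).
have mpsi : measurable_fun setT (EFin \o psi).
  by apply/measurable_EFinP; exact: density_measurable ms.
move=> /(_ mpsi) h.
have /h : forall E : set T, E `<=` setT -> measurable E ->
    (\int[mu]_(x in E) (EFin \o phi) x = \int[mu]_(x in E) (EFin \o psi) x)%E.
  by move=> E _ mE; rewrite -ep// -es.
by apply: filterS => w /(_ I) [].
Qed.

End log_increments.

Lemma continuous_big_prod (R : realType) (U : topologicalType) k (f : 'I_k -> U -> R) :
  (forall i, continuous (f i)) -> continuous (fun x => \prod_i f i x).
Proof.
move=> cf x.
suff H s : (\prod_(i <- s) f i y) @[y --> x] --> \prod_(i <- s) f i x by exact: H.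
elim: s => [|i s IHs].
  by rewrite big_nil; under eq_fun do rewrite big_nil; exact: cvg_cst.
rewrite big_cons; under eq_fun do rewrite big_cons.
by apply: cvgM => //; exact: cf.
Qed.

Section fisher_field.
Context (R : realType) (n : nat).

Section one_model.
Context (M : banach_manifold R) d (T : measurableType d).
Implicit Types (m : measure_model n.+1 M T).

Lemma dlog_linear_ae m pbar (x : M) (a : R) (u v : tangent x) : potential m pbar ->
  {ae param m x, forall w, dlog pbar (a *: u + v) w = a * dlog pbar u w + dlog pbar v w}.
Proof.
move=> mp; apply: (density_ae (potential_density mp x)).
apply: filterS (potential_regular mp) => w [_ gw].
have [_ lw _] := gw _ (chart_at_atlas x).
by have := lw _ (chart_range_map (chart_at_dom x)) a u v.
Qed.

Lemma dlog_potential_ae m pbar pbar' (x : M) (v : tangent x) :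
  potential m pbar -> potential m pbar' ->
  {ae param m x, forall w, dlog pbar v w = dlog pbar' v w}.
Proof.
move=> mp mp'; apply: (density_ae (potential_density mp x)); apply: dlog_ae_eq.
- by apply: filterS (potential_regular mp) => w [].
- by apply: filterS (potential_regular mp') => w [].
move=> y; have ex := positive_density_unique (potential_density mp x) (potential_density mp' x).
have ey := positive_density_unique (potential_density mp y) (potential_density mp' y).
by apply: filterS2 ex ey => w -> ->.
Qed.

Definition dlog_product (m : measure_model n.+1 M T) (pbar : M -> T -> R) (x : M) (V : 'I_n.+1 -> tangent x) : R :=
  \int[param m x]_w \prod_i dlog pbar (V i) w.

Lemma measurable_dlog_product m pbar (x : M) (V : 'I_n.+1 -> tangent x) : potential m pbar ->
  measurable_fun setT (fun w => \prod_i dlog pbar (V i) w).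
Proof. by move=> mp; apply: measurable_prod => i _; exact: dlog_measurable mp _ _. Qed.

Lemma dlog_product_potential m pbar pbar' (x : M) (V : 'I_n.+1 -> tangent x) :
  potential m pbar -> potential m pbar' -> dlog_product m pbar V = dlog_product m pbar' V.
Proof.
move=> mp mp'; apply: ae_Rintegral.
- exact: measurable_dlog_product mp.
- exact: measurable_dlog_product mp'.
have H (i : 'I_n.+1) := dlog_potential_ae (V i) mp mp'.
have : {ae param m x, forall w i, dlog pbar (V i) w = dlog pbar' (V i) w}.
  exact: filter_forall H.
by apply: filterS => w e; apply: eq_bigr => i _; exact: e.
Qed.

(** Scores are linear in the tangent vector outside a null set that depends on the model only;
    integration restores exact linearity from that of [monomial]. *)
Lemma dlog_product_multilinear m pbar (x : M) : potential m pbar ->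
  multilinear_form (dlog_product m pbar (x := x)).
Proof.
move=> mp i u a v w; have cov := @monomial_cml R n [:: xpredT] (fun=> erefl).
have [lin _] := cov _ _ (param m x).
pose D (z : 'I_n.+1 -> tangent x) := fun j => dlog pbar (z j).
have DE z : dlog_product m pbar z = monomial [:: xpredT] (param m x) (D z).
  by rewrite /monomial big_seq1.
have Ddf z : D (dfwith u i z) = dfwith (D u) i (dlog pbar z).
  by apply/funext => j; rewrite /D !dfwithE; case: eqP.
rewrite /= !DE /=.
have Lu j : D u j \in Lfun (param m x) n.+1%:R%:E by exact: (dlog_Lfun mp).
have := lin i (D u) a (dlog pbar v) (dlog pbar w) Lu (dlog_Lfun mp _) (dlog_Lfun mp _).
rewrite -!Ddf => <-; rewrite /monomial !big_seq1.
have mdf z j : measurable_fun setT z -> measurable_fun setT (dfwith (D u) i z j).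
  move=> mz; rewrite dfwithE; case: eqP => // _; exact: (dlog_measurable mp).
apply: ae_Rintegral.
- by apply: measurable_prod => j _; exact: (dlog_measurable mp).
- apply: measurable_prod => j _; apply: mdf.
  apply: measurable_funD; last exact: (dlog_measurable mp).
  by apply: measurable_funM => //; exact: (dlog_measurable mp).
apply: filterS (dlog_linear_ae a v w mp) => o oE; apply: eq_bigr => j _.
by rewrite /D !dfwithE; case: eqP.
Qed.

Lemma dlog_product_continuous m pbar (V : 'I_n.+1 -> forall x : M, tangent x) :
  potential m pbar -> (forall i, continuous_vector_field (V i)) ->
  continuous (fun x => dlog_product m pbar (fun i => V i x)).
Proof.
move=> mp cV; apply: (continuous_model_integral mp cV).
- by move=> y; exact: measurable_dlog_product mp.
- by move=> y w; exact: prod_bound.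
apply: filterS (potential_regular mp) => w [_ gw].
apply: (@continuous_big_prod R M n.+1 (fun i y => dlog pbar (V i y) w)) => i.
by apply: continuous_tangent_derive.
Qed.

End one_model.
End fisher_field.

(** * Push-forward of models by a sufficient statistic *)

Section pushforward.
Context (R : realType) d1 (T1 : measurableType d1) d2 (T2 : measurableType d2).
Variables (mu1 : {measure set T1 -> \bar R}) (mu2 : {measure set T2 -> \bar R}).
Variable kappa : {mfun T1 >-> T2}.
Hypothesis mu2E : forall B, measurable B -> mu2 B = image_measure mu1 kappa B.

Lemma integrable_image (f : T2 -> R) : measurable_fun setT f ->
  mu1.-integrable setT (EFin \o (f \o kappa)) -> mu2.-integrable setT (EFin \o f).
Proof.
move=> mf i1; have mE : measurable_fun setT (EFin \o f) by exact/measurable_EFinP.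
have := @integrable_pushforward _ _ _ _ _ _ (@measurable_funPT _ _ _ _ kappa) mu1 setT
  (EFin \o f) mE i1 measurableT.
move=> /integrableP[_ h]; apply/integrableP; split=> //.
by rewrite (eq_measure_integral (image_measure mu1 kappa))// => A mA _; exact: mu2E.
Qed.

Lemma Rintegral_image (f : T2 -> R) : measurable_fun setT f ->
  mu1.-integrable setT (EFin \o (f \o kappa)) ->
  \int[mu2]_w f w = \int[mu1]_w f (kappa w).
Proof.
move=> mf i1; have mE : measurable_fun setT (EFin \o f) by exact/measurable_EFinP.
rewrite /Rintegral; congr fine.
rewrite (eq_measure_integral (image_measure mu1 kappa)); last by move=> A mA _; exact: mu2E.
exact: (@integral_pushforward _ _ _ _ _ _ (@measurable_funPT _ _ _ _ kappa) mu1 setT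
  (EFin \o f) mE i1 measurableT).
Qed.

Lemma ae_image (P : T2 -> Prop) : {ae mu2, forall w, P w} -> {ae mu1, forall w, P (kappa w)}.
Proof.
move=> [N [mN N0 PN]]; exists (kappa @^-1` N); split.
- by rewrite -[X in measurable X]setTI; exact: measurable_funPT.
- by rewrite -N0 mu2E.
- by move=> w /= nP; apply: PN.
Qed.

End pushforward.

Section sufficient_statistics.
Context (R : realType) (n : nat) (M : banach_manifold R).
Context d1 (T1 : measurableType d1) d2 (T2 : measurableType d2).
Variables (m1 : measure_model n.+1 M T1) (m2 : measure_model n.+1 M T2).
Variables (kappa : {mfun T1 >-> T2}) (p1 : M -> T1 -> R) (p2 : M -> T2 -> R).
Variables (s : M -> T2 -> R) (t : T1 -> R).
Hypothesis mp1 : potential m1 p1.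
Hypothesis mp2 : potential m2 p2.
Hypothesis ms : forall x, measurable_fun setT (s x).
Hypothesis factor : forall x, {ae reference m1, forall w, p1 x w = s x (kappa w) * t w}.
Hypothesis image : image_model kappa m1 m2.

Let mu1 := reference m1.
Let mu2 := reference m2.

Let mu2E B : measurable B -> mu2 B = image_measure mu1 kappa B.
Proof. by move=> mB; have [+ _] := image; apply. Qed.

Let p2E x B : measurable B -> param m2 x B = image_measure (param m1 x) kappa B.
Proof. by move=> mB; have [_ +] := image; apply. Qed.

Let positive : {ae mu1, forall w, forall x, 0 < p1 x w}.
Proof. by apply: filterS (potential_regular mp1) => w []. Qed.

(** The ratio of the densities at [y] and at [x], as a function on the target of the statistic: the
    factor [t] cancels. *)
Let rho x y w := s y w / s x w.

Let mrho x y : measurable_fun setT (rho x y).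
Proof. by apply: measurable_funM => //; exact: measurable_invr. Qed.

Let rhoE x y : {ae mu1, forall w, p1 y w = rho x y (kappa w) * p1 x w}.
Proof.
apply: filterS3 positive (factor x) (factor y) => w p0 px py.
have := p0 x; rewrite /rho px py => s0; have sx : s x (kappa w) != 0.
  by apply: contraTneq s0 => ->; rewrite mul0r ltxx.
by field.
Qed.

(* p_2(y) = rho p_2(x), by pushing p_1(y) = (rho o kappa) p_1(x) forward. *)
Lemma image_density_ratio x y : {ae mu2, forall w, rho x y w * p2 x w = p2 y w}.
Proof.
have mk := @measurable_funPT _ _ _ _ kappa.
have mp1x z : measurable_fun setT (p1 z) by exact: density_measurable (potential_density mp1 z).
have mp2x z : measurable_fun setT (p2 z) by exact: density_measurable (potential_density mp2 z).
have mrk : measurable_fun setT (rho x y \o kappa) by exact: measurableT_comp.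
have ind_measurable d (T : measurableType d) (B : set T) : measurable B ->
    measurable_fun setT (\1_B : T -> R) by move=> mB; exact: measurable_indic.
have ind_norm (T : Type) (B : set T) w (a : R) : `|\1_B w * a| <= `|a|.
  by rewrite normrM ler_piMl// indicE; case: (_ \in _); rewrite ?normr1 ?normr0.
have i1 : (param m1 x).-integrable setT (EFin \o (rho x y \o kappa)).
  apply/(integrable_density (potential_density mp1 x)) => //.
  apply: (ae_integrable _ _ (density_integrable (potential_density mp1 y))).
    exact: measurable_funM.
  exact: rhoE.
have i2 : mu2.-integrable setT (EFin \o (rho x y \* p2 x)).
  apply/(integrable_density (potential_density mp2 x)); first exact: mrho.
  by apply: (integrable_image (p2E x)).
have key (B : set T2) : measurable B ->
    \int[mu2]_w (\1_B w * rho x y w * p2 x w) = \int[mu2]_w (\1_B w * p2 y w).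
  move=> mB; have mI := ind_measurable _ _ B mB.
  have mIk : measurable_fun setT (\1_B \o kappa : T1 -> R) by exact: measurableT_comp.
  have mIr : measurable_fun setT (fun w => \1_B w * rho x y w) by exact: measurable_funM.
  have mIrk := measurableT_comp mIr mk.
  rewrite -(Rintegral_density (potential_density mp2 x) mIr).
  rewrite (Rintegral_image (p2E x) mIr); last first.
    apply: (@le_integrable_norm _ _ _ _ _ (fun w => `|rho x y (kappa w)|)) => //.
      by move=> w; exact: ind_norm.
    exact: integrable_norm i1.
  rewrite (Rintegral_density (potential_density mp1 x) mIrk).
  rewrite (@ae_Rintegral _ _ _ _ _ (fun w => \1_B (kappa w) * p1 y w)); last 3 first.
  - exact: measurable_funM.
  - exact: measurable_funM.
  - apply: filterS (rhoE x y) => w /= ->.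
    exact/esym/mulrA.
  rewrite -(Rintegral_density (potential_density mp1 y) mIk).
  rewrite -(Rintegral_image (p2E y) mI); last first.
    apply: (@le_integrable_norm _ _ _ _ _ (fun=> `|1 : R|)) => //.
      by move=> w; rewrite -[(_ \o _) w]mulr1; exact: ind_norm.
    exact: finite_measure_integrable_cst.
  by rewrite (Rintegral_density (potential_density mp2 y) mI).
have setE (B : set T2) (f : T2 -> R) : measurable B -> mu2.-integrable setT (EFin \o f) ->
    (\int[mu2]_(w in B) (EFin \o f) w = (\int[mu2]_w (\1_B w * f w))%:E)%E.
  move=> mB fi; rewrite /Rintegral fineK; last first.
    apply: integrable_fin_num => //.
    apply: (@le_integrable_norm _ _ _ _ _ (fun w => `|f w|)).
    - by apply: measurable_funM; [exact: ind_measurable|exact: integrable_measurable fi].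
    - by move=> w; exact: ind_norm.
    - exact: integrable_norm fi.
  rewrite [LHS]integral_mkcond; apply: eq_integral => w _.
  rewrite patchE indicE; case: ifP => _ /=; first by rewrite mul1r.
  by rewrite mul0r.
have := @integral_ae_eq _ _ _ mu2 setT measurableT (EFin \o p2 y) (EFin \o (rho x y \* p2 x)) i2.
have mE : measurable_fun setT (EFin \o p2 y) by exact/measurable_EFinP.
move=> /(_ mE) h; have /h : forall E : set T2, E `<=` setT -> measurable E ->
    (\int[mu2]_(w in E) (EFin \o (rho x y \* p2 x)%R) w = \int[mu2]_(w in E) (EFin \o p2 y) w)%E.
  move=> E _ mB; rewrite !setE//; last exact: density_integrable (potential_density mp2 y).
  congr EFin; rewrite -(key _ mB); apply: eq_Rintegral => w _; by rewrite /= mulrA.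
by apply: filterS => w /(_ I) [].
Qed.

(** From [x] to [y], the logarithms of [p1] and of [p2] composed with [kappa] both grow by
    [ln (rho x y (kappa w))]. *)
Lemma dlog_sufficient_ae (x : M) (v : tangent x) :
  {ae param m1 x, forall w, dlog p1 v w = dlog p2 v (kappa w)}.
Proof.
apply: (density_ae (potential_density mp1 x)).
have regular2 := ae_image mu2E (potential_regular mp2).
apply: (@dlog_ae_eq _ _ _ _ _ p1 (fun x w => p2 x (kappa w))).
- by apply: filterS (potential_regular mp1) => w [].
- by apply: filterS regular2 => w [].
move=> y; have ratio := ae_image mu2E (image_density_ratio x y).
apply: filterS2 (filterI positive (rhoE x y)) (filterI regular2 ratio).
move=> w [p10 e1] [[p20 _] e2].
have r0 : 0 < rho x y (kappa w).
  by have := p10 y; rewrite e1 pmulr_lgt0.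
rewrite e1 -e2 (lnM r0 (p10 x)) (lnM r0 (p20 x)); ring.
Qed.

Lemma dlog_product_sufficient (x : M) (V : 'I_n.+1 -> tangent x) :
  dlog_product m1 p1 V = dlog_product m2 p2 V.
Proof.
have m2V := measurable_dlog_product V mp2.
have H (i : 'I_n.+1) := dlog_sufficient_ae (V i).
have e : {ae param m1 x, forall w, \prod_i dlog p1 (V i) w = \prod_i dlog p2 (V i) (kappa w)}.
  have : {ae param m1 x, forall w i, dlog p1 (V i) w = dlog p2 (V i) (kappa w)}.
    exact: filter_forall H.
  by apply: filterS => w e; apply: eq_bigr => i _; exact: e.
have mk := measurableT_comp m2V (@measurable_funPT _ _ _ _ kappa).
have i1 : (param m1 x).-integrable setT (EFin \o (fun w => \prod_i dlog p1 (V i) w)).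
  by apply: (@integrable_prod_fun _ _ _ _ _ xpredT) => j; exact: (dlog_Lfun mp1).
rewrite /dlog_product (ae_Rintegral _ _ e)//; last first.
  exact: measurable_dlog_product mp1.
symmetry; apply: (Rintegral_image (p2E x) m2V).
exact: ae_integrable mk e i1.
Qed.

End sufficient_statistics.

(** * Integrals of products of scores as invariant fields *)

Section dlog_product_field.
Context (R : realType) (n : nat).

(** A potential is picked by choice; two potentials of one model have almost everywhere equal
    scores, so the integral does not depend on it. *)
Definition product_field : tensor_family (R := R) n.+1 := fun M d T m x V =>
  dlog_product m (sval (cid (param_potential m))) V.

Definition product_form : Ln_family (R := R) n.+1 := monomial [:: xpredT].

Lemma product_field_potential M d (T : measurableType d) (m : measure_model n.+1 M T)
    (pbar : M -> T -> R) (x : M) (V : 'I_n.+1 -> tangent x) : potential m pbar ->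
  product_field m V = dlog_product m pbar V.
Proof. by apply: dlog_product_potential; exact: (svalP (cid (param_potential m))). Qed.

Lemma product_field_invariant P : local_invariant_field P product_field product_form.
Proof.
split.
- move=> M d T m _; have mp := svalP (cid (param_potential m)); split=> [x|V cV].
  + exact: dlog_product_multilinear.
  + exact: dlog_product_continuous.
- by move=> d T mu; apply: monomial_cml.
- move=> M d T m _ pbar mp x V; rewrite (product_field_potential V mp).
  by rewrite /product_form /monomial big_seq1.
- move=> M d1 d2 T1 T2 m1 m2 kappa _ [p1 [s [t [mp1 Ls _ factor]]]] image x V.
  rewrite (product_field_potential V mp1).
  apply: (@dlog_product_sufficient _ _ _ _ _ _ _ _ _ kappa _ _ s t) => //.
  + exact: (svalP (cid (param_potential m2))).
  + move=> y; have /Lfun1_integrable := Ls y; exact: integrable_measurable.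
Qed.

Lemma product_field_symmetric P : symmetric_field P product_field.
Proof.
move=> M d T m _ x s V; rewrite /product_field /dlog_product; apply: eq_Rintegral => w _.
by rewrite [RHS](reindex_inj (@perm_inj _ s)).
Qed.

End dlog_product_field.

(* The coefficient functions are evaluated at total masses. Continuity is
   claimed on ]0, +oo[ only: the local invariant 1-form field
   A(V)_x = d_V(ln \int dp(x)) has c(r) = 1 / r. *)
Theorem theorem2p10 (R : realType) :
  ((forall (A : tensor_family 1) (tau : Ln_family 1),
      local_invariant_field (@all_models R 1) A tau ->
      exists2 c : R -> R, {within `]0, +oo[, continuous c} &
        (forall d (Omega : measurableType d)
            (mu : {finite_measure set Omega -> \bar R}) (V : Omega -> R),
          V \in Lfun mu 1%E ->
          tau d Omega mu (fun=> V) = c (fine (mu setT)) * \int[mu]_o V o) /\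
        (forall M d (Omega : measurableType d) (m : measure_model 1 M Omega)
            (x : M) (v : tangent x),
          tangent_derivable (mass m) v /\
          A M d Omega m x (fun=> v) = c (mass m x) * tangent_derive (mass m) v))
   /\
   (forall (A : tensor_family 1) (tau : Ln_family 1),
      local_invariant_field (@statistical_models R 1) A tau ->
      forall M d (Omega : measurableType d) (m : measure_model 1 M Omega),
        is_statistical m ->
        forall (x : M) (V : 'I_1 -> tangent x), A M d Omega m x V = 0))
  /\
  ((forall (F : tensor_family 2) (tau : Ln_family 2),
      local_invariant_field (@all_models R 2) F tau ->
      symmetric_field (@all_models R 2) F ->
      exists f d : R -> R,
        [/\ {within `]0, +oo[, continuous f},
            {within `]0, +oo[, continuous d}
          & forall M disp (Omega : measurableType disp)
              (m : measure_model 2 M Omega) pbar, potential m pbar ->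
            forall x : M,
              (forall v : tangent x, is_tangent_derive (mass m) v
                 (\int[param m x]_o dlog pbar v o)) /\
              (forall V : 'I_2 -> tangent x,
                 F M disp Omega m x V =
                   f (mass m x) * fisher m pbar (V 0) (V 1)
                   + d (mass m x) * (tangent_derive (mass m) (V 0) *
                                     tangent_derive (mass m) (V 1))) ])
   /\
   (exists2 G : tensor_family 2,
      (exists tau, local_invariant_field (@statistical_models R 2) G tau) /\
      symmetric_field (@statistical_models R 2) G /\
      (forall M d (Omega : measurableType d) (m : measure_model 2 M Omega),
         is_statistical m -> forall pbar, potential m pbar ->
         forall (x : M) (V : 'I_2 -> tangent x),
           G M d Omega m x V = fisher m pbar (V 0) (V 1))
    & forall (F : tensor_family 2) (tau : Ln_family 2),
        local_invariant_field (@statistical_models R 2) F tau ->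
        symmetric_field (@statistical_models R 2) F ->
        exists a : R,
          forall M d (Omega : measurableType d) (m : measure_model 2 M Omega),
            is_statistical m ->
            forall (x : M) (V : 'I_2 -> tangent x),
              F M d Omega m x V = a * G M d Omega m x V))
  /\
  ((forall (T : tensor_family 3) (tau : Ln_family 3),
      local_invariant_field (@all_models R 3) T tau ->
      symmetric_field (@all_models R 3) T ->
      exists t c1 c2 : R -> R,
        [/\ {within `]0, +oo[, continuous t},
            {within `]0, +oo[, continuous c1},
            {within `]0, +oo[, continuous c2}
          & forall M d (Omega : measurableType d)
              (m : measure_model 3 M Omega) pbar, potential m pbar ->
            forall (x : M) (V : 'I_3 -> tangent x),
              (forall i, tangent_derivable (mass m) (V i)) /\
              T M d Omega m x V =
                t (mass m x) * amari_chentsov m pbar (V 0) (V 1) (V 2)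
                + \prod_(i < 3) mass_form c1 m (V i)
                + symmetric_product (mass_form c2 m (x := x))
                    (fisher m pbar (x := x)) (V 0) (V 1) (V 2) ])
   /\
   (exists2 G : tensor_family 3,
      (exists tau, local_invariant_field (@statistical_models R 3) G tau) /\
      symmetric_field (@statistical_models R 3) G /\
      (forall M d (Omega : measurableType d) (m : measure_model 3 M Omega),
         is_statistical m -> forall pbar, potential m pbar ->
         forall (x : M) (V : 'I_3 -> tangent x),
           G M d Omega m x V = amari_chentsov m pbar (V 0) (V 1) (V 2))
    & forall (T : tensor_family 3) (tau : Ln_family 3),
        local_invariant_field (@statistical_models R 3) T tau ->
        symmetric_field (@statistical_models R 3) T ->
        exists a : R,
          forall M d (Omega : measurableType d) (m : measure_model 3 M Omega),
            is_statistical m ->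
            forall (x : M) (V : 'I_3 -> tangent x),
              T M d Omega m x V = a * G M d Omega m x V)).
Proof.
have fisherE M d (Omega : measurableType d) (m : measure_model 2 M Omega) pbar
    (x : M) (V : 'I_2 -> tangent x) : potential m pbar ->
    @product_field R 1 M d Omega m x V = fisher m pbar (V 0) (V 1).
  move=> mp; rewrite (product_field_potential V mp).
  by apply: eq_Rintegral => w _; rewrite prod_ord2.
have amariE M d (Omega : measurableType d) (m : measure_model 3 M Omega) pbar
    (x : M) (V : 'I_3 -> tangent x) : potential m pbar ->
    @product_field R 2 M d Omega m x V = amari_chentsov m pbar (V 0) (V 1) (V 2).
  move=> mp; rewrite (product_field_potential V mp).
  by apply: eq_Rintegral => w _; rewrite prod_ord3.
split; [|split].
- by split; [exact: invariant_1form|exact: statistical_1form_eq0].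
- split; first exact: invariant_quadratic_form.
  exists (@product_field R 1).
    split; first by exists (@product_form R 1); exact: product_field_invariant.
    split; first exact: product_field_symmetric.
    by move=> M d Omega m _ pbar mp x V; exact: fisherE.
  move=> F tau F_inv _; have [a aP] := statistical_quadratic_form F_inv.
  exists a => M d Omega m st x V; have [pbar mp] := param_potential m.
  by rewrite (aP _ _ _ _ pbar)// (fisherE _ _ _ _ pbar).
- split; first exact: invariant_cubic_form.
  exists (@product_field R 2).
    split; first by exists (@product_form R 2); exact: product_field_invariant.
    split; first exact: product_field_symmetric.
    by move=> M d Omega m _ pbar mp x V; exact: amariE.
  move=> F tau F_inv F_sym; have [a aP] := statistical_cubic_form F_inv F_sym.
  exists a => M d Omega m st x V; have [pbar mp] := param_potential m.
  by rewrite (aP _ _ _ _ pbar)// (amariE _ _ _ _ pbar).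
Qed.
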